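(* (Symplectic Witt via Stiefel–Whitney) Let $\mathbf{k}=\mathbb{C}$, let $G$ be a finite group, $\mathcal{C}=\operatorname{Rep}(G)\boxtimes\mathrm{sVec}$, $\Gamma=G\times\mathbb{Z}/2$ with $\mathbb{Z}/2$ generated by $t$, and put $A:=H^2(G,\mathbf{k}^\times)$, $K:=\operatorname{Hom}(G,\mathbb{Z}/2)=H^1(G,\mathbb{Z}/2)$. Let $\Theta:H^2(\Gamma,\mathbf{k}^\times)\xrightarrow{\sim}A\times K$ be the Künneth isomorphism, let $\mathcal{SW}_+(\mathcal{C})\subset H^2_*(\Gamma,\mathbf{k}^\times)$ be the subgroup generated (for the modified multiplication $*$) by the classes $\beta_X$ of orthogonal representations $X$ of $G$, and let $\mathcal{SW}(G)\subset A[2]$ be the Stiefel–Whitney subgroup of $G$. Then under $\Theta$ one has $$\mathcal{SW}_+(\mathcal{C})=\mathcal{SW}(G)\times K$$ as a set. In particular, $\mathcal{SW}_+(\mathcal{C})$ is also a subgroup of $H^2(\Gamma,\mathbf{k}^\times)$ for the ordinary multiplication. Moreover, let $$D(G):=\left\langle j(\chi\smile\eta)\ \middle|\ \chi,\eta\in K\right\rangle\subset A.$$ Then $D(G)\subset\mathcal{SW}(G)$, and $$L:=D(G)\times K\subset\mathcal{SW}_+(\mathcal{C})$$ is a subgroup for the modified multiplication. Namely, it is the subgroup generated by the elements $(1,\chi)$, $\chi\in K$.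
   Context: All cohomology is group cohomology with trivial action. $H^2_*(\Gamma,\mathbf{k}^\times)$ is the set $H^2(\Gamma,\mathbf{k}^\times)$ with the modified multiplication defined on 2-cocycles by $$(\beta*\gamma)(x,y)=(-1)^{\varepsilon_\beta(x)\varepsilon_\gamma(y)}\beta(x,y)\gamma(x,y),$$ where $\varepsilon_\beta:\Gamma\to\mathbb{Z}/2$ is the homomorphism with $(-1)^{\varepsilon_\beta(x)}=\beta(x,t)/\beta(t,x)$. The Künneth isomorphism (for ordinary multiplication) is $$\Theta([c])=\left([c|_{G\times G}],\ g\mapsto\frac{c(t,g)}{c(g,t)}\right)\in H^2(G,\mathbf{k}^\times)\times\operatorname{Hom}(G,\mu_2),$$ with $\operatorname{Hom}(G,\mu_2)$ identified with $K$. The modified multiplication on $A\times K$ is the one transported by $\Theta$. An orthogonal representation of $G$ is a finite-dimensional complex representation $\rho:G\to O(X)$ preserving a non-degenerate symmetric bilinear form. Let $\widetilde X:=X_-\oplus\mathbf{k}_-^{\dim X}$, where the subscript $-$ means that $t$ acts by $-1$ and $\mathbf{k}$ is the trivial representation of $G$ with its standard form; thus $\Gamma$ acts by $\widetilde\rho(g,t^a)=(-1)^a(\rho(g)\oplus\mathrm{id}_{\mathbf{k}^{\dim X}})\in O(\widetilde X)$. The class $\beta_X\in H^2_*(\Gamma,\mathbf{k}^\times)$ is the pullback by $\widetilde\rho$ of the central extension $1\to\mathbf{k}^\times\to\mathrm{Cliff}(\widetilde X)\to O(\widetilde X)\to1$, where $\mathrm{Cliff}(\widetilde X)$ is the Clifford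 group (homogeneous invertible elements $u$ of the Clifford algebra with $u\widetilde Xu^{-1}=\widetilde X$), mapping to $O(\widetilde X)$ by the twisted adjoint action $v\mapsto(-1)^{|u|}uvu^{-1}$. Let $j:H^2(G,\mathbb{Z}/2)\to H^2(G,\mathbf{k}^\times)$ be induced by the inclusion $\mathbb{Z}/2\cong\mu_2\hookrightarrow\mathbf{k}^\times$. For an orthogonal representation $X$, let $w_1(X)\in K$ and $w_2(X)\in H^2(G,\mathbb{Z}/2)$ be the Stiefel–Whitney classes of $X$, i.e. of the associated orthogonal vector bundle on $BG$ (equivalently, of the corresponding real orthogonal representation), and put $b_G(X):=j(w_2(X))\in A[2]$, where $A[2]$ is the 2-torsion subgroup of $A$. The Stiefel–Whitney subgroup of $G$ is $\mathcal{SW}(G):=\langle b_G(X)\mid X\text{ an orthogonal representation of }G\rangle\subset A[2]$. *)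

(* Defs.v *)
From HB Require Import structures.
From mathcomp Require Import all_boot all_order all_algebra all_fingroup.
From mathcomp Require Import ssrAC generic_quotient ring_quotient.
From mathcomp Require Import all_classical all_reals.
From mathcomp Require Import complex ring.

Set Implicit Arguments.
Unset Strict Implicit.
Unset Printing Implicit Defensive.

Import Order.TTheory GRing.Theory Num.Theory.

Local Open Scope ring_scope.
Local Open Scope quotient_scope.
Local Open Scope complex_scope.
Local Open Scope classical_set_scope.

(* Group cohomology of degree 1 and 2 of an arbitrary (possibly infinite)
   group, with trivial action on the abelian group of coefficients, which is
   always written additively. *)

Section Cohomology.
Variables (Gam : groupType) (M : zmodType).

Definition is_hom (f : Gam -> M) : Prop :=
  forall x y, f (x * y)%g = f x + f y.

Definition is_cocycle (c : Gam -> Gam -> M) : Prop :=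
  forall x y z, c y z - c (x * y)%g z + c x (y * z)%g - c x y = 0.

Definition hom_pred : pred (Gam -> M) := fun f => `[< is_hom f >].
Definition cocycle_pred : pred (Gam -> Gam -> M) := fun c => `[< is_cocycle c >].

Fact hom_zmod_closed : zmod_closed hom_pred.
Proof.
split; first by apply/asboolP => x y; rewrite addr0.
move=> f g /asboolP hf /asboolP hg; apply/asboolP => x y.
by rewrite !fctE hf hg opprD addrACA.
Qed.
HB.instance Definition _ :=
  GRing.isZmodClosed.Build (Gam -> M) hom_pred hom_zmod_closed.

Fact cocycle_zmod_closed : zmod_closed cocycle_pred.
Proof.
split; first by apply/asboolP => x y z; rewrite (subr0 0) (addr0 0) (subr0 0).
move=> f g /asboolP hf /asboolP hg; apply/asboolP => x y z.
rewrite !fctE !opprB -[RHS](subrr 0) -{1}(hf x y z) -(hg x y z).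
by rewrite !opprD !opprK (AC (((2*2)*2)*2) ((1*4*5*8)*(2*3*6*7))).
Qed.
HB.instance Definition _ :=
  GRing.isZmodClosed.Build (Gam -> Gam -> M) cocycle_pred cocycle_zmod_closed.

(* For a trivial action, H^1 is the group of homomorphisms. *)
Record H1 := MkH1 { H1fun :> Gam -> M; _ : H1fun \in hom_pred }.
HB.instance Definition _ := [isSub for H1fun].
HB.instance Definition _ := [Choice of H1 by <:].
HB.instance Definition _ := [SubChoice_isSubZmodule of H1 by <:].

Record Z2 := MkZ2 { Z2fun :> Gam -> Gam -> M; _ : Z2fun \in cocycle_pred }.
HB.instance Definition _ := [isSub for Z2fun].
HB.instance Definition _ := [Choice of Z2 by <:].
HB.instance Definition _ := [SubChoice_isSubZmodule of Z2 by <:].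

Definition is_coboundary (c : Gam -> Gam -> M) : Prop :=
  exists f : Gam -> M, forall x y, c x y = f y - f (x * y)%g + f x.

Definition B2 : pred Z2 := fun c => `[< is_coboundary c >].

Fact B2_zmod_closed : zmod_closed B2.
Proof.
split; first by apply/asboolP; exists 0 => x y; rewrite (subr0 0) (addr0 0).
move=> f g /asboolP[F hF] /asboolP[K hK]; apply/asboolP; exists (F - K) => x y.
have -> : (f - g) x y = f x y - g x y by [].
by rewrite !fctE hF hK !opprD !opprK (AC (3*3) ((1*4)*(2*5)*(3*6))).
Qed.
HB.instance Definition _ := GRing.isZmodClosed.Build Z2 B2 B2_zmod_closed.

Definition H2 := Quotient.quot (GRing.ZmodClosed.clone Z2 B2 _).
HB.instance Definition _ := GRing.Zmodule.on H2.
Definition cls (c : Z2) : H2 := \pi c.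

Lemma H1P (f : H1) : is_hom f. Proof. by case: f => f hf; apply/asboolP. Qed.
Lemma Z2P (c : Z2) : is_cocycle c. Proof. by case: c => c hc; apply/asboolP. Qed.

Lemma cls_eqP (c d : Z2) : reflect (is_coboundary (c - d)) (cls c == cls d).
Proof.
have -> : (cls c == cls d) = ((c - d) \in (B2 : {pred Z2})).
  by rewrite Quotient.idealrBE.
exact: asboolP.
Qed.

Lemma clsP (c d : Z2) : is_coboundary (c - d) -> cls c = cls d.
Proof. by move=> h; apply/eqP/cls_eqP. Qed.

Lemma clsD (c d : Z2) : cls (c + d) = cls c + cls d.
Proof. by rewrite /cls piE. Qed.

Lemma clsN (c : Z2) : cls (- c) = - cls c.
Proof. by rewrite /cls piE. Qed.

Lemma cls_repr (a : H2) : cls (repr a) = a.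
Proof. exact: reprK. Qed.

Definition mkH1 (f : Gam -> M) (hf : is_hom f) : H1 := MkH1 (asboolT hf).
Definition mkZ2 (c : Gam -> Gam -> M) (hc : is_cocycle c) : Z2 :=
  MkZ2 (asboolT hc).

End Cohomology.

Arguments cls {Gam M} c.

Section Functoriality.
Variable M : zmodType.

Section Pullback.
Variables (Gam Del : groupType) (phi : {multiplicative Del -> Gam}).

Fact H1_pull_subproof (f : H1 Gam M) : is_hom (fun x => f (phi x)).
Proof. by move=> x y; rewrite gmulfM H1P. Qed.
Definition H1_pull (f : H1 Gam M) : H1 Del M := mkH1 (H1_pull_subproof f).

Fact Z2_pull_subproof (c : Z2 Gam M) : is_cocycle (fun x y => c (phi x) (phi y)).
Proof. by move=> x y z; rewrite !gmulfM Z2P. Qed.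
Definition Z2_pull (c : Z2 Gam M) : Z2 Del M := mkZ2 (Z2_pull_subproof c).

Definition H2_pull (a : H2 Gam M) : H2 Del M := cls (Z2_pull (repr a)).

Lemma H2_pull_cls (c : Z2 Gam M) : H2_pull (cls c) = cls (Z2_pull c).
Proof.
have /eqP/cls_eqP[f hf] := cls_repr (cls c).
apply: clsP; exists (fun x => f (phi x)) => x y.
by rewrite gmulfM -hf.
Qed.

End Pullback.

Section Coefficients.
Variables (Gam : groupType) (N : zmodType) (h : {additive M -> N}).

Fact Z2_map_subproof (c : Z2 Gam M) : is_cocycle (fun x y => h (c x y)).
Proof. by move=> x y z; rewrite -raddfB -raddfD -raddfB Z2P raddf0. Qed.
Definition Z2_map (c : Z2 Gam M) : Z2 Gam N := mkZ2 (Z2_map_subproof c).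

Definition H2_map (a : H2 Gam M) : H2 Gam N := cls (Z2_map (repr a)).

Lemma H2_map_cls (c : Z2 Gam M) : H2_map (cls c) = cls (Z2_map c).
Proof.
have /eqP/cls_eqP[f hf] := cls_repr (cls c).
apply: clsP; exists (fun x => h (f x)) => x y.
transitivity (h ((repr (cls c) - c) x y)); first by rewrite [RHS]raddfB.
by rewrite hf raddfD raddfB.
Qed.

End Coefficients.
End Functoriality.

Section Cup.
Variable Gam : groupType.

Fact cup_cocycle_subproof (f g : H1 Gam 'Z_2) :
  is_cocycle (fun x y => f x * g y).
Proof.
by move=> x y z; rewrite !H1P; ring.
Qed.
Definition cup_cocycle (f g : H1 Gam 'Z_2) : Z2 Gam 'Z_2 :=
  mkZ2 (cup_cocycle_subproof f g).
Definition cup (f g : H1 Gam 'Z_2) : H2 Gam 'Z_2 := cls (cup_cocycle f g).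

End Cup.

(* The multiplicative group of a field, as an additive group of coefficients:
   [x + y] stands for the product, [- x] for the inverse and [0] for 1. *)
Section FieldUnits.
Variable F : fieldType.

Record funit := Funit { fval :> F; fvalP : fval != 0 }.
HB.instance Definition _ := [isSub for fval].
HB.instance Definition _ := [Choice of funit by <:].

Definition funit_one : funit := Funit (oner_neq0 F).
Fact funit_inv_subproof (x : funit) : (fval x)^-1 != 0.
Proof. by rewrite invr_eq0 fvalP. Qed.
Definition funit_inv (x : funit) : funit := Funit (funit_inv_subproof x).
Fact funit_mul_subproof (x y : funit) : fval x * fval y != 0.
Proof. by rewrite mulf_neq0 ?fvalP. Qed.
Definition funit_mul (x y : funit) : funit := Funit (funit_mul_subproof x y).

Fact funit_mulA : associative funit_mul.
Proof. by move=> x y z; apply: val_inj; rewrite /= mulrA. Qed.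
Fact funit_mulC : commutative funit_mul.
Proof. by move=> x y; apply: val_inj; rewrite /= mulrC. Qed.
Fact funit_mul1 : left_id funit_one funit_mul.
Proof. by move=> x; apply: val_inj; rewrite /= mul1r. Qed.
Fact funit_mulV : left_inverse funit_one funit_inv funit_mul.
Proof. by move=> x; apply: val_inj; rewrite /= mulVf ?fvalP. Qed.
HB.instance Definition _ :=
  GRing.isZmodule.Build funit funit_mulA funit_mulC funit_mul1 funit_mulV.

Lemma fval0 : fval 0 = 1. Proof. by []. Qed.
Lemma fvalD x y : fval (x + y) = fval x * fval y. Proof. by []. Qed.
Lemma fvalN x : fval (- x) = (fval x)^-1. Proof. by []. Qed.

(* The isomorphism of Z/2 with mu_2 = {1, -1}. *)
Fact sgn_subproof (a : 'Z_2) : (-1 : F) ^+ a != 0.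
Proof. by rewrite expf_neq0 // oppr_eq0 oner_neq0. Qed.
Definition sgn (a : 'Z_2) : funit := Funit (sgn_subproof a).

Fact sgn_additive : zmod_morphism sgn.
Proof.
move=> a b; apply: val_inj.
change ((-1 : F) ^+ (a - b)%R = (-1) ^+ a * ((-1) ^+ b)^-1).
by case: a => [[|[|]]] // ?; case: b => [[|[|]]] // ?;
  rewrite /= ?expr0 ?expr1 ?invr1 ?invrN1 ?mulr1 ?mul1r ?mulrNN ?mulr1.
Qed.
HB.instance Definition _ :=
  GRing.isZmodMorphism.Build 'Z_2 funit sgn sgn_additive.

End FieldUnits.

Section CocycleIdentities.
Variables (Gam : groupType) (M : zmodType) (c : Z2 Gam M).

Lemma cocycleE x y z : c (x * y)%g z = c y z + c x (y * z)%g - c x y.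
Proof.
apply/eqP; rewrite eq_sym -subr_eq0 -[X in _ == X](Z2P c x y z); apply/eqP.
by rewrite (AC (3*1) (1*4*2*3)).
Qed.

Lemma cocycle1g x : c 1%g x = c 1%g 1%g.
Proof.
have := cocycleE 1 1 x; rewrite !mul1g => /(congr1 (fun z => z - c 1%g x)).
by rewrite subrr addrAC addrK => /esym/eqP; rewrite subr_eq0 => /eqP.
Qed.

Lemma cocycleg1 x : c x 1%g = c 1%g 1%g.
Proof.
have := cocycleE x 1 1; rewrite !mulg1 => /(congr1 (fun z => z - c x 1%g)).
by rewrite subrr addrK => /esym/eqP; rewrite subr_eq0 => /eqP.
Qed.

Lemma commuting_pairingM t x y : commute x t -> commute y t ->
  c (x * y)%g t - c t (x * y)%g = (c x t - c t x) + (c y t - c t y).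
Proof.
move=> cx cy; have e2 : c t (x * y)%g = c (t * x)%g y + c t x - c x y.
  by rewrite cocycleE subrK addrAC subrr add0r.
have e3 : c x (t * y)%g = c (x * t)%g y - c t y + c x t.
  by rewrite cocycleE (AC (3*1*1) (2*(1*4)*(3*5))) /= subrr addNr !addr0.
rewrite cocycleE cy e2 e3 cx !opprD !opprK.
by rewrite (AC ((1*3)*1*3) (((4*7)*(1*3))*(2*6)*(5*8))) /= subrr addNr !addr0.
Qed.

End CocycleIdentities.

(* G x Z/2, the group Z/2 being the additive group of 'Z_2. *)
Section TimesZ2.
Variable G : groupType.
Local Notation Gam := (G * 'Z_2)%type.

Definition tgen : Gam := (1%g, 1%R).
Definition incl (g : G) : Gam := (g, 0).

Lemma GamM (x y : Gam) : (x * y)%g = (x.1 * y.1, x.2 + y.2)%g.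
Proof. by []. Qed.

Fact incl_multiplicative : {morph incl : x y / (x * y)%g}.
Proof. by move=> x y; rewrite GamM /= addr0. Qed.
HB.instance Definition _ :=
  isMultiplicative.Build G Gam incl incl_multiplicative.

Lemma tgen_central (x : Gam) : commute x tgen.
Proof. by rewrite /commute !GamM mulg1 mul1g addrC. Qed.

Lemma tgen2 : (tgen * tgen = 1)%g.
Proof. by rewrite GamM mulg1; congr pair; apply: val_inj. Qed.

Lemma inclt (g : G) : (incl g * tgen = (g, 1%R))%g.
Proof. by rewrite GamM /= mulg1 add0r. Qed.

Lemma Z2_case (a : 'Z_2) : a = 0 \/ a = 1.
Proof. by case: a => [[|[|]]] // i; [left|right]; apply: val_inj. Qed.

Lemma GamE (x : Gam) : x = incl x.1 \/ x = (incl x.1 * tgen)%g.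
Proof. by rewrite inclt; case: x => g a /=; case: (Z2_case a) => ->; [left|right]. Qed.

Fact proj2_subproof : is_hom (fun x : Gam => x.2).
Proof. by []. Qed.
Definition proj2 : H1 Gam 'Z_2 := mkH1 proj2_subproof.

End TimesZ2.

Section Kunneth.
Variables (F : numClosedFieldType) (G : groupType).
Local Notation kx := (funit F).
Local Notation Gam := (G * 'Z_2)%type.
Local Notation t := (tgen G).

Lemma sgn_inj : injective (@sgn F).
Proof.
suff h (a : 'Z_2) : sgn F a = 0 -> a = 0.
  by move=> a b e; apply/eqP; rewrite -subr_eq0; apply/eqP/h; rewrite raddfB /= e subrr.
case: (Z2_case a) => [->//|->] /(congr1 (@fval F)) /= /eqP.
by rewrite expr1 eqNr oner_eq0.
Qed.

Lemma funit_2torsion (u : kx) : u + u = 0 -> u = 0 \/ u = sgn F 1.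
Proof.
move=> /(congr1 (@fval F)); rewrite fvalD fval0 => /eqP.
rewrite -expr2 sqrf_eq1 => /orP[]/eqP e; [left|right]; exact: val_inj.
Qed.

Lemma funit_half (u : kx) : exists v : kx, v + v = u.
Proof.
have nz : sqrtC (fval u) != 0 by rewrite sqrtC_eq0 fvalP.
by exists (Funit nz); apply: val_inj; rewrite /= -expr2 sqrtCK.
Qed.

(* The identification of mu_2 with Z/2 inverse to [sgn]. *)
Definition sgnlog (u : kx) : 'Z_2 := if u == 0 then 0 else 1.

Lemma sgnlogK (u : kx) : u + u = 0 -> sgn F (sgnlog u) = u.
Proof.
rewrite /sgnlog; case: eqP => [->|ne]; first by rewrite raddf0.
by move=> /funit_2torsion [|->].
Qed.

Definition pairing_t (c : Z2 Gam kx) (x : Gam) : kx := c x t - c t x.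

Lemma pairing_t2 c x : pairing_t c x + pairing_t c x = 0.
Proof.
rewrite /pairing_t -[_ - _]opprB -opprD -commuting_pairingM; try exact/esym/tgen_central.
by rewrite tgen2 cocycle1g cocycleg1 subrr oppr0.
Qed.

Definition eps_fun (c : Z2 Gam kx) (x : Gam) : 'Z_2 := sgnlog (pairing_t c x).

Lemma sgn_eps_fun c x : sgn F (eps_fun c x) = pairing_t c x.
Proof. by rewrite sgnlogK // pairing_t2. Qed.

Fact eps_subproof c : is_hom (eps_fun c).
Proof.
move=> x y; apply: sgn_inj; rewrite raddfD /= !sgn_eps_fun.
exact: commuting_pairingM (tgen_central x) (tgen_central y).
Qed.

Definition eps (c : Z2 Gam kx) : H1 Gam 'Z_2 := mkH1 (eps_subproof c).

Lemma epsP c x : sgn F (eps c x) = c x t - c t x.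
Proof. exact: sgn_eps_fun. Qed.

Lemma eps_cls c d : cls c = cls d -> eps c = eps d.
Proof.
move=> /eqP/cls_eqP[f hf]; apply: val_inj; apply/funext => x /=.
apply: sgn_inj; rewrite !sgn_eps_fun; apply/eqP; rewrite -subr_eq0.
have -> : pairing_t c x - pairing_t d x = (c - d) x t - (c - d) t x.
  rewrite -[(c - d) x t]/(c x t - d x t) -[(c - d) t x]/(c t x - d t x).
  by rewrite /pairing_t !opprD !opprK (AC (2*2) ((1*3)*(2*4))).
by rewrite !hf tgen_central [X in X - _](AC 3 (3*2*1)) /= subrr.
Qed.

Lemma epsD c d : eps (c + d) = eps c + eps d.
Proof.
apply: val_inj; apply/funext => x /=; apply: sgn_inj.
rewrite [RHS](raddfD (@sgn F)) /= !sgn_eps_fun /pairing_t.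
by rewrite [LHS](_ : _ = c x t + d x t - (c t x + d t x)) // opprD addrACA.
Qed.

(* The modified multiplication of 2-cocycles, and the abelian group law that it
   induces on classes; its neutral element is the trivial class 0. *)
Definition star_cocycle (b c : Z2 Gam kx) : Z2 Gam kx :=
  b + c + Z2_map (@sgn F) (cup_cocycle (eps b) (eps c)).

Lemma star_cocycleE b c x y :
  fval (star_cocycle b c x y) = (-1) ^+ (eps b x * eps c y)%R * fval (b x y) * fval (c x y).
Proof. by rewrite -mulrA mulrC. Qed.

Definition star (a b : H2 Gam kx) : H2 Gam kx :=
  cls (star_cocycle (repr a) (repr b)).

Lemma star_cls b c : star (cls b) (cls c) = cls (star_cocycle b c).
Proof.
by rewrite /star /star_cocycle !clsD !cls_repr !(eps_cls (cls_repr (cls _))).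
Qed.

Lemma eps_t b : eps b t = 0.
Proof. by apply: sgn_inj; rewrite epsP subrr raddf0. Qed.

Lemma eps_cup b c : eps (Z2_map (@sgn F) (cup_cocycle (eps b) (eps c))) = 0.
Proof.
apply: val_inj; apply/funext => x; apply: sgn_inj; rewrite [LHS]epsP.
rewrite -[LHS]/(sgn F (eps b x * eps c t) - sgn F (eps b t * eps c x)).
by rewrite !eps_t mulr0 mul0r subrr raddf0.
Qed.

Lemma eps_star b c : eps (star_cocycle b c) = eps b + eps c.
Proof. by rewrite /star_cocycle !epsD eps_cup addr0. Qed.

Lemma starA : associative star.
Proof.
move=> a b c; rewrite -[a]cls_repr -[b]cls_repr -[c]cls_repr !star_cls.
congr cls; apply: val_inj; apply/funext => x; apply/funext => y.
move: (repr a) (repr b) (repr c) => {a b c} a b c.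
rewrite -[LHS]/(a x y + (b x y + c x y + sgn F (eps b x * eps c y))
                + sgn F (eps a x * eps (star_cocycle b c) y)).
rewrite -[RHS]/(a x y + b x y + sgn F (eps a x * eps b y) + c x y
                + sgn F (eps (star_cocycle a b) x * eps c y)).
rewrite !eps_star.
rewrite -[X in _ = _ + sgn F (X * _)]/(eps a x + eps b x).
rewrite -[X in _ + sgn F (_ * X) = _]/(eps b y + eps c y).
rewrite mulrDl mulrDr !raddfD /=.
by rewrite [LHS](AC ((1*3)*2) ((1*2*5*3)*(6*4))).
Qed.

Lemma star0r : left_id 0 star.
Proof.
move=> a; rewrite -[a]cls_repr; move: (repr a) => {a} a.
have -> : 0 = cls 0 :> H2 Gam kx by rewrite /cls piE.
rewrite star_cls; congr cls; apply: val_inj; apply/funext => x; apply/funext => y.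
have e0 : eps 0 x = 0 by apply: sgn_inj; rewrite epsP subrr raddf0.
by rewrite -[LHS]/(0 + a x y + sgn F (eps 0 x * eps a y)) e0 mul0r raddf0 add0r addr0.
Qed.

Lemma starC : commutative star.
Proof.
move=> a b; rewrite -[a]cls_repr -[b]cls_repr !star_cls.
move: (repr a) (repr b) => {a b} a b; apply: clsP.
exists (fun x => sgn F (eps a x * eps b x)) => x y.
rewrite -[LHS]/(a x y + b x y + sgn F (eps a x * eps b y)
  - (b x y + a x y + sgn F (eps b x * eps a y))).
rewrite [b x y + _]addrC opprD addrACA subrr add0r.
rewrite -[LHS]raddfB -raddfB -raddfD; congr (sgn F _); rewrite !H1P.
have opp2 (u : 'Z_2) : u = - u by case: (Z2_case u) => ->; apply: val_inj.
by rewrite [eps a x * eps b y]opp2; ring.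
Qed.

Lemma starV a : exists b, star a b = 0.
Proof.
rewrite -[a]cls_repr; move: (repr a) => {a} a.
pose s := Z2_map (@sgn F) (cup_cocycle (eps a) (eps a)).
exists (cls (s - a)); rewrite star_cls.
have -> : 0 = cls 0 :> H2 Gam kx by rewrite /cls piE.
congr cls; rewrite /star_cocycle; have -> : eps (s - a) = eps a.
  have e : eps (s - a) + eps a = 0 by rewrite -epsD subrK eps_cup.
  apply: val_inj; apply/funext => x; apply: sgn_inj.
  apply: (addIr (sgn F (eps a x))); rewrite -!raddfD /=.
  rewrite -[X in sgn F X]/((eps (s - a) + eps a) x) e.
  by case: (Z2_case (eps a x)) => /= ->; congr (sgn F _); apply: val_inj.
rewrite -/s (addrC a) subrK; apply: val_inj.
apply/funext => x; apply/funext => y; rewrite -[LHS]/(s x y + s x y).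
rewrite -[LHS]raddfD /=; case: (Z2_case (eps a x * eps a y)) => ->; exact: val_inj.
Qed.

(* The second component is g |-> c(g, t) / c(t, g), which is its own inverse,
   read in Z/2; see [sgn_Theta2]. *)
Definition Theta (a : H2 Gam kx) : H2 G kx * H1 G 'Z_2 :=
  (H2_pull (@incl G) a, H1_pull (@incl G) (eps (repr a))).

Lemma Theta_cls c :
  Theta (cls c) = (cls (Z2_pull (@incl G) c), H1_pull (@incl G) (eps c)).
Proof. by rewrite /Theta H2_pull_cls (eps_cls (cls_repr (cls _))). Qed.

Lemma sgn_Theta2 c g :
  sgn F ((Theta (cls c)).2 g) = c t (incl g) - c (incl g) t.
Proof.
rewrite Theta_cls /= epsP -[RHS]opprB; apply/eqP.
by rewrite -addr_eq0 pairing_t2.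
Qed.

Fact Theta_additive : zmod_morphism Theta.
Proof.
suff D a b : Theta (a + b) = Theta a + Theta b.
  by move=> a b; apply: (addIr (Theta b)); rewrite -D !subrK.
rewrite -[a]cls_repr -[b]cls_repr -clsD !Theta_cls epsD; congr pair.
  by rewrite -clsD; congr cls; apply: val_inj.
by apply: val_inj.
Qed.
HB.instance Definition _ := GRing.isZmodMorphism.Build
  (H2 Gam kx) (H2 G kx * H1 G 'Z_2)%type Theta Theta_additive.

Fact Theta_inj : injective Theta.
Proof.
suff ker a : Theta a = 0 -> a = 0.
  by move=> a b e; apply/eqP; rewrite -subr_eq0; apply/eqP/ker; rewrite raddfB /= e subrr.
rewrite -[a]cls_repr; move: (repr a) => {a} c; rewrite Theta_cls => -[e1 e2].
have /eqP/cls_eqP[f hf] : cls (Z2_pull (@incl G) c) = cls 0.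
  by rewrite e1 /cls piE.
have {}hf g h : c (incl g) (incl h) = f h - f (g * h)%g + f g.
  by rewrite -hf -[RHS]/(_ - 0) subr0.
have ct g : c (incl g) t = c t (incl g).
  apply/eqP; rewrite -subr_eq0 -epsP.
  by rewrite (_ : eps c (incl g) = 0) ?raddf0 //; exact: (congr1 (fun f => f g) e2).
have [tau htau] := funit_half (c t t + f 1%g).
pose k (x : Gam) : kx :=
  if x.2 == 0 then f x.1 else f x.1 + tau - c (incl x.1) t.
have k0 g : k (incl g) = f g by [].
have k1 g : k (incl g * t)%g = f g + tau - c (incl g) t by rewrite inclt.
have incl1 : incl (1%g : G) = 1%g by [].
have c1 : c 1%g 1%g = f 1%g by rewrite -incl1 hf mulg1 subrr add0r.
have kt : k t = tau.
  by rewrite -[t]mul1g -incl1 k1 incl1 cocycle1g c1 addrAC subrr add0r.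
have hk : is_cocycle (fun x y => k y - k (x * y)%g + k x).
  move=> x y z; rewrite !mulgA !opprD !opprK.
  rewrite (AC (3*3*3*3) ((1*4)*(2*7)*(3*10)*(5*8)*(6*11)*(9*12))) /=.
  by rewrite !(addrN, addNr, addr0).
pose d := c - mkZ2 hk.
have dE x y : d x y = c x y - (k y - k (x * y)%g + k x) by [].
suff d0 : d = 0.
  rewrite -[RHS](subrr (cls c)) -clsN -clsD subrr; apply: clsP; exists k => x y.
  rewrite subr0 -[LHS](addrNK (k y - k (x * y)%g + k x)).
  by rewrite -dE d0 add0r.
have dgh g h : d (incl g) (incl h) = 0.
  by rewrite dE -gmulfM !k0 hf subrr.
have dgt g : d (incl g) t = 0.
  rewrite dE k1 kt k0 !opprD !opprK.
  by rewrite (AC (1*((1*3)*1)) ((1*5)*(2*4)*(3*6))) /= !(addrN, addNr, addr0).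
have dtg g : d t (incl g) = 0.
  rewrite -(dgt g) !dE ct tgen_central; congr (_ - _).
  by rewrite [RHS](AC 3 (3*2*1)).
have dtt : d t t = 0.
  rewrite dE tgen2 -incl1 k0 kt; apply/eqP; rewrite subr_eq0 addrAC htau addrK.
  by rewrite eqxx.
have d1 x : d x 1%g = 0 by rewrite cocycleg1 -incl1 dgh.
have dxt x : d x t = 0.
  case: (GamE x) => -> //.
  by rewrite cocycleE tgen2 dtt d1 dgt subr0 addr0.
have dxh x h : d x (incl h) = 0.
  case: (GamE x) => -> //.
  by rewrite tgen_central cocycleE -gmulfM dgh !dtg subr0 addr0.
apply: val_inj; apply/funext => x; apply/funext => y /=.
case: (GamE y) => ->; [exact: dxh | move: y.1 => h].
have := cocycleE d x (incl h) t; rewrite !dxt dxh add0r subr0.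
exact: esym.
Qed.

Fact Theta_surj : set_surj setT setT Theta.
Proof.
move=> [a chi] _; exists (cls (Z2_pull fst (repr a)
  + Z2_map (@sgn F) (cup_cocycle (H1_pull fst chi) (proj2 G)))) => //.
rewrite Theta_cls; congr pair.
  rewrite -[RHS]cls_repr; congr cls; apply: val_inj.
  apply/funext => g; apply/funext => h /=.
  by rewrite -[LHS]/(_ + sgn F (chi g * 0)) mulr0 raddf0 addr0.
apply: val_inj; apply/funext => g /=; apply: sgn_inj; rewrite sgn_eps_fun.
rewrite /pairing_t -[X in X - _]/(repr a g 1%g + sgn F (chi g * 1)).
rewrite -[X in _ - X]/(repr a 1%g g + sgn F (chi 1%g * 0)).
by rewrite cocycleg1 cocycle1g mulr0 raddf0 addr0 mulr1 addrAC subrr add0r.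
Qed.

Lemma Theta_bij : bijective Theta.
Proof.
by rewrite -setTT_bijective; split=> //; [move=> x y _ _; apply: Theta_inj | apply: Theta_surj].
Qed.

End Kunneth.
(* Subgroups of a group given by its product [op] and neutral element [e]. *)
Definition is_subgroup (T : Type) (op : T -> T -> T) (e : T) (H : set T) : Prop :=
  [/\ H e, forall x y, H x -> H y -> H (op x y)
    & forall x, H x -> exists2 y, H y & op x y = e].

Definition subgroup_generated (T : Type) (op : T -> T -> T) (e : T) (S : set T) : set T :=
  smallest (is_subgroup op e) S.

(* Orthogonal representations on F^n (column vectors) for the bilinear form
   (u, v) |-> u^T *m oform *m v. *)
Record orth_rep (F : fieldType) (Gam : groupType) (n : nat) := OrthRep {
  oform : 'M[F]_n;
  omx :> Gam -> 'M[F]_n;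
  oform_sym : oform^T = oform;
  oform_nondegenerate : oform \in unitmx;
  omx1 : omx 1%g = 1%:M;
  omxM : forall x y, omx (x * y)%g = omx x *m omx y;
  omx_isom : forall x, (omx x)^T *m oform *m omx x = oform }.

(* Real orthogonal representations Gam -> O(n), for the standard form. *)
Record real_rep (R : realType) (Gam : groupType) (n : nat) := RealRep {
  rmx :> Gam -> 'M[R]_n;
  rmx1 : rmx 1%g = 1%:M;
  rmxM : forall x y, rmx (x * y)%g = rmx x *m rmx y;
  rmx_orth : forall x, (rmx x)^T *m rmx x = 1%:M }.

Lemma gmulf_one (Gam Del : groupType) (phi : {multiplicative Del -> Gam}) :
  phi 1%g = 1%g.
Proof. by apply: (mulgI (phi 1%g)); rewrite -gmulfM !mulg1. Qed.

Section RealRep.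
Variable R : realType.

Section Pull.
Variables (Gam Del : groupType) (phi : {multiplicative Del -> Gam}).
Variables (n : nat) (X : real_rep R Gam n).

Definition pull_mx (x : Del) : 'M[R]_n := X (phi x).
Fact pull_mx1 : pull_mx 1%g = 1%:M.
Proof. by rewrite /pull_mx gmulf_one rmx1. Qed.
Fact pull_mxM x y : pull_mx (x * y)%g = pull_mx x *m pull_mx y.
Proof. by rewrite /pull_mx gmulfM rmxM. Qed.
Fact pull_mx_orth x : (pull_mx x)^T *m pull_mx x = 1%:M.
Proof. exact: rmx_orth. Qed.
Definition real_rep_pull : real_rep R Del n :=
  RealRep pull_mx1 pull_mxM pull_mx_orth.

End Pull.

Section Sum.
Variables (Gam : groupType) (m n : nat).
Variables (X : real_rep R Gam m) (Y : real_rep R Gam n).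

Definition sum_mx (x : Gam) : 'M[R]_(m + n) := block_mx (X x) 0 0 (Y x).
Fact sum_mx1 : sum_mx 1%g = 1%:M.
Proof. by rewrite /sum_mx !rmx1 -scalar_mx_block. Qed.
Fact sum_mxM x y : sum_mx (x * y)%g = sum_mx x *m sum_mx y.
Proof.
by rewrite /sum_mx mulmx_block !mulmx0 !mul0mx !addr0 !add0r !rmxM.
Qed.
Fact sum_mx_orth x : (sum_mx x)^T *m sum_mx x = 1%:M.
Proof.
rewrite /sum_mx tr_block_mx !trmx0 mulmx_block !mulmx0 !mul0mx !addr0 !add0r.
by rewrite !rmx_orth -scalar_mx_block.
Qed.
Definition real_rep_sum : real_rep R Gam (m + n) :=
  RealRep sum_mx1 sum_mxM sum_mx_orth.

End Sum.

(* Isomorphism of the underlying real vector bundles. *)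
Definition real_rep_iso (Gam : groupType) n (X Y : real_rep R Gam n) : Prop :=
  exists2 P : 'M[R]_n, P \in unitmx & forall x, P *m X x = Y x *m P.

(* Stiefel-Whitney classes of flat bundles.  A representation
   X : Gam -> O(n) of a discrete group is the same thing as the flat orthogonal
   bundle EGam x_Gam R^n on BGam, and H^i(BGam, Z/2) = H^i(Gam, Z/2).  The
   fields below are the Hirzebruch / Milnor-Stasheff axioms for the classes of
   degree 1 and 2 of these bundles: naturality, the Whitney sum formula,
   vanishing above the rank, and normalization on line bundles.  They are
   required for all discrete groups, and then determine w_1 and w_2. *)
Record stiefel_whitney := StiefelWhitney {
  w1 : forall (Gam : groupType) (n : nat), real_rep R Gam n -> H1 Gam 'Z_2;
  w2 : forall (Gam : groupType) (n : nat), real_rep R Gam n -> H2 Gam 'Z_2;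
  w1_iso : forall Gam n (X Y : real_rep R Gam n),
    real_rep_iso X Y -> w1 X = w1 Y;
  w2_iso : forall Gam n (X Y : real_rep R Gam n),
    real_rep_iso X Y -> w2 X = w2 Y;
  w1_pull : forall (Gam Del : groupType) (phi : {multiplicative Del -> Gam}) n
    (X : real_rep R Gam n), w1 (real_rep_pull phi X) = H1_pull phi (w1 X);
  w2_pull : forall (Gam Del : groupType) (phi : {multiplicative Del -> Gam}) n
    (X : real_rep R Gam n), w2 (real_rep_pull phi X) = H2_pull phi (w2 X);
  w1_sum : forall Gam m n (X : real_rep R Gam m) (Y : real_rep R Gam n),
    w1 (real_rep_sum X Y) = w1 X + w1 Y;
  w2_sum : forall Gam m n (X : real_rep R Gam m) (Y : real_rep R Gam n),
    w2 (real_rep_sum X Y) = w2 X + cup (w1 X) (w1 Y) + w2 Y;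
  w1_rank0 : forall Gam (X : real_rep R Gam 0), w1 X = 0;
  w2_rank0 : forall Gam (X : real_rep R Gam 0), w2 X = 0;
  w2_line : forall Gam (X : real_rep R Gam 1), w2 X = 0;
  w1_line : forall Gam (X : real_rep R Gam 1) x,
    X x = ((-1) ^+ w1 X x)%:M }.

End RealRep.

Section Clifford.
Variables (F : fieldType) (m : nat) (B : 'M[F]_m).

Definition quad (v : 'cV[F]_m) : F := (v^T *m B *m v) 0 0.

Definition is_clifford_map (A : algType F) (f : 'cV[F]_m -> A) : Prop :=
  forall v, f v * f v = (quad v)%:A.

(* The Clifford algebra of (F^m, B), given by its universal property. *)
Record clifford_algebra := CliffordAlgebra {
  calg :> algType F;
  cvec : {linear 'cV[F]_m -> calg};
  cvec_clifford : is_clifford_map cvec;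
  cuniv : forall (A : algType F) (f : {linear 'cV[F]_m -> A}),
    is_clifford_map f ->
    exists g : {lrmorphism calg -> A}, (forall v, g (cvec v) = f v) /\
      forall g' : {lrmorphism calg -> A}, (forall v, g' (cvec v) = f v) ->
      g' =1 g }.

Variable Cl : clifford_algebra.
Local Notation iota := (cvec Cl).

(* The Z/2-grading: the part of degree d is the image of the tensors of
   degree congruent to d modulo 2. *)
Definition chomogeneous (d : bool) (u : Cl) : Prop :=
  exists2 s : seq (F * seq 'cV[F]_m), all (fun w => odd (size w.2) == d) s &
    u = \sum_(w <- s) w.1 *: \prod_(v <- w.2) iota v.

(* [u] is in the Clifford group, with degree [d] and inverse [u']. *)
Definition in_clifford_group (d : bool) (u u' : Cl) : Prop :=
  [/\ chomogeneous d u, u * u' = 1, u' * u = 1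
    & range (fun v => u * iota v * u') = range iota].

(* [u] is in the Clifford group and has image [g] in the orthogonal group,
   under the twisted adjoint action. *)
Definition clifford_lift (g : 'M[F]_m) (u : Cl) : Prop :=
  exists d u', in_clifford_group d u u' /\
    forall v, (-1) ^+ d *: (u * iota v * u') = iota (g *m v).

End Clifford.

(* The class of the pullback along a representation of the central extension
   of O(F^m, B) by the Clifford group: for a set-theoretic section s of the
   pullback, it is the class of the cocycle c with s x s y = c(x, y) s(x y). *)
Definition clifford_class (F : fieldType) (Gam : groupType) m
    (X : orth_rep F Gam m) (a : H2 Gam (funit F)) : Prop :=
  exists (Cl : clifford_algebra (oform X)) (s : Gam -> Cl)
    (c : Z2 Gam (funit F)),
    [/\ forall x, clifford_lift (X x) (s x),
        forall x y, s x * s y = fval (c x y) *: s (x * y)%g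
      & a = cls c].

(* The representation X_- + k_-^n of G x Z/2. *)
Section Tilde.
Variables (F : fieldType) (G : groupType) (n : nat) (X : orth_rep F G n).
Local Notation Gam := (G * 'Z_2)%type.

Definition tilde_form : 'M[F]_(n + n) := block_mx (oform X) 0 0 1%:M.
Definition tilde_mx (x : Gam) : 'M[F]_(n + n) :=
  (-1) ^+ x.2 *: block_mx (X x.1) 0 0 1%:M.

Fact tilde_form_sym : tilde_form^T = tilde_form.
Proof. by rewrite tr_block_mx !trmx0 trmx1 oform_sym. Qed.

Fact tilde_form_nondegenerate : tilde_form \in unitmx.
Proof.
by rewrite unitmxE det_ublock det1 mulr1 -unitmxE oform_nondegenerate.
Qed.

Fact tilde_mx1 : tilde_mx 1%g = 1%:M.
Proof. by rewrite /tilde_mx expr0 scale1r omx1 -scalar_mx_block. Qed.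

Fact tilde_mxM x y : tilde_mx (x * y)%g = tilde_mx x *m tilde_mx y.
Proof.
rewrite /tilde_mx -scalemxAl -scalemxAr scalerA mulmx_block.
rewrite !mulmx0 !mul0mx !addr0 !add0r mulmx1 -omxM GamM /=; congr (_ *: _).
by rewrite -[LHS]/(fval (sgn F (x.2 + y.2))) raddfD.
Qed.

Fact tilde_mx_isom x : (tilde_mx x)^T *m tilde_form *m tilde_mx x = tilde_form.
Proof.
have -> : (tilde_mx x)^T = (-1) ^+ x.2 *: (block_mx (X x.1) 0 0 1%:M)^T.
  by rewrite /tilde_mx linearZ.
rewrite /tilde_mx -!scalemxAl -scalemxAr scalerA tr_block_mx.
rewrite !mulmx_block !trmx0 trmx1 !mulmx0 !mul0mx !addr0 !add0r !mulmx1.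
by rewrite mul0mx omx_isom -expr2 sqrr_sign scale1r.
Qed.

Definition tilde : orth_rep F Gam (n + n) :=
  OrthRep tilde_form_sym tilde_form_nondegenerate tilde_mx1 tilde_mxM
    tilde_mx_isom.

End Tilde.

Section StiefelWhitneyGroups.
Variables (R : realType) (G : groupType).
Local Notation kx := (funit R[i]).

Definition SW_plus : set (H2 (G * 'Z_2)%type kx) :=
  subgroup_generated (@star R[i] G) 0
    [set b | exists n (X : orth_rep R[i] G n), clifford_class (tilde X) b].

(* Y is the real orthogonal representation corresponding to X. *)
Definition is_real_form n (X : orth_rep R[i] G n) (Y : real_rep R G n) : Prop :=
  exists P : 'M[R[i]]_n, [/\ P \in unitmx, P^T *m oform X *m P = 1%:M
    & forall g, X g *m P = P *m map_mx (real_complex R) (Y g)].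

(* H^2(G, Z/2) -> H^2(G, k^x). *)
Definition j : H2 G 'Z_2 -> H2 G kx := H2_map (@sgn R[i]).

Variable w : stiefel_whitney R.

Definition bG n (X : orth_rep R[i] G n) (a : H2 G kx) : Prop :=
  exists2 Y : real_rep R G n, is_real_form X Y & a = j (w2 w Y).

Definition SW : set (H2 G kx) :=
  subgroup_generated +%R 0 [set a | exists n (X : orth_rep R[i] G n), bG X a].

Definition DG : set (H2 G kx) :=
  subgroup_generated +%R 0 [set a | exists chi eta : H1 G 'Z_2, a = j (cup chi eta)].

End StiefelWhitneyGroups.

Arguments SW_plus R G : clear implicits.
Arguments SW {R} G w.
Arguments DG R G : clear implicits.
Arguments star F G : clear implicits.
Arguments Theta F G : clear implicits.

(* Main.v *)
Require Import Defs.
From HB Require Import structures.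
From mathcomp Require Import all_boot all_order all_algebra all_fingroup.
From mathcomp Require Import all_classical all_reals complex.
From mathcomp Require Import ring.

(* A natural theory of Stiefel-Whitney classes is pinned down on the discrete
   group O(n): every relation between reflections follows from [r_a ^ 2 = 1] and
   from the planar relations [r_a r_b r_c = r_d], so that a central extension of
   O(n) in which reflections lift to involutions and orthogonal reflections have
   commuting lifts is split.  Applied to the difference of the extension of class
   w_2 and of the pin extension inside a Clifford algebra, which agree on pairs of
   orthogonal reflections by the Whitney sum formula, this identifies the class of
   the Clifford extension with j(w_2).  A complex orthogonal representation X of a
   finite group has a real form, hence the first component of Theta(beta_X) is
   j(w_2(X)), as (X + 1^n) and X have the same w_2, and for a line chi one gets
   Theta(beta_chi) = (0, chi).  Through Theta, the modified product is
   (a, chi) * (b, eta) = (a + b + j(chi eta), chi + eta), with j(chi chi) = 0,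
   so the star-subgroups containing all (0, chi) are the products A x K with A a
   subgroup containing D(G). *)

Set Implicit Arguments.
Unset Strict Implicit.
Unset Printing Implicit Defensive.

Import Order.TTheory GRing.Theory Num.Theory.

Local Open Scope ring_scope.

(** * The orthogonal group and its reflections *)

(** The classes [w1] and [w2] are known only through axioms, so no construction of them can be
    compared with the Clifford side. The axioms compute [w2] where a representation splits into
    lines, here on the Klein subgroups of O(n) generated by two orthogonal reflections. These
    restrictions only tell how lifts of reflections square and how lifts of orthogonal reflections
    commute. The difficulty is that this has to kill the difference of two extensions of an infinite
    discrete group, with nothing assumed about reflections that are not orthogonal: the planar
    relation has to be recovered inside the extension, from canonical lifts that are compatible with
    conjugation. On the Clifford side, algebras are given by a universal property alone. A model is
    therefore built, and in it the elements acting trivially by the twisted adjoint action are shown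
    to be scalars; this makes lifts unique up to a scalar, for every model and every section allowed
    by [clifford_class]. *)

Section Orthogonal.
Variables (R : rcfType) (n : nat).

Record orthg := Orthg { omat :> 'M[R]_n; _ : omat^T *m omat == 1%:M }.
HB.instance Definition _ := [isSub for omat].
HB.instance Definition _ := [Choice of orthg by <:].

Lemma orthgP (g : orthg) : (g : 'M_n)^T *m g = 1%:M.
Proof. by case: g => g /= /eqP. Qed.

Lemma orthgPr (g : orthg) : (g : 'M_n) *m (g : 'M_n)^T = 1%:M.
Proof. exact: mulmx1C (orthgP g). Qed.

Fact orthg_one_subproof : (1%:M : 'M[R]_n)^T *m 1%:M == 1%:M.
Proof. by rewrite trmx1 mulmx1. Qed.
Definition orthg_one := Orthg orthg_one_subproof.

Fact orthg_mul_subproof (g h : orthg) : (g *m h)^T *m (g *m h) == 1%:M.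
Proof. by rewrite trmx_mul mulmxA -(mulmxA _ _ (g : 'M_n)) orthgP mulmx1 orthgP. Qed.
Definition orthg_mul g h := Orthg (orthg_mul_subproof g h).

Fact orthg_inv_subproof (g : orthg) : (g : 'M_n)^T^T *m (g : 'M_n)^T == 1%:M.
Proof. by rewrite trmxK orthgPr. Qed.
Definition orthg_inv g := Orthg (orthg_inv_subproof g).

Fact orthg_mulA : associative orthg_mul.
Proof. by move=> g h k; apply: val_inj; rewrite /= mulmxA. Qed.
Fact orthg_mul1 : left_id orthg_one orthg_mul.
Proof. by move=> g; apply: val_inj; rewrite /= mul1mx. Qed.
Fact orthg_mulr1 : right_id orthg_one orthg_mul.
Proof. by move=> g; apply: val_inj; rewrite /= mulmx1. Qed.
Fact orthg_mulV : left_inverse orthg_one orthg_inv orthg_mul.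
Proof. by move=> g; apply: val_inj; rewrite /= orthgP. Qed.
Fact orthg_mulVr : right_inverse orthg_one orthg_inv orthg_mul.
Proof. by move=> g; apply: val_inj; rewrite /= orthgPr. Qed.
HB.instance Definition _ := isGroup.Build orthg
  orthg_mulA orthg_mul1 orthg_mulr1 orthg_mulV orthg_mulVr.

Lemma omat1 : omat 1%g = 1%:M. Proof. by []. Qed.
Lemma omatM (g h : orthg) : omat (g * h)%g = omat g *m omat h. Proof. by []. Qed.

Local Notation V := 'cV[R]_n.

Lemma orthg_eq (g h : orthg) : (forall v : V, omat g *m v = omat h *m v) -> g = h.
Proof.
move=> e; apply: val_inj; apply/matrixP => i j /=.
have := e (delta_mx j 0); rewrite -!colE => /matrixP/(_ i 0).
by rewrite !mxE.
Qed.

Definition dot (u v : V) : R := (u^T *m v) 0 0.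

Lemma dotE u v : dot u v = \sum_i u i 0 * v i 0.
Proof. by rewrite /dot mxE; apply: eq_bigr => i _; rewrite mxE. Qed.

Lemma dotC u v : dot u v = dot v u.
Proof. by rewrite !dotE; apply: eq_bigr => i _; rewrite mulrC. Qed.

Lemma dotDr u v w : dot u (v + w) = dot u v + dot u w.
Proof. by rewrite /dot mulmxDr mxE. Qed.

Lemma dotZr a u v : dot u (a *: v) = a * dot u v.
Proof. by rewrite /dot -scalemxAr mxE. Qed.

Lemma dotNr u v : dot u (- v) = - dot u v.
Proof. by rewrite -scaleN1r dotZr mulN1r. Qed.

Lemma dotBr u v w : dot u (v - w) = dot u v - dot u w.
Proof. by rewrite dotDr dotNr. Qed.

Lemma dot0r u : dot u 0 = 0.
Proof. by rewrite /dot mulmx0 mxE. Qed.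

Lemma dotDl u v w : dot (v + w) u = dot v u + dot w u.
Proof. by rewrite dotC dotDr !(dotC u). Qed.

Lemma dotZl a u v : dot (a *: v) u = a * dot v u.
Proof. by rewrite dotC dotZr (dotC u). Qed.

Lemma dotNl u v : dot (- v) u = - dot v u.
Proof. by rewrite dotC dotNr (dotC u). Qed.

Lemma dotBl u v w : dot (v - w) u = dot v u - dot w u.
Proof. by rewrite dotDl dotNl. Qed.

Lemma dot0l u : dot 0 u = 0.
Proof. by rewrite dotC dot0r. Qed.

Definition dotlin := (dotDl, dotDr, dotZl, dotZr, dotNl, dotNr).

Lemma dot_ge0 u : 0 <= dot u u.
Proof. by rewrite dotE sumr_ge0 // => i _; rewrite -expr2 sqr_ge0. Qed.

Lemma dot_eq0 u : (dot u u == 0) = (u == 0).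
Proof.
apply/eqP/eqP => [|->]; last exact: dot0r.
rewrite dotE => /eqP; rewrite psumr_eq0; last by move=> i _; rewrite -expr2 sqr_ge0.
move=> /allP h; apply/colP => i; rewrite mxE.
by have := h i (mem_index_enum i); rewrite /= mulf_eq0 orbb => /eqP.
Qed.

Lemma dot_gt0 u : (0 < dot u u) = (u != 0).
Proof. by rewrite lt_def dot_ge0 andbT dot_eq0. Qed.

Lemma dot_orthg (g : orthg) u v : dot (omat g *m u) (omat g *m v) = dot u v.
Proof. by rewrite /dot trmx_mul mulmxA -(mulmxA _ _ (g : 'M_n)) orthgP mulmx1. Qed.

(** A zero [a] gives the identity, so reflections are total in the vector and words may contain the
    letter 0. *)
Definition reflv (a v : V) : V := v - (2 * dot a v / dot a a) *: a.

Definition refl_mx (a : V) : 'M[R]_n := 1%:M - (2 / dot a a) *: (a *m a^T).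

Lemma refl_mxE a v : refl_mx a *m v = reflv a v.
Proof.
rewrite /refl_mx mulmxBl mul1mx -scalemxAl -mulmxA.
rewrite [a^T *m v]mx11_scalar -/(dot a v) mul_mx_scalar scalerA /reflv.
by rewrite mulrAC.
Qed.

Lemma reflvK a v : reflv a (reflv a v) = v.
Proof.
rewrite /reflv; have [->|nz] := eqVneq a 0; first by rewrite !scaler0 !subr0.
rewrite dotBr dotZr -addrA -opprD -scalerDl.
rewrite [X in X *: _](_ : _ = 0) ?scale0r ?subr0 //.
have nz' : dot a a != 0 by rewrite dot_eq0.
by field.
Qed.

Fact refl_subproof a : (refl_mx a)^T *m refl_mx a == 1%:M.
Proof.
have tr : (refl_mx a)^T = refl_mx a.
  by rewrite /refl_mx linearB /= trmx1 linearZ /= trmx_mul trmxK.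
apply/eqP/matrixP => i j; rewrite tr.
have := reflvK a (delta_mx j 0); rewrite -!refl_mxE mulmxA -!colE => /matrixP/(_ i 0).
by rewrite !mxE eqxx andbT.
Qed.

Definition refl (a : V) : orthg := Orthg (refl_subproof a).

Lemma reflE a v : omat (refl a) *m v = reflv a v.
Proof. exact: refl_mxE. Qed.

Lemma reflv0 v : reflv 0 v = v.
Proof. by rewrite /reflv scaler0 subr0. Qed.

Lemma refl0 : refl 0 = 1%g.
Proof. by apply: orthg_eq => v; rewrite reflE reflv0 omat1 mul1mx. Qed.

Lemma reflK a : (refl a * refl a)%g = 1%g.
Proof. by apply: orthg_eq => v; rewrite omatM -mulmxA !reflE reflvK omat1 mul1mx. Qed.

Lemma dot_reflv a u v : dot (reflv a u) (reflv a v) = dot u v.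
Proof. by rewrite -!reflE dot_orthg. Qed.

Lemma reflvZ l a v : l != 0 -> reflv (l *: a) v = reflv a v.
Proof.
move=> nl; rewrite /reflv scalerA !dotlin; congr (_ - _ *: _).
have [->|nz] := eqVneq a 0; first by rewrite !dot0r !(dot0l, mulr0, mul0r, invr0).
have nz' : dot a a != 0 by rewrite dot_eq0.
by field; rewrite nl nz'.
Qed.

Lemma reflZ l a : l != 0 -> refl (l *: a) = refl a.
Proof. by move=> nl; apply: orthg_eq => v; rewrite !reflE reflvZ. Qed.

Lemma reflv_self a : reflv a a = - a.
Proof.
rewrite /reflv; have [->|nz] := eqVneq a 0; first by rewrite scaler0 subr0 oppr0.
by rewrite mulfK ?dot_eq0 // scaler_nat mulr2n opprD addNKr.
Qed.

Lemma reflv_orth a v : dot a v = 0 -> reflv a v = v.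
Proof. by rewrite /reflv => ->; rewrite mulr0 mul0r scale0r subr0. Qed.

Lemma reflv_fix a v : reflv a v = v -> dot a v = 0.
Proof.
have [->|nz] := eqVneq a 0; first by rewrite dot0l.
move=> /(congr1 (fun x => v - x)); rewrite subrr /reflv opprB addrC subrK => /eqP.
rewrite scaler_eq0 (negPf nz) orbF mulf_eq0 invr_eq0 dot_eq0 (negPf nz) orbF.
by rewrite mulf_eq0 pnatr_eq0 => /eqP.
Qed.

(** The hyperplane orthogonal to [x - e] bisects two vectors of equal norm. Words are reduced with
    such reflections. *)
Lemma reflv_diff x e : dot x x = dot e e -> reflv (x - e) e = x.
Proof.
move=> xe; have [->|nz] := eqVneq x e; first by rewrite subrr reflv0.
rewrite /reflv.
have nz' : dot (x - e) (x - e) != 0 by rewrite dot_eq0 subr_eq0.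
suff -> : 2 * dot (x - e) e / dot (x - e) (x - e) = -1 by rewrite scaleN1r opprK addrC subrK.
apply: (mulIf nz'); rewrite mulfVK // !dotlin xe (dotC e x).
by ring.
Qed.

Lemma reflv_diffV x e : dot x x = dot e e -> reflv (x - e) x = e.
Proof. by move=> xe; rewrite -{2}(reflv_diff xe) reflvK. Qed.

Lemma refl_inv a : (refl a)^-1%g = refl a.
Proof. by apply: (mulgI (refl a)); rewrite mulgV reflK. Qed.

Lemma refl_conj (g : orthg) a : (g * refl a * g^-1)%g = refl (omat g *m a).
Proof.
apply: (mulIg g); rewrite mulgKV; apply: orthg_eq => v.
rewrite !omatM -!mulmxA !reflE /reflv mulmxBr -scalemxAr.
by rewrite !dot_orthg.
Qed.

Lemma refl_commute a b : dot a b = 0 -> commute (refl a) (refl b).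
Proof.
by move=> ab; apply: (mulIg (refl a)^-1%g); rewrite mulgK refl_conj reflE reflv_orth.
Qed.

(** The line of [a] is the eigenspace of its reflection for -1: applying both sides to [a] gives
    [2 *: a = m *: b]. *)
Lemma refl_inj a b : a != 0 -> refl a = refl b -> exists2 l, l != 0 & b = l *: a.
Proof.
move=> nz e; have := congr1 (fun g => omat g *m a) e.
rewrite /= !reflE reflv_self /reflv; set m := _ / _ => e'.
have e2 : 2 *: a = m *: b.
  move/(congr1 (fun x => a - x)): e'; rewrite opprK subKr => <-.
  by rewrite scaler_nat mulr2n.
have nm : m != 0.
  apply/eqP => m0; move: e2; rewrite m0 scale0r => /eqP.
  by rewrite scaler_eq0 pnatr_eq0 (negPf nz).
exists (m^-1 * 2); first by rewrite mulf_neq0 ?invr_eq0 ?pnatr_eq0.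
by rewrite -scalerA e2 scalerA mulVf // scale1r.
Qed.

(* [w] is the Clifford product [a b c], a vector as [a] is in the span of [b] and [c]. *)
Lemma refl_planar b c p q (a := p *: b + q *: c)
    (w := - (q * dot c c) *: b + (p * dot b b + 2 * q * dot b c) *: c) :
    b != 0 -> c != 0 -> a != 0 ->
  dot w w = dot a a * dot b b * dot c c /\ (refl a * refl b * refl c)%g = refl w.
Proof.
move=> nb nc na.
have eb : dot b b != 0 by rewrite dot_eq0.
have ec : dot c c != 0 by rewrite dot_eq0.
have ea : dot a a != 0 by rewrite dot_eq0.
have ww : dot w w = dot a a * dot b b * dot c c.
  by rewrite /w /a !dotlin (dotC c b); ring.
have ew : dot w w != 0 by rewrite ww !mulf_neq0.
split=> //; apply: orthg_eq => v; rewrite !omatM -!mulmxA !reflE /reflv.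
set s1 := _ / dot c c; set s2 := _ / dot b b; set s3 := _ / dot a a; set t := _ / dot w w.
(* The composite subtracts [s1 c + s2 b + s3 a] from [v], and [refl w] subtracts [t w]. Equality of
   the coefficients of [b] and [c] suffices, whether or not these vectors are independent. *)
suff [e1 e2] : s2 + s3 * p = - (t * (q * dot c c)) /\
    s1 + s3 * q = t * (p * dot b b + 2 * q * dot b c).
  rewrite /a /w !scalerDr !scalerA mulrN -e1 -e2 !opprD !addrA !scalerDl !opprD !addrA.
  by rewrite [LHS](AC 5 (1*3*4*2*5)).
rewrite /t /s3 /s2 /s1 ww; move: ea; clear ew ww; rewrite /w /a !(dotlin, dotBr) (dotC c b).
move: (dot b b) (dot c c) (dot b c) (dot b v) (dot c v) eb ec => B C M bv cv eb ec.
move=> ea; split; field; rewrite eb ec ?andbT //=; (apply: contra ea => /eqP e; apply/eqP; rewrite -[RHS]e; ring).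
Qed.

(** * Relations between reflections *)

(* The vector [0] is a junk letter, standing for [refl 0 = 1]. *)
Inductive weq : seq V -> seq V -> Prop :=
| WeqRefl s : weq s s
| WeqSym s t : weq s t -> weq t s
| WeqTrans t s u : weq s t -> weq t u -> weq s u
| WeqCat s1 s2 t1 t2 : weq s1 t1 -> weq s2 t2 -> weq (s1 ++ s2) (t1 ++ t2)
| WeqZero : weq [:: 0] [::]
| WeqSquare a : a != 0 -> weq [:: a; a] [::]
| WeqPlanar p q b c w : b != 0 -> c != 0 -> p *: b + q *: c != 0 -> w != 0 ->
    (refl (p *: b + q *: c) * refl b * refl c)%g = refl w ->
    weq [:: p *: b + q *: c; b; c] [:: w].

Definition wprod (s : seq V) : orthg := foldr (fun a g => refl a * g)%g 1%g s.

Lemma wprod_cat s t : wprod (s ++ t) = (wprod s * wprod t)%g.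
Proof. by elim: s => [|a s IH] /=; rewrite ?mul1g // IH mulgA. Qed.

Lemma weq_wprod s t : weq s t -> wprod s = wprod t.
Proof.
elim=> {s t} [//|//|t s u _ -> //|s1 s2 t1 t2 _ e1 _ e2||a _|p q b c w _ _ _ _ e] /=.
- by rewrite !wprod_cat e1 e2.
- by rewrite refl0 mulg1.
- by rewrite mulg1 reflK.
- by rewrite !mulg1 mulgA.
Qed.

Lemma weq_square a : weq [:: a; a] [::].
Proof.
have [->|] := eqVneq a 0; last exact: WeqSquare.
exact: (@WeqCat [:: 0] [:: 0] [::] [::] WeqZero WeqZero).
Qed.

Lemma weq_catl s t u : weq t u -> weq (s ++ t) (s ++ u).
Proof. by apply: WeqCat; apply: WeqRefl. Qed.

Lemma weq_catr s t u : weq t u -> weq (t ++ s) (u ++ s).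
Proof. by move=> h; apply: WeqCat h (WeqRefl _). Qed.

(** Rescaling is a degenerate planar relation: [a a a = l a], followed by the cancellation of a
    square. *)
Lemma weq_line l a : l != 0 -> weq [:: l *: a] [:: a].
Proof.
move=> nl; have [->|na] := eqVneq a 0; first by rewrite scaler0; apply: WeqRefl.
have nla : l *: a != 0 by rewrite scaler_eq0 negb_or nl.
apply: (WeqTrans (t := [:: 1 *: a + 0 *: a; a; a])).
  apply: WeqSym; apply: WeqPlanar => //; rewrite scale1r scale0r addr0 // reflK mul1g.
  by rewrite reflZ.
rewrite scale1r scale0r addr0.
exact: (weq_catl [:: a] (weq_square a)).
Qed.

(** Reflection in [x - e] carries [e] to [x], reflection in [b] carries [x] to [reflv b x], and
    reflection in [reflv b x - e] brings this back to [e]. The three vectors lie in the span of [b]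
    and [x - e], so the composite is one reflection, in a vector [w] orthogonal to [e]. Letters 0
    pad the degenerate cases. *)
Lemma weq_swap e x b : dot x x = dot e e ->
  exists w, [/\ dot w e = 0, exists p q, w = p *: b + q *: (x - e)
    & weq [:: b; x - e] [:: reflv b x - e; w]].
Proof.
move=> xe; set c := x - e; set l := 2 * dot b x / dot b b.
have eu : reflv b x - e = c - l *: b by rewrite /reflv /c addrAC.
set u := reflv b x - e in eu *.
have span0 : exists p q, 0 = p *: b + q *: c.
  by exists 0, 0; rewrite !scale0r addr0.
have sq2 a d : weq [:: a; d] [::] -> weq [:: a; d] [:: 0; 0].
  by move=> h; apply: WeqTrans h _; apply: WeqSym; apply: weq_square.
have zr a : weq [:: a; 0] [:: a] := weq_catl [:: a] WeqZero.
have zl a : weq [:: 0; a] [:: a] := weq_catr [:: a] WeqZero.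
have [b0|nb] := eqVneq b 0.
  exists 0; split; rewrite ?dot0l // eu b0 scaler0 subr0.
  exact: WeqTrans (zl c) (WeqSym (zr c)).
have [c0|nc] := eqVneq c 0.
  have ex : x = e by apply/eqP; rewrite -subr_eq0 -/c c0.
  have [l0|nl] := eqVneq l 0.
    exists b; split; last 1 first.
    - by rewrite eu c0 l0 scale0r subr0; apply: WeqTrans (zr b) (WeqSym (zl b)).
    - by apply: reflv_fix; rewrite /reflv -ex -/l l0 scale0r subr0.
    - by exists 1, 0; rewrite scale1r scale0r addr0.
  exists 0; split; rewrite ?dot0l // eu c0 sub0r -scaleNr.
  apply: WeqTrans (zr b) (WeqTrans _ (WeqSym (zr _))).
  by apply: WeqSym; apply: weq_line; rewrite oppr_eq0.
have [u0|nu] := eqVneq u 0.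
  have ec : c = l *: b by apply/eqP; rewrite -subr_eq0 -eu u0.
  have nl : l != 0 by apply: contra nc; rewrite ec => /eqP ->; rewrite scale0r.
  exists 0; split; rewrite ?dot0l // u0; apply: sq2; rewrite ec.
  exact: WeqTrans (weq_catl [:: b] (weq_line b nl)) (weq_square b).
have eu' : u = (- l) *: b + 1 *: c by rewrite eu scaleNr scale1r addrC.
have := @refl_planar b c (- l) 1 nb nc; rewrite -eu' => /(_ nu) /=.
set w := (_ *: b + _ *: c) => -[ww ew]; exists w.
have nw : w != 0 by rewrite -dot_eq0 ww !mulf_neq0 // dot_eq0.
split; last 1 first.
- apply: WeqTrans (WeqSym (weq_catr [:: b; c] (weq_square u))) _ => /=.
  apply: (@weq_catl [:: u] [:: u; b; c] [:: w]).
  by rewrite {1}eu'; apply: WeqPlanar; rewrite -?eu'.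
- apply: reflv_fix; rewrite -reflE -ew !omatM -!mulmxA !reflE.
  by rewrite reflv_diff // reflv_diffV // dot_reflv.
- by exists (- (1 * dot c c)), ((- l) * dot b b + 2 * 1 * dot b c).
Qed.

(** A descending flag of subspaces: reflections in vectors of [low k] fix the first [k] basis
    vectors. *)
Definition low k (a : V) : Prop := forall i : 'I_n, (i < k)%N -> a i 0 = 0.

Lemma low_comb k p q a b : low k a -> low k b -> low k (p *: a + q *: b).
Proof. by move=> ha hb i ik; rewrite !mxE ha // hb // !mulr0 addr0. Qed.

Lemma low_full a : low n a -> a = 0.
Proof. by move=> h; apply/colP => i; rewrite h // mxE. Qed.

Let bv (k : 'I_n) : V := delta_mx k 0.

Lemma dot_bv a (k : 'I_n) : dot a (bv k) = a k 0.
Proof.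
rewrite dotE (bigD1 k) //= big1 ?addr0 => [|i ik]; first by rewrite mxE !eqxx mulr1.
by rewrite mxE (negPf ik) mulr0.
Qed.

Lemma lowS (k : 'I_n) a : low k a -> dot a (bv k) = 0 -> low k.+1 a.
Proof.
move=> h; rewrite dot_bv => ak i; rewrite ltnS leq_eqVlt => /orP[/eqP/val_inj -> //|].
exact: h.
Qed.

Let lowseq k (s : seq V) := forall a, a \in s -> low k a.

(** Exchanging letters with [weq_swap] leaves one reflection carrying [bv k] to its image, followed
    by letters orthogonal to [bv k]. The first letter depends only on the product of the word, not
    on the word. *)
Lemma weq_canonical (k : 'I_n) s : lowseq k s ->
  low k (omat (wprod s) *m bv k - bv k) /\
  exists2 h, lowseq k.+1 h & weq s ((omat (wprod s) *m bv k - bv k) :: h).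
Proof.
elim: s => [|a s IH] ls.
  rewrite mul1mx subrr; split; first by move=> i _; rewrite mxE.
  by exists [::] => //; apply: WeqSym WeqZero.
have la : low k a by apply: ls; rewrite mem_head.
have [|lc [h lh eh]] := IH; first by move=> b bs; apply: ls; rewrite in_cons bs orbT.
rewrite [wprod _]/= omatM -mulmxA reflE; set x := omat (wprod s) *m bv k in lc eh *.
have xx : dot x x = dot (bv k) (bv k) by rewrite dot_orthg.
have [w [we [p [q ew]] ww]] := weq_swap a xx.
split.
  rewrite /reflv addrAC -scaleNr -[x - _]scale1r; exact: low_comb.
exists (w :: h).
  move=> b; rewrite in_cons => /orP[/eqP ->|/lh //].
  by apply: lowS => //; rewrite ew; apply: low_comb.
apply: WeqTrans (weq_catl [:: a] eh) _.
exact: (weq_catr h ww).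
Qed.

(** By [weq_canonical], two words with the same product are equivalent to words with the same first
    letter; it is cancelled and the induction goes on one step deeper in the flag. At the bottom
    [k = n] all letters are 0. *)
Theorem wprod_weq s t : wprod s = wprod t -> weq s t.
Proof.
suff H m k : (m + k)%N = n -> forall s t, lowseq k s -> lowseq k t ->
    wprod s = wprod t -> weq s t.
  by apply: (H n 0%N); rewrite ?addn0 // => a _ i.
elim: m k => [|m IH] k.
  rewrite add0n => -> {s t} s t ls lt _.
  have nilE u : lowseq n u -> weq u [::].
    elim: u => [|a u IHu] lu; first exact: WeqRefl.
    have -> : a = 0 by apply: low_full; apply: lu; rewrite mem_head.
    apply: (@WeqCat [:: 0] u [::] [::] WeqZero); apply: IHu => b bu.
    by apply: lu; rewrite in_cons bu orbT.
  exact: WeqTrans (nilE _ ls) (WeqSym (nilE _ lt)).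
move=> mk {s t} s t ls lt e; have kn : (k < n)%N by rewrite -mk addSn ltnS leq_addl.
have [lc [h lh eh]] := @weq_canonical (Ordinal kn) s ls.
have [_ [h' lh' eh']] := @weq_canonical (Ordinal kn) t lt.
rewrite -e in eh'.
apply: (WeqTrans eh (WeqTrans _ (WeqSym eh'))).
apply: (weq_catl [:: _]); apply: (IH k.+1) => //; first by rewrite addnS -addSn.
exact: mulgI (etrans (esym (weq_wprod eh)) (etrans e (weq_wprod eh'))).
Qed.

(** If [g] fixes the first [k] basis vectors, the reflection in [g e - e], with [e] the next one,
    carries [g e] back to [e], and it fixes the earlier ones since they are orthogonal to
    [g e - e]. *)
Theorem cartan_dieudonne (g : orthg) : exists s, wprod s = g.
Proof.
suff H m k : (m + k)%N = n -> forall g : orthg,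
    (forall i : 'I_n, (i < k)%N -> omat g *m bv i = bv i) -> exists s, wprod s = g.
  by apply: (H n 0%N); rewrite ?addn0.
elim: m k {g} => [|m IH] k.
  rewrite add0n => -> g hg; exists [::]; apply/esym/val_inj/matrixP => i j.
  by have := hg j (ltn_ord j); rewrite -colE => /matrixP/(_ i 0); rewrite !mxE andbT.
move=> mk g hg; have kn : (k < n)%N by rewrite -mk addSn ltnS leq_addl.
set e := bv (Ordinal kn); set c := omat g *m e - e.
have [||s hs] := IH k.+1 _ (refl c * g)%g; first by rewrite addnS -addSn.
  move=> i; rewrite omatM -mulmxA reflE ltnS leq_eqVlt => /orP[/eqP ik|ik].
    have -> : i = Ordinal kn by apply: val_inj.
    by rewrite reflv_diffV // dot_orthg.
  rewrite hg // reflv_orth // dotBl -{1}(hg i ik) dot_orthg !dot_bv !mxE.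
  by rewrite subrr.
by exists (c :: s); rewrite /= hs mulgA reflK mul1g.
Qed.

End Orthogonal.

(** * Central extensions of the orthogonal group *)

Section Normalize.
Variables (R : rcfType) (n : nat).
Implicit Types a : 'cV[R]_n.

Definition normalize a := (Num.sqrt (dot a a))^-1 *: a.

Lemma sqrt_dot_neq0 a : a != 0 -> Num.sqrt (dot a a) != 0.
Proof. by move=> na; rewrite gt_eqF // sqrtr_gt0 dot_gt0. Qed.

Lemma dot_normalize a : a != 0 -> dot (normalize a) (normalize a) = 1.
Proof.
move=> na; rewrite !dotlin mulrA -expr2 exprVn sqr_sqrtr ?dot_ge0 //.
by rewrite mulVf // dot_eq0.
Qed.

Lemma normalizeZ l a : l != 0 ->
  normalize (l *: a) = normalize a \/ normalize (l *: a) = - normalize a.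
Proof.
move=> nl; rewrite /normalize !dotlin mulrA -expr2 sqrtrM ?sqr_ge0 // sqrtr_sqr.
rewrite invfM scalerA mulrAC; have := normr_idP; case: (ger0P l) => _ _.
  by left; rewrite mulVf // mul1r.
by right; rewrite invrN mulNr mulVf // mulN1r scaleNr.
Qed.

Lemma normalize_reflv a b : normalize (reflv b a) = reflv b (normalize a).
Proof. by rewrite /normalize dot_reflv -!reflE scalemxAr. Qed.

End Normalize.

Section Splitting.
Variables (R : rcfType) (n : nat) (E : groupType).
Variable pi : {multiplicative E -> orthg R n}.
Local Notation V := 'cV[R]_n.

Hypothesis pi_surj : forall g, exists x, pi x = g.
Hypothesis pi_central : forall z x, pi z = 1%g -> commute z x.
Hypothesis refl_lift_involutive :
  forall a x, a != 0 -> pi x = refl a -> (x * x = 1)%g.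
Hypothesis orth_refl_lifts_commute : forall a b x y,
  a != 0 -> b != 0 -> dot a b = 0 -> pi x = refl a -> pi y = refl b -> commute x y.

Let piV x : pi x^-1%g = (pi x)^-1%g.
Proof. by apply: (mulgI (pi x)); rewrite -gmulfM !mulgV gmulf_one. Qed.

Let lift g : E := sval (cid (pi_surj g)).
Let liftP g : pi (lift g) = g.
Proof. by rewrite /lift; case: cid. Qed.

Section Base.
Variable e : V.
Hypothesis e1 : dot e e = 1.

Let ne : e != 0. Proof. by rewrite -dot_eq0 e1 oner_eq0. Qed.

(** A single lift of [refl e] is chosen and transported to every unit vector [a] by conjugation with
    a lift of the reflection exchanging [e] and [a]. Lifts chosen independently would have no reason
    to be compatible with conjugation. *)
Let rho1 (a : V) : E :=
  (lift (refl (a - e)%R) * lift (refl e) * (lift (refl (a - e)%R))^-1)%g.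

(** The element [y'^-1 * (x * y)] lifts the reflection [w] of [weq_swap], which is orthogonal to [e]
    or trivial. It therefore commutes with the lift of [refl e], by hypothesis or by centrality of
    the kernel. *)
Let rho1_conj a b x : dot a a = 1 -> pi x = refl b ->
  (x * rho1 a * x^-1 = rho1 (reflv b a))%g.
Proof.
move=> a1 xb; rewrite /rho1; set y := lift (refl (a - e)).
set y' := lift (refl (reflv b a - e)); set E0 := lift (refl e).
have [w [we _ ww]] := weq_swap b (etrans a1 (esym e1)).
have zw : pi (y'^-1 * (x * y))%g = refl w.
  rewrite gmulfM piV gmulfM xb !liftP refl_inv.
  have /= := weq_wprod ww; rewrite !mulg1 => ->.
  by rewrite mulgA reflK mul1g.
have cz : commute (y'^-1 * (x * y))%g E0.
  have [w0|nw] := eqVneq w 0; first by apply: pi_central; rewrite zw w0 refl0.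
  exact: orth_refl_lifts_commute nw ne we zw (liftP _).
have exy : (x * y = y' * (y'^-1 * (x * y)))%g by rewrite mulKVg.
have e2 : (x * y * E0 = y' * E0 * y'^-1 * (x * y))%g.
  by rewrite {1}exy -mulgA cz !mulgA.
by rewrite !mulgA e2 !mulgA !mulgK.
Qed.

Let rho (a : V) : E := if a == 0 then 1%g else rho1 (normalize a).

Let rhoE a : a != 0 -> rho a = rho1 (normalize a).
Proof. by rewrite /rho => /negPf ->. Qed.

Let rho_conj a b x : a != 0 -> pi x = refl b ->
  (x * rho a * x^-1 = rho (reflv b a))%g.
Proof.
move=> na xb; rewrite rhoE // (rho1_conj _ xb) ?dot_normalize //.
by rewrite -normalize_reflv rhoE // -dot_eq0 dot_reflv dot_eq0.
Qed.

Let pi_rho a : pi (rho a) = refl a.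
Proof.
have [->|na] := eqVneq a 0; first by rewrite /rho eqxx gmulf_one refl0.
rewrite rhoE // /rho1 !gmulfM piV !liftP refl_conj reflE reflv_diff.
  by rewrite reflZ // invr_eq0 sqrt_dot_neq0.
by rewrite dot_normalize.
Qed.

Let rho_sq a : (rho a * rho a = 1)%g.
Proof.
have [->|na] := eqVneq a 0; first by rewrite /rho eqxx mulg1.
exact: refl_lift_involutive na (pi_rho a).
Qed.

Let rhoV a : (rho a)^-1%g = rho a.
Proof. by apply: (mulgI (rho a)); rewrite mulgV rho_sq. Qed.

Let rhoZ l a : l != 0 -> rho (l *: a) = rho a.
Proof.
move=> nl; have [->|na] := eqVneq a 0; first by rewrite scaler0.
(* Conjugation by [rho b] sends [rho b] to [rho (- b)], but also fixes it. *)
have rhoN (b : V) : b != 0 -> rho (- b) = rho b.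
  by move=> nb; rewrite -reflv_self -(rho_conj nb (pi_rho b)) mulgK.
have nla : l *: a != 0 by rewrite scaler_eq0 negb_or nl.
have nn (b : V) : b != 0 -> normalize b != 0.
  by move=> nb; rewrite -dot_eq0 dot_normalize ?oner_eq0.
have idem (b : V) : dot b b = 1 -> normalize b = b.
  by rewrite /normalize => ->; rewrite sqrtr1 invr1 scale1r.
have rho_n (b : V) : b != 0 -> rho b = rho (normalize b).
  by move=> nb; rewrite !rhoE ?nn // (idem (normalize b)) ?dot_normalize.
rewrite rho_n // [RHS]rho_n //.
by case: (normalizeZ a nl) => ->; rewrite ?rhoN // nn.
Qed.

Let rho_eq a b : a != 0 -> refl a = refl b -> rho a = rho b.
Proof. by move=> na /(refl_inj na)[l nl ->]; rewrite rhoZ. Qed.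

(* Let [d] be [b] rescaled to the norm of [a := p *: b + q *: c], and
   [h := rho (a - d) * rho d].  Then [rho a * rho d = h * h], and [h * rho c] lifts
   a product of three coplanar reflections, that is a reflection, so it is an
   involution; hence [h * h * rho c] is the conjugate of [rho c] by [h]. *)
Let rho_planar p q b c w : b != 0 -> c != 0 -> p *: b + q *: c != 0 -> w != 0 ->
  (refl (p *: b + q *: c) * refl b * refl c)%g = refl w ->
  (rho (p *: b + q *: c) * rho b * rho c = rho w)%g.
Proof.
move=> nb nc na nw ew; set a := p *: b + q *: c in na ew *.
pose r := Num.sqrt (dot a a) / Num.sqrt (dot b b).
have nr : r != 0 by rewrite mulf_neq0 ?invr_eq0 ?sqrt_dot_neq0.
pose d := r *: b.
have nd : d != 0 by rewrite scaler_eq0 negb_or nr.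
have da : dot a a = dot d d.
  rewrite [RHS]dotZl dotZr mulrA -expr2 expr_div_n !sqr_sqrtr ?dot_ge0 // mulfVK //.
  by rewrite dot_eq0.
rewrite -(rhoZ b nr) -/d; have ed : refl d = refl b by rewrite reflZ.
have [ad|nad] := eqVneq a d.
  rewrite ad rho_sq mul1g; apply: rho_eq => //.
  by rewrite -ew -ed ad reflK mul1g.
set m := a - d; have nm : m != 0 by rewrite subr_eq0.
set h := (rho m * rho d)%g.
have hh : (rho a * rho d = h * h)%g.
  rewrite /h -(reflv_diff da) -/m -(rho_conj nd (pi_rho m)) rhoV.
  by rewrite !mulgA.
have [w' nw' ew'] : exists2 w', w' != 0 &
    (refl m * refl b * refl c)%g = refl w'.
  have em : m = (p - r) *: b + q *: c by rewrite /m /a /d scalerBl addrAC.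
  have := @refl_planar _ _ b c (p - r) q nb nc; rewrite -em => /(_ nm) [ww e'].
  by eexists; last exact: e'; rewrite -dot_eq0 ww !mulf_neq0 // dot_eq0.
have inv : ((h * rho c) * (h * rho c) = 1)%g.
  apply: refl_lift_involutive nw' _.
  by rewrite /h !gmulfM !pi_rho ed ew'.
have {}inv : (h * rho c = rho c * h^-1)%g.
  by apply: (mulgI (h * rho c)%g); rewrite inv -(mulgA h) (mulgA (rho c)) rho_sq mul1g mulgV.
have conj : (h * (rho c * h^-1) = rho (reflv m (reflv d c)))%g.
  rewrite -(rho_conj _ (pi_rho m)) -?(rho_conj nc (pi_rho d)).
    by rewrite /h invMg !mulgA.
  by rewrite -dot_eq0 dot_reflv dot_eq0.
rewrite hh -mulgA inv conj; apply: rho_eq.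
  by rewrite -dot_eq0 !dot_reflv dot_eq0.
rewrite -ew -pi_rho -conj -inv mulgA -hh !gmulfM !pi_rho.
by rewrite ed.
Qed.

Let eval (s : seq V) : E := foldr (fun a x => rho a * x)%g 1%g s.

Let eval_cat s t : eval (s ++ t) = (eval s * eval t)%g.
Proof. by elim: s => [|a s IH] /=; rewrite ?mul1g // IH mulgA. Qed.

Let weq_eval s t : weq s t -> eval s = eval t.
Proof.
elim=> {s t} [//|//|t s u _ -> //|s1 s2 t1 t2 _ h1 _ h2||a _|p q b c w nb nc na nw ew] /=.
- by rewrite !eval_cat h1 h2.
- by rewrite /rho eqxx mulg1.
- by rewrite mulg1 rho_sq.
- by rewrite !mulg1 mulgA; apply: rho_planar.
Qed.

(** The value of a word in [E] depends only on its product, since all relations between reflections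
    follow from those checked for [rho]; concatenation of words then gives multiplicativity. *)
Lemma splitting_base : exists2 s : orthg R n -> E,
  (forall g, pi (s g) = g) & forall g h, s (g * h)%g = (s g * s h)%g.
Proof.
pose word (g : orthg R n) := sval (cid (cartan_dieudonne g)).
have wordP g : wprod (word g) = g by rewrite /word; case: cid.
have pi_eval t : pi (eval t) = wprod t.
  by elim: t => [|a t IH] /=; rewrite ?gmulf_one // gmulfM pi_rho IH.
exists (fun g => eval (word g)) => [g|g h]; first by rewrite pi_eval wordP.
rewrite -eval_cat; apply: weq_eval; apply: wprod_weq.
by rewrite wprod_cat !wordP.
Qed.

End Base.

Theorem orthg_extension_split : exists2 s : orthg R n -> E,
  (forall g, pi (s g) = g) & forall g h, s (g * h)%g = (s g * s h)%g.
Proof.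
have [[e ne]|nV] := pselect (exists e : V, e != 0).
  exact: splitting_base (dot_normalize ne).
(* Without a nonzero vector there is no base point [e], but the orthogonal group is trivial. *)
have triv (g h : orthg R n) : g = h.
  apply: orthg_eq => v; have -> : v = 0; last by rewrite !mulmx0.
  by apply/eqP; apply: contrapT => nv; apply: nV; exists v; apply/negP.
by exists (fun=> 1%g) => [g|g h]; [exact: triv | rewrite mulg1].
Qed.

End Splitting.

(** * The central extension attached to a cocycle *)

Section CentralExtension.
Variables (Gam : groupType) (M : zmodType) (c : Z2 Gam M).

(** The cocycle is a phantom argument, so that each cocycle puts its own group structure on the same
    set. *)
Definition central_ext_of of Z2 Gam M : Type := (Gam * M)%type.
Local Notation central_ext := (central_ext_of c).
HB.instance Definition _ := Choice.copy central_ext (Gam * M)%type.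

(** Cocycles are not assumed normalized, hence the correction by [c 1 1] here and in the inverse. *)
Definition cext_one : central_ext := (1%g, - c 1%g 1%g).
Definition cext_mul (x y : central_ext) : central_ext :=
  ((x.1 * y.1)%g, x.2 + y.2 + c x.1 y.1).
Definition cext_inv (x : central_ext) : central_ext :=
  (x.1^-1%g, - x.2 - c x.1^-1%g x.1 - c 1%g 1%g).

Fact cext_mulA : associative cext_mul.
Proof.
move=> [x a] [y b] [z d]; rewrite /cext_mul /= mulgA; congr pair.
by rewrite cocycleE [RHS](AC (4*3) (1*((2*4)*5)*((3*7)*6))) /= subrr add0r !addrA.
Qed.

Fact cext_mul1 : left_id cext_one cext_mul.
Proof.
by move=> [x a]; rewrite /cext_mul /= mul1g cocycle1g addrAC addNr add0r.
Qed.

Fact cext_mulr1 : right_id cext_one cext_mul.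
Proof. by move=> [x a]; rewrite /cext_mul /= mulg1 cocycleg1 subrK. Qed.

Fact cext_mulV : left_inverse cext_one cext_inv cext_mul.
Proof.
move=> [x a]; rewrite /cext_mul /= mulVg; congr pair => /=.
by rewrite (AC (3*1*1) ((1*4)*(2*5)*3)) /= !addNr !add0r.
Qed.

Fact cext_mulVr : right_inverse cext_one cext_inv cext_mul.
Proof.
move=> [x a]; rewrite /cext_mul /= mulgV; congr pair => /=.
have -> : c x x^-1%g = c x^-1%g x.
  have := cocycleE c x x^-1%g x; rewrite mulgV mulVg cocycle1g cocycleg1.
  by move=> /(congr1 (fun z => z - c 1%g 1%g)); rewrite subrr addrAC addrK => /esym/eqP;
     rewrite subr_eq0 => /eqP.
by rewrite (AC ((1*3)*1) ((1*2)*(3*5)*4)) /= addrN addNr !add0r.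
Qed.

HB.instance Definition _ := isGroup.Build central_ext
  cext_mulA cext_mul1 cext_mulr1 cext_mulV cext_mulVr.

Definition cext_proj (x : central_ext) : Gam := x.1.
Fact cext_projM : {morph cext_proj : x y / (x * y)%g}.
Proof. by []. Qed.
HB.instance Definition _ :=
  isMultiplicative.Build central_ext Gam cext_proj cext_projM.

Lemma cextM (x y : central_ext) :
  (x * y)%g = ((x.1 * y.1)%g, x.2 + y.2 + c x.1 y.1) :> central_ext.
Proof. by []. Qed.

Lemma cext_proj_central (z x : central_ext) : cext_proj z = 1%g -> commute z x.
Proof.
case: z x => [z a] [x b]; rewrite /cext_proj /= => ->.
by rewrite /commute !cextM /= mul1g mulg1 cocycle1g cocycleg1 (addrC a).
Qed.

(** The second component of a multiplicative section is, up to sign, a cochain bounding [c]. *)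
Lemma cext_split_coboundary (s : Gam -> central_ext) :
  (forall g, cext_proj (s g) = g) -> (forall g h, s (g * h)%g = (s g * s h)%g) ->
  is_coboundary c.
Proof.
move=> sp sM; exists (fun g => - (s g).2) => x y.
have -> : c x y = c (s x).1 (s y).1 by rewrite -!/(cext_proj _) !sp.
rewrite sM cextM !opprD !opprK /=.
by rewrite [RHS](AC (1*3*1) ((1*3)*(2*5)*4)) /= addNr addrN !add0r.
Qed.

End CentralExtension.

Lemma cls_surj (Gam : groupType) (M : zmodType) (a : H2 Gam M) : exists c, cls c = a.
Proof. by eexists; apply: cls_repr. Qed.

Lemma cls0 (Gam : groupType) (M : zmodType) : cls 0 = 0 :> H2 Gam M.
Proof. by apply: (addIr (cls 0)); rewrite -clsD !add0r. Qed.

Lemma Z2_opp (u : 'Z_2) : - u = u.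
Proof. by case: (Z2_case u) => ->; apply: val_inj. Qed.

Lemma Z2_add2 (u : 'Z_2) : u + u = 0.
Proof. by rewrite -{1}(Z2_opp u) addNr. Qed.

(** * Values of a cocycle that depend only on its class *)

Section ClassInvariants.
Variables (Gam : groupType) (c d : Z2 Gam 'Z_2).
Hypothesis cd : cls c = cls d.

(** On a commuting pair a coboundary is symmetric. *)
Lemma cls_commutator x y : commute x y -> c x y - c y x = d x y - d y x.
Proof.
move=> xy; have /eqP/cls_eqP[f hf] := cd.
have E u v : c u v = d u v + (f v - f (u * v)%g + f u).
  by rewrite -hf -[X in _ = _ + X]/(c u v - d u v) addrC subrK.
by rewrite !E xy [f x - _ + _]addrAC [f x + _]addrC [X in _ - (_ + X)]addrAC opprD addrACA subrr addr0.
Qed.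

(** The coboundary of [f] contributes twice [f x] minus twice [f 1], which vanishes in Z/2. *)
Lemma cls_square x : (x * x = 1)%g -> c x x - c 1%g 1%g = d x x - d 1%g 1%g.
Proof.
move=> xx; have /eqP/cls_eqP[f hf] := cd.
have E u v : c u v = d u v + (f v - f (u * v)%g + f u).
  by rewrite -hf -[X in _ = _ + X]/(c u v - d u v) addrC subrK.
rewrite !E xx mulg1 subrr add0r opprD addrACA [X in _ + X](_ : _ = 0) ?addr0 //.
by rewrite (AC (3*1) ((1*3)*(2*4))) /= Z2_add2 add0r -opprD Z2_add2 oppr0.
Qed.

End ClassInvariants.

Lemma cup0l Gam (f : H1 Gam 'Z_2) : cup 0 f = 0.
Proof.
rewrite -[RHS](subrr (cup 0 f)) /cup -clsN -clsD; apply: clsP; exists 0 => x y.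
by rewrite -[LHS]/(0 * f y - (0 * f y - 0 * f y)) !mul0r !subr0 addr0.
Qed.

Lemma cup0r Gam (f : H1 Gam 'Z_2) : cup f 0 = 0.
Proof.
rewrite -[RHS](subrr (cup f 0)) /cup -clsN -clsD; apply: clsP; exists 0 => x y.
by rewrite -[LHS]/(f x * 0 - (f x * 0 - f x * 0)) !mulr0 !subr0 addr0.
Qed.

Lemma sign_inj (F : realDomainType) (u v : 'Z_2) : (-1) ^+ u = (-1) ^+ v :> F -> u = v.
Proof.
by case: (Z2_case u) (Z2_case v) => -> [] -> // /eqP;
  rewrite ?expr0 ?expr1 ?[1 == _]eq_sym eqNr oner_eq0.
Qed.

Lemma signD (F : fieldType) (u v : 'Z_2) : (-1) ^+ (u + v)%R = (-1) ^+ u * (-1) ^+ v :> F.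
Proof. by rewrite -[LHS]/(fval (sgn F (u + v))) raddfD. Qed.

(** * Consequences of the Stiefel-Whitney axioms *)

Section SW.
Variables (R : realType) (w : stiefel_whitney R).

Section Reps.
Variable Gam : groupType.

Section Line.
Variable chi : H1 Gam 'Z_2.
Let mx (x : Gam) : 'M[R]_1 := ((-1) ^+ chi x)%:M.
Fact line_mxM x y : mx (x * y)%g = mx x *m mx y.
Proof. by rewrite /mx H1P signD scalar_mxM. Qed.
Fact line_mx1 : mx 1%g = 1%:M.
Proof.
suff e : chi 1%g = 0 by rewrite /mx e expr0.
by apply: (addIr (chi 1%g)); rewrite -H1P mulg1 add0r.
Qed.
Fact line_mx_orth x : (mx x)^T *m mx x = 1%:M.
Proof. by rewrite /mx tr_scalar_mx -scalar_mxM -expr2 sqrr_sign. Qed.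
Definition line : real_rep R Gam 1 := RealRep line_mx1 line_mxM line_mx_orth.
End Line.

Lemma w1_lineE chi : w1 w (line chi) = chi.
Proof.
apply: val_inj; apply/funext => x; apply: (@sign_inj R).
have /matrixP/(_ 0 0) := w1_line w (line chi) x.
by rewrite !mxE !mulr1n => <-.
Qed.

Fact triv_subproof n (x y : Gam) : 1%:M = 1%:M *m 1%:M :> 'M[R]_n.
Proof. by rewrite mulmx1. Qed.
Fact triv_orth_subproof n (x : Gam) : 1%:M^T *m 1%:M = 1%:M :> 'M[R]_n.
Proof. by rewrite trmx1 mulmx1. Qed.
Definition triv n : real_rep R Gam n :=
  RealRep (rmx := fun=> 1%:M) erefl (triv_subproof n) (triv_orth_subproof n).

Lemma real_rep_iso_eq n (X Y : real_rep R Gam n) : X =1 Y -> real_rep_iso X Y.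
Proof. by move=> e; exists 1%:M => [|x]; rewrite ?unitmx1 // mul1mx mulmx1 e. Qed.

Lemma w_triv n : w1 w (triv n) = 0 /\ w2 w (triv n) = 0.
Proof.
elim: n => [|n [h1 h2]]; first by split; [exact: w1_rank0 | exact: w2_rank0].
have iso : @real_rep_iso R Gam (1 + n) (triv (1 + n)) (real_rep_sum (line 0) (triv n)).
  by apply: real_rep_iso_eq => x /=; rewrite /sum_mx /= expr0 -scalar_mx_block.
have : w1 w (triv (1 + n)) = 0 /\ w2 w (triv (1 + n)) = 0; last by [].
rewrite (w1_iso w iso) (w2_iso w iso) w1_sum w2_sum h1 h2 w2_line w1_lineE.
by rewrite cup0r !addr0.
Qed.

(* The line of [a] in [X] is exchanged with a trivial line added to [X]. *)
Lemma w_eigenline n (X X' : real_rep R Gam n) (a : 'cV[R]_n) (chi : H1 Gam 'Z_2) :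
    dot a a = 1 -> (forall x, X' x *m a = a) ->
    (forall x, X x = (1%:M + ((-1) ^+ chi x - 1) *: (a *m a^T)) *m X' x) ->
  w1 w X = w1 w X' + chi /\ w2 w X = w2 w X' + cup (w1 w X') chi.
Proof.
move=> a1 X'a XE.
have iso : real_rep_iso (real_rep_sum X (triv 1)) (real_rep_sum X' (line chi)).
  have aa : a^T *m a = 1%:M by rewrite [LHS]mx11_scalar -/(dot a a) a1.
  have aX' x : a^T *m X' x = a^T.
    rewrite -{1}(X'a x) trmx_mul -mulmxA rmx_orth mulmx1 //.
  have pa : (1%:M - a *m a^T) *m a = 0.
    by rewrite mulmxBl mul1mx -mulmxA aa mulmx1 subrr.
  have ap : a^T *m (1%:M - a *m a^T) = 0.
    by rewrite mulmxBr mulmx1 mulmxA aa mul1mx subrr.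
  exists (block_mx (1%:M - a *m a^T) a a^T 0).
    suff e : block_mx (1%:M - a *m a^T) a a^T 0 *m block_mx (1%:M - a *m a^T) a a^T 0 = 1%:M.
      by case/mulmx1_unit: e.
    rewrite mulmx_block pa ap aa !mul0mx !addr0 mulmxBl mul1mx -mulmxA ap.
    by rewrite !mulmx0 subr0 subrK add0r -scalar_mx_block.
  move=> x.
  have e1 : (1%:M - a *m a^T) *m X x = X' x - a *m a^T.
    rewrite XE mulmxA mulmxDr mulmx1 -scalemxAr mulmxA pa mul0mx scaler0 addr0.
    by rewrite mulmxBl mul1mx -mulmxA aX'.
  have e2 : a^T *m X x = (-1) ^+ chi x *: a^T.
    rewrite XE mulmxA mulmxDr mulmx1 -scalemxAr mulmxA aa mul1mx mulmxDl -scalemxAl aX'.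
    by rewrite scalerBl scale1r addrC subrK.
  have e3 : X' x *m (1%:M - a *m a^T) = X' x - a *m a^T.
    by rewrite mulmxBr mulmx1 mulmxA X'a.
  rewrite /= /sum_mx !mulmx_block e1 e2 e3 !mulmx0 !mul0mx !addr0 !add0r mulmx1 X'a.
  by rewrite mul_scalar_mx.
have [t1 t2] := w_triv 1.
have := w1_iso w iso; have := w2_iso w iso.
rewrite !w1_sum !w2_sum t1 t2 w1_lineE w2_line cup0r !addr0 => -> ->.
by [].
Qed.

End Reps.

Variable n : nat.
Local Notation O := (orthg R n).

(** The universal case: every real orthogonal representation of rank [n] is a pullback of this
    one. *)
Definition taut : real_rep R O n :=
  RealRep (@omat1 R n) (@omatM R n) (@orthgP R n).

Definition refl_pow (v : 'cV[R]_n) (i : 'Z_2) : O := if i == 0 then 1%g else refl v.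

Lemma refl_pow_0v i : refl_pow 0 i = 1%g.
Proof. by rewrite /refl_pow refl0 if_same. Qed.

Lemma refl_powD v i k : refl_pow v (i + k) = (refl_pow v i * refl_pow v k)%g.
Proof.
by case: (Z2_case i) (Z2_case k) => -> [] ->; rewrite ?Z2_add2 ?add0r ?addr0 /refl_pow /=
  ?mul1g ?mulg1 ?reflK.
Qed.

Section Klein.
Variables a b : 'cV[R]_n.
Hypothesis ab : dot a b = 0.
Local Notation H := ('Z_2 * 'Z_2)%type.

Let refl_pow_commute i k : commute (refl_pow a i) (refl_pow b k).
Proof.
by rewrite /refl_pow; do 2!case: eqP => _; rewrite /commute ?mul1g ?mulg1 // refl_commute.
Qed.

(** Zero vectors are allowed, so the same family also contains the subgroups generated by one
    reflection. *)
Definition klein (u : H) : O := (refl_pow a u.1 * refl_pow b u.2)%g.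
Fact kleinM : {morph klein : x y / (x * y)%g}.
Proof.
move=> x y; rewrite /klein /= !refl_powD -!mulgA; congr (_ * _)%g; rewrite !mulgA.
by rewrite refl_pow_commute.
Qed.
HB.instance Definition _ := isMultiplicative.Build H O klein kleinM.

Definition klein_hom : {multiplicative H -> O} := klein.

End Klein.

Local Notation H := ('Z_2 * 'Z_2)%type.
Definition char1 : H1 H 'Z_2 := mkH1 (fun x y : H => erefl (x.1 + y.1)).
Definition char2 : H1 H 'Z_2 := mkH1 (fun x y : H => erefl (x.2 + y.2)).

Lemma refl_powE a i : dot a a = 1 ->
  omat (refl_pow a i) = 1%:M + ((-1) ^+ i - 1) *: (a *m a^T).
Proof.
move=> a1; case: (Z2_case i) => ->; first by rewrite expr0 subrr scale0r addr0.
rewrite -[LHS]/(refl_mx a) /refl_mx a1 divr1 expr1 -opprD scaleNr.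
by congr (_ - _ *: _).
Qed.

Lemma w_refl_pow (Gam : groupType) (X : real_rep R Gam n) a (chi : H1 Gam 'Z_2) :
  dot a a = 1 -> (forall x, X x = refl_pow a (chi x)) -> w1 w X = chi /\ w2 w X = 0.
Proof.
move=> a1 XE; have [t1 t2] := w_triv Gam n.
have := @w_eigenline _ _ X (triv Gam n) a chi a1; rewrite t1 t2 cup0l !add0r; apply.
  by move=> x; rewrite mul1mx.
by move=> x; rewrite mulmx1 XE refl_powE.
Qed.

Lemma w2_klein a b (ab : dot a b = 0) : dot a a = 1 -> dot b b = 1 ->
  w2 w (real_rep_pull (klein_hom ab) taut) = cup char2 char1.
Proof.
move=> a1 b1; have b0 : dot 0 b = 0 by rewrite dot0l.
(* [X'] forgets the reflection in [a]; it fixes [a], and [X] differs from it by the sign [char1] on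
   the line of [a]. *)
pose X := real_rep_pull (klein_hom ab) taut; pose X' := real_rep_pull (klein_hom b0) taut.
have X'E x : X' x = refl_pow b (char2 x).
  by rewrite -[LHS]/(omat (refl_pow 0 x.1 * refl_pow b x.2)%g) refl_pow_0v mul1g.
have [e1 e2] := w_refl_pow b1 X'E.
have := @w_eigenline _ _ X X' a char1 a1; rewrite e1 e2 add0r; case=> // x.
  rewrite X'E /refl_pow; case: eqP => _; rewrite ?mul1mx // reflE reflv_orth //.
  by rewrite dotC.
by rewrite X'E -refl_powE.
Qed.

Lemma w2_klein0 a (a0 : dot a 0 = 0) : dot a a = 1 ->
  w2 w (real_rep_pull (klein_hom a0) taut) = 0.
Proof.
move=> a1.
have XE x : real_rep_pull (klein_hom a0) taut x = refl_pow a (char1 x).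
  by rewrite -[LHS]/(omat (refl_pow a x.1 * refl_pow 0 x.2)%g) refl_pow_0v mulg1.
by have [] := w_refl_pow a1 XE.
Qed.

(** A cocycle [c] of class [w2] satisfies the same two conditions as [p], by restriction to Klein
    subgroups. In the extension of [p - c] lifts of reflections are then involutions and lifts of
    orthogonal reflections commute, so that it splits. *)
Theorem w2_tautE (p : Z2 O 'Z_2) :
    (forall a, dot a a = 1 -> p (refl a) (refl a) = p 1%g 1%g) ->
    (forall a b, dot a a = 1 -> dot b b = 1 -> dot a b = 0 ->
       p (refl a) (refl b) - p (refl b) (refl a) = 1) ->
  cls p = w2 w taut.
Proof.
move=> psq pcom; have [c ec] := cls_surj (w2 w taut).
have cE a b (ab : dot a b = 0) :
    cls (Z2_pull (klein_hom ab) c) = w2 w (real_rep_pull (klein_hom ab) taut).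
  by rewrite w2_pull -ec H2_pull_cls.
have klein1 a b (ab : dot a b = 0) : klein_hom ab 1%g = 1%g by rewrite gmulf_one.
have klein10 a b (ab : dot a b = 0) : klein_hom ab (1, 0) = refl a.
  by rewrite -[LHS]/(refl a * 1)%g mulg1.
have klein01 a b (ab : dot a b = 0) : klein_hom ab (0, 1) = refl b.
  by rewrite -[LHS]/(1 * refl b)%g mul1g.
have pullE a b (ab : dot a b = 0) x y :
  Z2_pull (klein_hom ab) c x y = c (klein_hom ab x) (klein_hom ab y) by [].
have csq a : dot a a = 1 -> c (refl a) (refl a) = c 1%g 1%g.
  move=> a1; have a0 := dot0r a; have := cE _ _ a0; rewrite w2_klein0 // -cls0.
  move=> /cls_square /(_ ((1, 0) : 'Z_2 * 'Z_2)%type); rewrite !pullE klein10 klein1.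
  by move=> h; apply/eqP; rewrite -subr_eq0 h ?subrr //; congr pair; apply: val_inj.
have ccom a b : dot a a = 1 -> dot b b = 1 -> dot a b = 0 ->
    c (refl a) (refl b) - c (refl b) (refl a) = 1.
  move=> a1 b1 ab; have := cE _ _ ab; rewrite w2_klein // /cup.
  move=> /cls_commutator /(_ (1, 0) (0, 1)); rewrite !pullE klein10 klein01.
  (* Only one of the two orders contributes to the cup product, and -1 = 1 in Z/2. *)
  move=> ->; first by rewrite -[LHS]/(0 * 0 - 1 * 1) mul0r mul1r sub0r Z2_opp.
  by congr pair; apply: val_inj.
rewrite -ec; apply: clsP; set d := p - c.
have dE x y : d x y = p x y - c x y by [].
have nn (a : 'cV[R]_n) : a != 0 -> refl (normalize a) = refl a.
  by move=> na; rewrite reflZ // invr_eq0 sqrt_dot_neq0.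
have [g | z x | a x na xa | a b x y na nb ab xa yb | s sp sM] :=
    @orthg_extension_split R n (central_ext_of d) (@cext_proj _ _ d).
- by exists (g, 0).
- exact: cext_proj_central.
- have e : d (refl a) (refl a) = d 1%g 1%g.
    by rewrite -nn // !dE psq ?csq ?dot_normalize.
  case: x xa => x u; rewrite /cext_proj /= => ->.
  rewrite -[LHS]/((refl a * refl a)%g, u + u + d (refl a) (refl a)).
  by rewrite reflK Z2_add2 add0r e -[RHS]/(1%g, - d 1%g 1%g) Z2_opp.
- have ab1 : dot (normalize a) (normalize b) = 0.
    by rewrite dotZl dotZr ab !mulr0.
  have e : d (refl a) (refl b) = d (refl b) (refl a).
    apply/eqP; rewrite -subr_eq0 -(nn _ na) -(nn _ nb) !dE opprD opprK addrACA.
    rewrite -[X in _ + (_ + X)]opprK -opprD pcom ?ccom ?dot_normalize //.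
  case: x xa => x u; case: y yb => y v; rewrite /cext_proj /= => -> ->.
  rewrite /commute -[LHS]/((refl a * refl b)%g, u + v + d (refl a) (refl b)).
  rewrite -[RHS]/((refl b * refl a)%g, v + u + d (refl b) (refl a)).
  by rewrite e (refl_commute ab) (addrC u).
- exact: cext_split_coboundary sp sM.
Qed.

End SW.

(** * Clifford algebras *)

Section CliffordTheory.
Variable F : fieldType.

Lemma lrmorphism_of (C A : algType F) (k : C -> A) :
  linear k -> monoid_morphism k -> {g : {lrmorphism C -> A} | g =1 k}.
Proof.
move=> kl km.
pose kl' := GRing.isLinear.Build F C A *:%R k kl.
pose km' := GRing.isMonoidMorphism.Build C A k km.
pose g : {lrmorphism C -> A} := HB.pack k kl' km'.
by exists g.
Qed.

Lemma linear_of (U V : lmodType F) (k : U -> V) :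
  linear k -> {g : {linear U -> V} | g =1 k}.
Proof.
move=> kl; pose g : {linear U -> V} := HB.pack k (GRing.isLinear.Build F U V *:%R k kl).
by exists g.
Qed.

Lemma lr_alg (C A : algType F) (g : {lrmorphism C -> A}) l : g l%:A = l%:A.
Proof. exact: rmorph_alg. Qed.

Section Universal.
Variables (m : nat) (B : 'M[F]_m) (Cl : clifford_algebra B).
Local Notation iota := (cvec Cl).

Lemma cvec_sq v : iota v * iota v = (quad B v)%:A.
Proof. exact: cvec_clifford. Qed.

Lemma cuniv_sig (A : algType F) (f : {linear 'cV[F]_m -> A}) :
  is_clifford_map B f -> {g : {lrmorphism Cl -> A} | forall v, g (iota v) = f v}.
Proof. by move=> hf; apply: cid; have [g [h _]] := @cuniv _ _ _ Cl _ f hf; exists g. Qed.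

Lemma cuniv_ext (A : algType F) (g g' : {lrmorphism Cl -> A}) :
  (forall v, g (iota v) = g' (iota v)) -> g =1 g'.
Proof.
move=> e; pose f : {linear 'cV[F]_m -> A} := g' \o iota.
have hf : is_clifford_map B f.
  by move=> v; rewrite /f /= -rmorphM /= cvec_sq lr_alg.
have [k [_ ku]] := @cuniv _ _ _ Cl _ f hf => x.
by rewrite (ku g) // (ku g').
Qed.

Fact grade_inv_subproof : is_clifford_map B (-%R \o iota).
Proof. by move=> v /=; rewrite mulrNN cvec_sq. Qed.

(** The grade automorphism. It stands in for the grading, which [chomogeneous] describes only by
    expressions in vectors. *)
Definition grade_inv : {lrmorphism Cl -> Cl} := sval (cuniv_sig grade_inv_subproof).

Lemma grade_invE v : grade_inv (iota v) = - iota v.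
Proof. by rewrite /grade_inv; case: cuniv_sig. Qed.

Lemma grade_invK u : grade_inv (grade_inv u) = u.
Proof.
apply: (@cuniv_ext _ (grade_inv \o grade_inv) idfun) => v /=.
by rewrite !grade_invE rmorphN /= grade_invE opprK.
Qed.

(** The twist by the grade automorphism matters: in odd dimension the volume element is central in
    the ordinary sense, without being a scalar. *)
Definition twisted_central (u : Cl) : Prop :=
  forall v, grade_inv u * iota v = iota v * u.

End Universal.

Definition twisted_centrally_scalar m (B : 'M[F]_m) (Cl : clifford_algebra B) : Prop :=
  forall u : Cl, twisted_central u -> exists l : F, u = l%:A.

(** Two models of the same Clifford algebra are canonically isomorphic, compatibly with the grade
    automorphisms. What is proved in a constructed model thus applies to the arbitrary one of
    [clifford_class]. *)
Lemma twisted_centrally_scalar_any m (B : 'M[F]_m) (Cl Cl' : clifford_algebra B) :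
  twisted_centrally_scalar Cl -> twisted_centrally_scalar Cl'.
Proof.
move=> H u uc.
have [g gE] := cuniv_sig Cl' (@cvec_clifford _ _ _ Cl).
have [h hE] := cuniv_sig Cl (@cvec_clifford _ _ _ Cl').
have hg x : h (g x) = x.
  by apply: (@cuniv_ext _ _ _ _ (h \o g) idfun) => v /=; rewrite gE hE.
have ga x : g (grade_inv Cl' x) = grade_inv Cl (g x).
  apply: (@cuniv_ext _ _ _ _ (g \o grade_inv Cl') (grade_inv Cl \o g)) => v /=.
  by rewrite grade_invE rmorphN /= gE grade_invE.
have [v|l e] := H (g u).
  by rewrite -ga -gE -!rmorphM /= uc.
by exists l; rewrite -(hg u) e lr_alg.
Qed.

(* The skew extension [C + C x] with [x ^ 2 = 1] and [x c = alpha c x]. *)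
Section Double.
Variables (C : algType F) (alpha : {lrmorphism C -> C}).
Hypothesis alphaK : forall c, alpha (alpha c) = c.

(** The involution is recorded in the type through the proof that it is one, so that the product can
    depend on it. *)
Definition double of cancel alpha alpha : Type := (C * C)%type.
Local Notation D := (double alphaK).
HB.instance Definition _ := GRing.Lmodule.copy D (C * C)%type.

Definition double_mul (x y : D) : D :=
  (x.1 * y.1 + x.2 * alpha y.2, x.1 * y.2 + x.2 * alpha y.1).
Definition double_one : D := (1, 0).

Fact double_mulA : associative double_mul.
Proof.
move=> [a b] [c d] [e f]; rewrite /double_mul /= !rmorphD !rmorphM /= !alphaK.
rewrite !mulrDl !mulrDr !mulrA; congr pair.
  by rewrite [RHS](AC (2*2) ((1*3)*(4*2))).
by rewrite [RHS](AC (2*2) ((1*3)*(4*2))).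
Qed.

Fact double_mul1 : left_id double_one double_mul.
Proof. by move=> [a b]; rewrite /double_mul /= !mul1r !mul0r !addr0. Qed.

Fact double_mulr1 : right_id double_one double_mul.
Proof.
by move=> [a b]; rewrite /double_mul /= !mulr1 rmorph0 rmorph1 mulr0 mulr1 addr0 mulr0 add0r.
Qed.

Fact double_mulDl : left_distributive double_mul +%R.
Proof. by move=> [a b] [c d] [e f]; rewrite /double_mul /= !mulrDl; congr pair; rewrite addrACA. Qed.

Fact double_mulDr : right_distributive double_mul +%R.
Proof.
by move=> [a b] [c d] [e f]; rewrite /double_mul /= !rmorphD !mulrDr; congr pair; rewrite addrACA.
Qed.

Fact double_one_neq0 : double_one != 0.
Proof. by rewrite -[0]/((0, 0) : D) /double_one xpair_eqE oner_eq0. Qed.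

HB.instance Definition _ := GRing.Zmodule_isNzRing.Build D
  double_mulA double_mul1 double_mulr1 double_mulDl double_mulDr double_one_neq0.

Lemma doubleM (x y : D) :
  x * y = (x.1 * y.1 + x.2 * alpha y.2, x.1 * y.2 + x.2 * alpha y.1).
Proof. by []. Qed.

Lemma doubleZ l (x : D) : l *: x = (l *: x.1, l *: x.2). Proof. by []. Qed.

Fact double_scalerAl l (x y : D) : l *: (x * y) = (l *: x : D) * y.
Proof. rewrite doubleM -[RHS]/(double_mul (l *: x) y) /double_mul !doubleZ /=.
by rewrite !scalerDr !scalerAl. Qed.
HB.instance Definition _ := GRing.Lmodule_isLalgebra.Build F D double_scalerAl.

Fact double_scalerAr l (x y : D) : l *: (x * y) = x * (l *: y : D).
Proof.
rewrite doubleM -[RHS]/(double_mul x (l *: y)) /double_mul !doubleZ /=.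
by rewrite !linearZ /= !scalerDr -!scalerAr.
Qed.
HB.instance Definition _ := GRing.Lalgebra_isAlgebra.Build F D double_scalerAr.

End Double.

Lemma quad1E m (v : 'cV[F]_m) : quad 1%:M v = \sum_i v i 0 * v i 0.
Proof. by rewrite /quad mulmx1 mxE; apply: eq_bigr => i _; rewrite mxE. Qed.

(** * Adding one orthonormal vector to a Clifford algebra *)

Section Step.
Variables (m : nat) (Cl : clifford_algebra (1%:M : 'M[F]_m)).
Local Notation D := (double (@grade_invK _ _ Cl)).
Local Notation iota := (cvec Cl).

Lemma quad1_col (v : 'cV[F]_(1 + m)) :
  quad 1%:M v = quad 1%:M (dsubmx v) + v 0 0 * v 0 0.
Proof.
rewrite !quad1E big_ord_recl addrC; congr (_ + _).
by apply: eq_bigr => i _; rewrite !mxE; have -> : lift ord0 i = rshift 1 i by apply: val_inj.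
Qed.

(** The first coordinate goes to the new generator [x], which has square 1 and anticommutes with the
    old vectors because the skew extension is taken along [grade_inv]. *)
Definition double_vec (v : 'cV[F]_(1 + m)) : D := (iota (dsubmx v), (v 0 0)%:A).

Fact double_vec_linear : linear double_vec.
Proof.
move=> l u v; rewrite /double_vec !mxE linearP linearP scalerDl -scalerA.
by rewrite /=.
Qed.

Fact double_vec_clifford v : double_vec v * double_vec v = (quad 1%:M v)%:A.
Proof.
rewrite doubleM doubleZ /= cvec_sq lr_alg -scalerAl mul1r scalerA scaler0.
by rewrite quad1_col scalerDl grade_invE mulrN -scalerAl mul1r -scalerAr mulr1 subrr.
Qed.

Let low (v : 'cV[F]_m) : 'cV[F]_(1 + m) := col_mx 0 v.
Let e0 : 'cV[F]_(1 + m) := col_mx 1%:M 0.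

Let vE (v : 'cV[F]_(1 + m)) : v = low (dsubmx v) + v 0 0 *: e0.
Proof.
rewrite /low /e0 scale_col_mx add_col_mx scaler0 addr0 add0r -[LHS]vsubmxK; congr col_mx.
rewrite [LHS]mx11_scalar !mxE -mul_scalar_mx mulmx1; congr ((v _ _)%:M).
exact: val_inj.
Qed.

Let low_linear : linear low.
Proof. by move=> l u v; rewrite /low scale_col_mx add_col_mx scaler0 addr0. Qed.

Let low_dsub v : dsubmx (low v) = v. Proof. exact: col_mxKd. Qed.

Let low0 v : low v 0 0 = 0.
Proof.
rewrite /low; have -> : 0 = lshift m (0 : 'I_1) :> 'I_(1 + m) by apply: val_inj.
by rewrite col_mxEu mxE.
Qed.

Let e00 : e0 0 0 = 1.
Proof.
rewrite /e0; have -> : 0 = lshift m (0 : 'I_1) :> 'I_(1 + m) by apply: val_inj.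
by rewrite col_mxEu mxE eqxx.
Qed.

Let e0_dsub : dsubmx e0 = 0. Proof. exact: col_mxKd. Qed.

Let double_low v : double_vec (low v) = (iota v, 0).
Proof. by rewrite /double_vec low_dsub low0 scale0r. Qed.

Let double_e0 : double_vec e0 = (0, 1).
Proof. by rewrite /double_vec e0_dsub linear0 e00 scale1r. Qed.

Lemma double_incl : {i : {lrmorphism Cl -> D} | forall c, i c = (c, 0)}.
Proof.
apply: lrmorphism_of.
  by move=> l u v; rewrite -[RHS]/(l *: u + v, l *: 0 + 0) scaler0 addr0.
split=> // u v; rewrite doubleM /= rmorph0 !mulr0 mul0r !addr0.
by [].
Qed.

Lemma doubleE (i := sval double_incl) (x : D) : x = i x.1 + i x.2 * ((0, 1) : D).
Proof.
rewrite /i; case: double_incl => {}i iE; rewrite !iE doubleM /=.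
rewrite -[RHS]/(x.1 + (x.2 * 0 + 0 * grade_inv Cl 1), 0 + (x.2 * 1 + 0 * grade_inv Cl 0)).
by rewrite !mul0r mulr0 mulr1 !addr0 add0r; case: x.
Qed.

Section Univ.
Variables (A : algType F) (f : {linear 'cV[F]_(1 + m) -> A}).
Hypothesis hf : is_clifford_map 1%:M f.

Let y := f e0.

Let quad_low v l : quad 1%:M (low v + l *: e0) = quad 1%:M v + l * l.
Proof.
have e : (low v + l *: e0) 0 0 = l.
  by rewrite mxE [X in _ + X]mxE low0 e00 mulr1 add0r.
by rewrite quad1_col e linearD linearZ /= low_dsub e0_dsub scaler0 addr0.
Qed.

Let fsq v l : f (low v + l *: e0) * f (low v + l *: e0) = (quad 1%:M v + l * l)%:A.
Proof. by rewrite hf quad_low. Qed.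

Let flow_sq v : f (low v) * f (low v) = (quad 1%:M v)%:A.
Proof. by have := fsq v 0; rewrite scale0r addr0 mul0r addr0. Qed.

Let yy : y * y = 1.
Proof.
have := fsq 0 1; have -> : low 0 = 0 by rewrite /low col_mx0.
rewrite add0r scale1r -/y => ->.
by rewrite quad1E big1 ?add0r ?mulr1 ?scale1r // => i _; rewrite !mxE mulr0.
Qed.

Let anti v : f (low v) * y = - (y * f (low v)).
Proof.
have := fsq v 1; rewrite scale1r linearD /= -/y mulrDl !mulrDr flow_sq yy mulr1 scalerDl.
rewrite scale1r addrA => /addIr; rewrite -addrA -[RHS]addr0 => /addrI /eqP.
by rewrite addr_eq0 => /eqP.
Qed.

Let flow_linear : linear (fun v => f (low v)).
Proof. by move=> l u v; rewrite low_linear linearP. Qed.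

Let flow := sval (linear_of flow_linear).

Let flowE v : flow v = f (low v).
Proof. by rewrite /flow; case: (linear_of flow_linear). Qed.

Let g0_subproof : is_clifford_map 1%:M flow.
Proof. by move=> v; rewrite flowE flow_sq. Qed.

Let g0 := sval (cuniv_sig Cl g0_subproof).

Let g0E v : g0 (iota v) = f (low v).
Proof. by rewrite /g0; case: (cuniv_sig Cl g0_subproof) => g h /=; rewrite h flowE. Qed.

(** The map [c |-> y * g0 (grade_inv c) * y] is an algebra morphism since [y * y = 1], and it agrees
    with [g0] on vectors since [y] anticommutes with them. *)
Let g0_grade c : g0 (grade_inv Cl c) * y = y * g0 c.
Proof.
pose k c := y * g0 (grade_inv Cl c) * y.
have kl : linear k.
  move=> l u v; rewrite /k /= !linearP /= mulrDr mulrDl -scalerAr -scalerAl.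
  by [].
have km : monoid_morphism k.
  split; first by rewrite /k (rmorph1 (grade_inv Cl)) (rmorph1 g0) mulr1 yy.
  by move=> u v; rewrite /k !rmorphM /= -!mulrA (mulrA y y) yy mul1r.
have [h hE] := lrmorphism_of kl km.
have hg : h =1 g0.
  apply: cuniv_ext => v; rewrite hE /k grade_invE rmorphN /= g0E mulrN mulNr.
  by rewrite -mulrA anti mulrN opprK mulrA yy mul1r.
by rewrite -[in RHS]hg hE /k !mulrA yy mul1r.
Qed.

(** The formula [a + b x |-> g0 a + g0 b * y] is forced; the commutation rule [g0_grade] is what
    makes it multiplicative. *)
Lemma double_univ :
  exists g : {lrmorphism D -> A}, (forall v, g (double_vec v) = f v) /\
    forall g' : {lrmorphism D -> A}, (forall v, g' (double_vec v) = f v) -> g' =1 g.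
Proof.
pose k (x : D) := g0 x.1 + g0 x.2 * y.
have kl : linear k.
  move=> l u v; rewrite /k /= !linearP /= mulrDl scalerDr scalerAl.
  by rewrite addrACA.
have km : monoid_morphism k.
  split; first by rewrite /k /= (rmorph1 g0) rmorph0 mul0r addr0.
  move=> [a b] [c d]; rewrite doubleM /k /= !rmorphD !rmorphM /= !mulrDl !mulrDr.
  rewrite -!mulrA -(g0_grade c) (mulrA y (g0 d) y) -(g0_grade d) -[in RHS](mulrA _ y y) yy.
  by rewrite mulr1 [LHS](AC (2*2) ((1*3)*(4*2))).
have [g gE] := lrmorphism_of kl km; exists g; split.
  move=> v; rewrite gE /k /= g0E lr_alg -scalerAl mul1r [in RHS](vE v) linearD linearZ /=.
  by [].
move=> g' hg' [a b]; rewrite gE /k /=.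
have gi : g' \o sval double_incl =1 g0.
  apply: cuniv_ext => v /=; case: double_incl => i iE /=.
  by rewrite iE g0E -hg' double_low.
have gx : g' (0, 1) = y by rewrite /y -hg' double_e0.
have -> : (a, b) = sval double_incl a + sval double_incl b * ((0, 1) : D).
  exact: doubleE (a, b).
by rewrite rmorphD rmorphM /= gx -!gi.
Qed.

End Univ.

Let dvec := sval (linear_of double_vec_linear).

Let dvecE v : dvec v = double_vec v.
Proof. by rewrite /dvec; case: (linear_of double_vec_linear). Qed.

Let dvec_clifford : is_clifford_map 1%:M dvec.
Proof. by move=> v; rewrite dvecE double_vec_clifford. Qed.

Let dvec_univ (A : algType F) (f : {linear 'cV[F]_(1 + m) -> A}) :
  is_clifford_map 1%:M f ->
  exists g : {lrmorphism D -> A}, (forall v, g (dvec v) = f v) /\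
    forall g' : {lrmorphism D -> A}, (forall v, g' (dvec v) = f v) -> g' =1 g.
Proof.
move=> /double_univ [g [h1 h2]]; exists g; split=> [v|g' hg']; first by rewrite dvecE.
by apply: h2 => v; rewrite -dvecE.
Qed.

Definition double_clifford : clifford_algebra (1%:M : 'M[F]_(1 + m)) :=
  CliffordAlgebra dvec_clifford dvec_univ.

(** Testing [a + b x] on the new vector gives [- grade_inv b = grade_inv b], so [b] vanishes in
    characteristic different from 2; testing it on the old vectors reduces to [a]. *)
Lemma double_twisted_centrally_scalar : 2 != 0 :> F ->
  twisted_centrally_scalar Cl -> twisted_centrally_scalar double_clifford.
Proof.
move=> two H [a b] uc; pose i := sval double_incl.
have iE c : i c = (c, 0) by rewrite /i; case: double_incl.
pose be : {lrmorphism D -> D} := grade_inv double_clifford.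
have beE v : be (double_vec v) = - double_vec v.
  by rewrite -dvecE; apply: (grade_invE double_clifford).
have bi c : be (i c) = i (grade_inv Cl c).
  apply: (cuniv_ext (g := be \o i) (g' := i \o grade_inv Cl)) => v /=.
  by rewrite grade_invE rmorphN /= iE -double_low beE.
have bab : be (a, b) = (grade_inv Cl a, - grade_inv Cl b).
  rewrite [X in be X]doubleE -/i rmorphD rmorphM /= !bi -double_e0 beE double_e0.
  rewrite mulrN -mulNr -rmorphN [RHS]doubleE -/i /=.
  by [].
have {}uc v : be (a, b) * double_vec v = double_vec v * ((a, b) : D).
  by rewrite -dvecE; apply: uc.
have b0 : b = 0.
  have := uc e0; rewrite bab double_e0 !doubleM /= !mul0r !mulr0 !add0r mul1r.
  rewrite (rmorph1 (grade_inv Cl)) mulr1.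
  move=> /(congr1 fst) /= /eqP; rewrite -subr_eq0 -opprD oppr_eq0 -mulr2n.
  rewrite -scaler_nat scaler_eq0 (negPf two) /= => /eqP h.
  by rewrite -(grade_invK b) h rmorph0.
have [v|l al] := H a.
  have := uc (low v); rewrite bab double_low !doubleM /= b0 !rmorph0 !mulr0 !mul0r !addr0.
  by move=> /(congr1 fst).
by exists l; rewrite al b0 -[RHS]/(l *: 1, l *: 0) scaler0.
Qed.

End Step.

Section Base.
Local Notation B0 := (1%:M : 'M[F]_0).

Let quad00 (v : 'cV[F]_0) : quad B0 v = 0.
Proof. by rewrite quad1E big_ord0. Qed.

Let zero_clifford : is_clifford_map (A := F^o) B0 (\0 : {linear 'cV[F]_0 -> F^o}).
Proof. by move=> v; rewrite quad00 scale0r /= mulr0. Qed.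

Let zero_univ (A : algType F) (f : {linear 'cV[F]_0 -> A}) :
  is_clifford_map B0 f ->
  exists g : {lrmorphism F^o -> A},
    (forall v, g ((\0 : {linear 'cV[F]_0 -> F^o}) v) = f v) /\
    forall g' : {lrmorphism F^o -> A},
      (forall v, g' ((\0 : {linear 'cV[F]_0 -> F^o}) v) = f v) -> g' =1 g.
Proof.
move=> _; have kl : linear (fun c : F^o => c%:A : A).
  by move=> l u v; rewrite scalerDl scalerA.
have km : monoid_morphism (fun c : F^o => c%:A : A).
  by split; rewrite ?scale1r // => u v; rewrite -scalerAl mul1r scalerA.
have [g gE] := lrmorphism_of kl km; exists g; split.
  move=> v; rewrite gE /= scale0r; have -> : v = 0 by apply/colP => -[].
  by rewrite linear0.
move=> g' _ c; rewrite gE -(lr_alg g') /=; congr (g' _).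
by rewrite -[RHS]/(c * 1) mulr1.
Qed.

Definition zero_clifford_algebra : clifford_algebra B0 :=
  CliffordAlgebra zero_clifford zero_univ.

Lemma zero_twisted_centrally_scalar : twisted_centrally_scalar zero_clifford_algebra.
Proof. by move=> u _; exists u; rewrite -[RHS]/(u * 1) mulr1. Qed.

End Base.

Theorem clifford_algebra1_exists : 2 != 0 :> F -> forall m,
  exists Cl : clifford_algebra (1%:M : 'M[F]_m), twisted_centrally_scalar Cl.
Proof.
move=> two; elim=> [|m [Cl h]].
  by exists zero_clifford_algebra; apply: zero_twisted_centrally_scalar.
by exists (double_clifford Cl); apply: double_twisted_centrally_scalar.
Qed.

(** A change of coordinates from the standard form. Forms [Q^T *m Q] suffice for later use, since a
    real form supplies an orthonormal basis. *)
Theorem clifford_algebra_exists m (Q : 'M[F]_m) : 2 != 0 :> F -> Q \in unitmx ->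
  exists Cl : clifford_algebra (Q^T *m Q), twisted_centrally_scalar Cl.
Proof.
move=> two Qu; have [Cl h] := clifford_algebra1_exists two m.
have ql : linear (fun v => cvec Cl (Q *m v)).
  by move=> l u v; rewrite mulmxDr -scalemxAr linearP.
have [q qE] := linear_of ql.
have quadQ v : quad (Q^T *m Q) v = quad 1%:M (Q *m v).
  by rewrite /quad mulmx1 trmx_mul !mulmxA.
have qc : is_clifford_map (Q^T *m Q) q by move=> v; rewrite qE cvec_sq quadQ.
have qu (A : algType F) (f : {linear 'cV[F]_m -> A}) : is_clifford_map (Q^T *m Q) f ->
    exists g : {lrmorphism Cl -> A}, (forall v, g (q v) = f v) /\
      forall g' : {lrmorphism Cl -> A}, (forall v, g' (q v) = f v) -> g' =1 g.
  move=> hf; have fl : linear (fun v => f (invmx Q *m v)).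
    by move=> l u v; rewrite mulmxDr -scalemxAr linearP.
  have [f' f'E] := linear_of fl.
  have hf' : is_clifford_map 1%:M f'.
    by move=> v; rewrite f'E hf quadQ mulKVmx.
  have [g gE] := cuniv_sig Cl hf'; exists g; split=> [v|g' g'E].
    by rewrite qE gE f'E mulKmx.
  by apply: cuniv_ext => v; rewrite gE f'E -g'E qE mulKVmx.
exists (CliffordAlgebra qc qu) => u uc; apply: h => v.
have e : grade_inv (CliffordAlgebra qc qu) u = grade_inv Cl u.
  apply: (@cuniv_ext _ _ Cl _ (grade_inv (CliffordAlgebra qc qu)) (grade_inv Cl)) => x.
  rewrite grade_invE -[x](mulKVmx Qu) -qE.
  exact: (grade_invE (CliffordAlgebra qc qu)).
by rewrite -e -[v](mulKVmx Qu) -qE; apply: uc.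
Qed.

End CliffordTheory.

(** * Uniqueness of lifts to the Clifford group *)

Section CliffordLifts.
Variables (F : fieldType) (m : nat) (B : 'M[F]_m) (Cl : clifford_algebra B).
Local Notation iota := (cvec Cl).

Lemma cvec_polar u v :
  iota u * iota v + iota v * iota u = ((u^T *m B *m v) 0 0 + (v^T *m B *m u) 0 0)%:A.
Proof.
have := cvec_sq Cl (u + v); rewrite linearD mulrDl !mulrDr !cvec_sq.
have -> : quad B (u + v) = quad B u + ((u^T *m B *m v) 0 0 + (v^T *m B *m u) 0 0) + quad B v.
  by rewrite /quad [(u + v)^T]linearD /= !mulmxDl !mulmxDr !(mxE, addrA).
rewrite [(_ + quad B v)%:A]scalerDl [(quad B u + _)%:A]scalerDl addrA => /addIr.
by rewrite -addrA => /addrI.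
Qed.

Lemma chomogeneous1 : chomogeneous false (1 : Cl).
Proof.
exists [:: (1, [::])] => //.
by rewrite big_seq1 /= big_nil scale1r.
Qed.

Lemma chomogeneous_mulvec d v (u : Cl) :
  chomogeneous d u -> chomogeneous (~~ d) (iota v * u).
Proof.
move=> [s hs ->]; exists [seq (w.1, v :: w.2) | w <- s].
  apply/allP => _ /mapP[w ws ->] /=; rewrite (eqP (allP hs w ws)).
  by [].
rewrite big_map mulr_sumr; apply: eq_bigr => w _ /=.
by rewrite big_cons scalerAr.
Qed.

Lemma chomogeneous_grade d (u : Cl) : chomogeneous d u -> grade_inv Cl u = (-1) ^+ d *: u.
Proof.
move=> [s hs ->]; rewrite rmorph_sum scaler_sumr big_seq [RHS]big_seq.
apply: eq_bigr => w ws; rewrite [LHS]linearZ /= [RHS]scalerA mulrC -scalerA; congr (_ *: _).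
rewrite -(eqP (allP hs w ws)) rmorph_prod.
elim: (w.2) => [|v t IH]; first by rewrite !big_nil scale1r.
rewrite !big_cons IH /= grade_invE; case: (odd _).
  by rewrite /= expr1 expr0 !scaleN1r mulrNN scale1r.
by rewrite /= expr0 expr1 scale1r scaleN1r mulNr.
Qed.

(** The quotient of two lifts acts trivially by the twisted adjoint action, so it is twisted
    central, hence a scalar. *)
Lemma clifford_lift_unique (g : 'M[F]_m) (u u0 : Cl) : twisted_centrally_scalar Cl ->
  clifford_lift g u -> clifford_lift g u0 -> exists2 l : F, l != 0 & u = l *: u0.
Proof.
move=> H [d [u' [[hu uu' u'u _] ug]]] [d0 [u0' [[hu0 u0u0' u0'u0 _] u0g]]].
(* The definition does not require the inverse to be homogeneous; its degree is read off by applying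
   [grade_inv] to [u0 * u0' = 1]. *)
have gu0' : grade_inv Cl u0' = (-1) ^+ d0 *: u0'.
  have e : grade_inv Cl u0 * grade_inv Cl u0' = 1.
    by rewrite -rmorphM u0u0' rmorph1.
  have u0E : u0 = (-1) ^+ d0 *: grade_inv Cl u0.
    by rewrite (chomogeneous_grade hu0) scalerA -expr2 sqrr_sign scale1r.
  by rewrite -[LHS]mul1r -u0'u0 [in LHS]u0E -scalerAr -scalerAl -mulrA e mulr1.
have gz : grade_inv Cl (u0' * u) = (-1) ^+ d0 * (-1) ^+ d *: (u0' * u).
  by rewrite rmorphM /= gu0' (chomogeneous_grade hu) -scalerAl -scalerAr scalerA.
have [v|l zl] := H (u0' * u).
  rewrite gz; have := etrans (ug v) (esym (u0g v)).
  move=> /(congr1 (fun x => (-1) ^+ d0 *: (u0' * x * u))).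
  rewrite -!scalerAr -!scalerAl !scalerA -expr2 sqrr_sign scale1r.
  rewrite -!mulrA u'u mulr1 (mulrA u0' u0) u0'u0 mul1r => <-.
  by rewrite !mulrA scalerAl.
have ul : u = l *: u0 by rewrite -[LHS]mul1r -u0u0' -mulrA zl -scalerAr mulr1.
exists l => //; apply/eqP => l0; move: uu'; rewrite ul l0 scale0r mul0r => /eqP.
by rewrite eq_sym oner_eq0.
Qed.

End CliffordLifts.

(** * The pin extension inside the Clifford algebra *)

Section Pin.
Variables (R : realType) (N : nat) (B : 'M[R[i]]_N) (Cl : clifford_algebra B).
Variable P : 'M[R[i]]_N.
Hypothesis Pu : P \in unitmx.
Hypothesis PB : P^T *m B *m P = 1%:M.
Local Notation iota := (cvec Cl).
Local Notation V := 'cV[R]_N.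
Local Notation rc := (real_complex R).
Local Notation O := (orthg R N).

Let vec (a : V) : 'cV[R[i]]_N := P *m map_mx rc a.
Let iR (a : V) : Cl := iota (vec a).

Let form_vec (u v : 'cV[R[i]]_N) : ((P *m u)^T *m B *m (P *m v)) 0 0 = (u^T *m v) 0 0.
Proof.
rewrite trmx_mul !mulmxA -(mulmxA _ P^T B) -(mulmxA u^T) (_ : (P^T *m B) *m P = 1%:M) //.
by rewrite mulmx1.
Qed.

Let dot_map (a b : V) : ((map_mx rc a)^T *m map_mx rc b) 0 0 = rc (dot a b).
Proof. by rewrite /dot map_trmx -map_mxM mxE. Qed.

Let iRZ l a : iR (l *: a) = rc l *: iR a.
Proof. by rewrite /iR /vec map_mxZ -scalemxAr linearZ. Qed.

Let iRD a b : iR (a + b) = iR a + iR b.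
Proof. by rewrite /iR /vec map_mxD mulmxDr linearD. Qed.

Let iRN a : iR (- a) = - iR a.
Proof. by rewrite -scaleN1r iRZ rmorphN1 scaleN1r. Qed.

Let iR_sq a : iR a * iR a = (rc (dot a a))%:A.
Proof. by rewrite /iR cvec_sq /quad form_vec dot_map. Qed.

Let iR_anti a b : iR a * iR b = (rc (2 * dot a b))%:A - iR b * iR a.
Proof.
apply/eqP; rewrite eq_sym subr_eq eq_sym; apply/eqP.
rewrite cvec_polar !form_vec !dot_map (dotC b) -rmorphD.
by rewrite mulr_natl mulr2n.
Qed.

Let rho (a : V) : Cl := if a == 0 then 1 else iR (normalize a).

Let rhoE a : a != 0 -> rho a = iR (normalize a).
Proof. by rewrite /rho => /negPf ->. Qed.

Let rho_sq a : rho a * rho a = 1.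
Proof.
have [->|na] := eqVneq a 0; first by rewrite /rho eqxx mulr1.
by rewrite rhoE // iR_sq dot_normalize // rmorph1 scale1r.
Qed.

Definition sgneq (u v : Cl) : Prop := exists e : 'Z_2, u = (-1) ^+ e *: v.

Let sgneq_refl u : sgneq u u.
Proof. by exists 0; rewrite expr0 scale1r. Qed.

Let sgneq_sym u v : sgneq u v -> sgneq v u.
Proof. by move=> [e ->]; exists e; rewrite scalerA -expr2 sqrr_sign scale1r. Qed.

Let sgneq_trans u v x : sgneq u v -> sgneq v x -> sgneq u x.
Proof. by move=> [e ->] [f ->]; exists (e + f); rewrite signD scalerA. Qed.

Let sgneq_mul u v x y : sgneq u v -> sgneq x y -> sgneq (u * x) (v * y).
Proof.
move=> [e ->] [f ->]; exists (e + f).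
by rewrite signD -scalerAl -scalerAr scalerA.
Qed.

Let sgneqN u : sgneq (- u) u.
Proof. by exists 1; rewrite expr1 scaleN1r. Qed.

(** The vector [w0] of [refl_planar] is exactly the Clifford product of the three vectors, and its
    norm is the product of theirs. After normalization only the sign relating [w] to [w0] is
    left. *)
Let rho_planar p q b c w : b != 0 -> c != 0 -> p *: b + q *: c != 0 -> w != 0 ->
  (refl (p *: b + q *: c) * refl b * refl c)%g = refl w ->
  sgneq (rho (p *: b + q *: c) * rho b * rho c) (rho w).
Proof.
move=> nb nc na nw ew; have [ww0 ew0] := refl_planar nb nc na.
set a := p *: b + q *: c in na ew ww0 ew0 *.
set w0 := (_ *: b + _ *: c) in ww0 ew0 *.
have nw0 : w0 != 0 by rewrite -dot_eq0 ww0 !mulf_neq0 // dot_eq0.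
have abc : iR a * iR b * iR c = iR w0.
  have cbc : iR c * iR b * iR c = rc (2 * dot b c) *: iR c - rc (dot c c) *: iR b.
    by rewrite iR_anti mulrBl -scalerAl mul1r -mulrA iR_sq -scalerAr mulr1 dotC.
  rewrite /a /w0 !iRD !iRZ !mulrDl -!scalerAl cbc iR_sq -scalerAl mul1r.
  rewrite scalerBr !scalerA -!rmorphM /= addrA mul1r -scalerDl -rmorphD addrC.
  rewrite -scaleNr -rmorphN; congr (_ + rc _ *: _); ring.
have [l nl wl] : exists2 l, l != 0 & w = l *: w0 by apply: refl_inj; rewrite -?ew0.
rewrite !rhoE // /normalize !iRZ -!scalerAl -!scalerAr -scalerAl !scalerA -!rmorphM.
rewrite abc -!iRZ.
have -> : (Num.sqrt (dot a a))^-1 * (Num.sqrt (dot c c))^-1 * (Num.sqrt (dot b b))^-1 =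
          (Num.sqrt (dot w0 w0))^-1.
  by rewrite ww0 !sqrtrM ?mulr_ge0 ?dot_ge0 // !invfM mulrAC.
rewrite -/(normalize w0) -/(normalize w) wl.
case: (normalizeZ w0 nl) => ->; first exact: sgneq_refl.
by rewrite iRN; apply/sgneq_sym/sgneqN.
Qed.

Definition pin_eval (s : seq V) : Cl := \prod_(a <- s) rho a.

Let weq_pin_eval s t : weq s t -> sgneq (pin_eval s) (pin_eval t).
Proof.
rewrite /pin_eval.
elim=> {s t} [//|s t _ /sgneq_sym //|t s u _ h1 _ h2|s1 s2 t1 t2 _ h1 _ h2||a _|p q b c w nb nc na nw ew].
- exact: sgneq_trans h1 h2.
- by rewrite !big_cat; apply: sgneq_mul.
- by rewrite big_seq1 big_nil /rho eqxx.
- by rewrite !big_cons !big_nil mulr1 rho_sq.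
- by rewrite !big_cons !big_nil !mulr1 mulrA; apply: rho_planar.
Qed.

Definition cmx (g : O) : 'M[R[i]]_N := P *m map_mx rc (omat g) *m invmx P.

Let cmxM g h : cmx (g * h)%g = cmx g *m cmx h.
Proof. by rewrite /cmx !mulmxA mulmxKV // omatM map_mxM !mulmxA. Qed.

Let cmx1 : cmx 1%g = 1%:M.
Proof. by rewrite /cmx omat1 map_mx1 mulmx1 mulmxV. Qed.

(** A unit vector is odd and its own inverse; polarization of the Clifford relation then yields the
    reflection formula, sign included. *)
Let rho_adj a v : a != 0 ->
  - (rho a * iota v * rho a) = iota (cmx (refl a) *m v).
Proof.
move=> na; rewrite rhoE //; set b := normalize a.
have b1 : dot b b = 1 by rewrite dot_normalize.
have -> : refl a = refl b by rewrite reflZ // invr_eq0 sqrt_dot_neq0.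
clearbody b; set v' := invmx P *m v; have vE : v = P *m v' by rewrite mulKVmx.
set k := ((map_mx rc b)^T *m v') 0 0.
have e : iR b * iota v = (2 * k)%:A - iota v * iR b.
  apply/eqP; rewrite eq_sym subr_eq eq_sym; apply/eqP.
  rewrite cvec_polar vE !form_vec -/k.
  have -> : (v'^T *m map_mx rc b) 0 0 = k by rewrite /k -[v' in RHS]trmxK -trmx_mul [RHS]mxE.
  by rewrite mulr_natl mulr2n.
rewrite e mulrBl -scalerAl mul1r -mulrA iR_sq b1 rmorph1 scale1r mulr1 opprB.
rewrite /iR -linearZ -linearB; congr (iota _).
rewrite /cmx -!mulmxA -/v' {1}vE /vec scalemxAr -mulmxBr; congr (_ *m _).
rewrite -[omat _]/(refl_mx b) /refl_mx b1 divr1 map_mxB map_mx1 map_mxZ map_mxM -map_trmx.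
rewrite mulmxBl mul1mx -scalemxAl -mulmxA [_^T *m v']mx11_scalar -/k mul_mx_scalar.
by rewrite scalerA rmorph_nat.
Qed.

Let pin_eval_lift_aux s : exists d u',
  [/\ chomogeneous d (pin_eval s), pin_eval s * u' = 1, u' * pin_eval s = 1
    & forall v, (-1) ^+ d *: (pin_eval s * iota v * u') = iota (cmx (wprod s) *m v)].
Proof.
rewrite /pin_eval; elim: s => [|a s [d [u' [h1 h2 h3 h4]]]].
  exists false, 1; rewrite big_nil; split; rewrite ?mulr1 //; first exact: chomogeneous1.
  by move=> v; rewrite cmx1 mul1mx mulr1 mul1r scale1r.
rewrite big_cons; have [a0|na] := eqVneq a 0.
  rewrite a0 /rho eqxx mul1r; exists d, u'; split=> // v.
  by rewrite /= refl0 mul1g.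
exists (~~ d), (u' * rho a); split.
- by rewrite rhoE //; apply: chomogeneous_mulvec.
- by rewrite -mulrA (mulrA _ u') h2 mul1r rho_sq.
- by rewrite -mulrA (mulrA (rho a)) rho_sq mul1r.
- move=> v; rewrite [wprod _]/= cmxM -mulmxA -rho_adj // -h4 -scalerAr -scalerAl !mulrA.
  by rewrite signrN scaleNr.
Qed.

Let pin_eval_lift s : clifford_lift (cmx (wprod s)) (pin_eval s).
Proof.
have [d [u' [h1 h2 h3 h4]]] := pin_eval_lift_aux s.
exists d, u'; split=> //; split=> //; apply/seteqP; split=> _ [v _ <-].
  exists ((-1) ^+ d *: (cmx (wprod s) *m v)) => //.
  by rewrite linearZ /= -h4 scalerA -expr2 sqrr_sign scale1r.
exists ((-1) ^+ d *: (cmx (wprod s)^-1%g *m v)) => //.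
rewrite linearZ /= -scalerAr -scalerAl h4 mulmxA -cmxM mulgV cmx1 mul1mx.
by [].
Qed.

Let pin_eval_neq0 s : pin_eval s != 0.
Proof.
have [d [u' [_ h _ _]]] := pin_eval_lift_aux s.
by apply/eqP => z; move/eqP: h; rewrite z mul0r eq_sym oner_eq0.
Qed.

Let sign_scale_inj (u : Cl) (e f : 'Z_2) : u != 0 ->
  (-1) ^+ e *: u = (-1) ^+ f *: u -> e = f.
Proof.
move=> nu /eqP; rewrite -subr_eq0 -scalerBl scaler_eq0 (negPf nu) orbF subr_eq0 => /eqP h.
by apply: (@sgn_inj R[i]); apply: val_inj.
Qed.

(** Words of reflections evaluate to products of unit vectors, well defined up to sign because the
    defining relations hold up to sign. The signs form the cocycle. Unit vectors have square 1 and
    orthogonal ones anticommute, which is the criterion of [w2_tautE]. *)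
Theorem pin_cocycle (w : stiefel_whitney R) : exists (s : O -> Cl) (p : Z2 O 'Z_2),
  [/\ forall g, clifford_lift (cmx g) (s g),
      forall g h, s g * s h = (-1) ^+ p g h *: s (g * h)%g
    & cls p = w2 w (taut R N)].
Proof.
pose word (g : O) := sval (cid (cartan_dieudonne g)).
have wordP g : wprod (word g) = g by rewrite /word; case: cid.
pose s g := pin_eval (word g).
have s_neq0 g : s g != 0 by apply: pin_eval_neq0.
have s_eval g t : wprod t = g -> sgneq (s g) (pin_eval t).
  by move=> tg; apply/weq_pin_eval/wprod_weq; rewrite wordP.
have sM g h : sgneq (s g * s h) (s (g * h)%g).
  rewrite {1 2}/s /pin_eval -big_cat; apply/sgneq_sym/s_eval.
  by rewrite wprod_cat !wordP.
pose p g h := sval (cid (sM g h)).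
have pP g h : s g * s h = (-1) ^+ p g h *: s (g * h)%g by rewrite /p; case: cid.
have pc : is_cocycle p.
  move=> x y z.
  have e : p x y + p (x * y)%g z = p y z + p x (y * z)%g.
    apply: (sign_scale_inj (s_neq0 (x * y * z)%g)).
    rewrite !signD -!scalerA -pP -[in RHS]mulgA -pP scalerAl scalerAr -!pP.
    by rewrite mulrA.
  by rewrite [_ - _ + _]addrAC -e addrK subrr.
have s_refl a : a != 0 -> sgneq (s (refl a)) (rho a).
  move=> _; have := @s_eval (refl a) [:: a]; rewrite /pin_eval big_seq1; apply.
  by rewrite /= mulg1.
have s1 : sgneq (s 1%g) 1.
  by have := @s_eval 1%g [::]; rewrite /pin_eval big_nil; apply.
exists s, (mkZ2 pc); split=> // [g|]; first by rewrite -{1}(wordP g); apply: pin_eval_lift.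
apply: w2_tautE => /= [a a1|a b a1 b1 ab].
  have na : a != 0 by rewrite -dot_eq0 a1 oner_eq0.
  apply: (sign_scale_inj (s_neq0 1%g)).
  (* The section is not normalized: [s 1] may be -1, but its square is 1, as is that of
     [s (refl a)]. *)
  have [e se] := s1; have [f sf] := s_refl a na.
  have := pP (refl a) (refl a); rewrite reflK => <-.
  have := pP 1%g 1%g; rewrite mulg1 => <-.
  have sq (u v : Cl) (k : 'Z_2) : u = (-1) ^+ k *: v -> v * v = 1 -> u * u = 1.
    by move=> -> vv; rewrite -scalerAl -scalerAr scalerA -expr2 sqrr_sign vv scale1r.
  by rewrite (sq _ _ _ se (mulr1 1)) (sq _ _ _ sf (rho_sq a)).
have na : a != 0 by rewrite -dot_eq0 a1 oner_eq0.
have nb : b != 0 by rewrite -dot_eq0 b1 oner_eq0.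
have [e se] := s_refl a na; have [f sf] := s_refl b nb.
apply/eqP; rewrite subr_eq; apply/eqP.
apply: (sign_scale_inj (s_neq0 (refl a * refl b)%g)).
rewrite -pP signD expr1 -scalerA (refl_commute ab) -pP se sf.
rewrite -!scalerAl -!scalerAr !scalerA mulN1r mulNr scaleNr -scalerN [_ ^+ e * _]mulrC; congr (_ *: _).
by rewrite !rhoE // iR_anti dotZl dotZr ab !mulr0 rmorph0 scale0r sub0r.
Qed.

End Pin.

(** * Clifford classes of representations with a real form *)

Section CliffordClass.
Variables (R : realType) (w : stiefel_whitney R) (Gam : groupType) (N : nat).
Local Notation C := R[i].

Fact rep_orthg_subproof (Y : real_rep R Gam N) x : (Y x)^T *m Y x == 1%:M.
Proof. exact/eqP/rmx_orth. Qed.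
Definition rep_orthg (Y : real_rep R Gam N) x : orthg R N :=
  Orthg (rep_orthg_subproof Y x).
Fact rep_orthgM Y : {morph rep_orthg Y : x y / (x * y)%g}.
Proof. by move=> x y; apply: val_inj; rewrite /= rmxM. Qed.
HB.instance Definition _ Y :=
  isMultiplicative.Build Gam (orthg R N) (rep_orthg Y) (rep_orthgM Y).

Lemma w2_rep_orthg (Y : real_rep R Gam N) (p : Z2 (orthg R N) 'Z_2) :
  cls p = w2 w (taut R N) -> cls (Z2_pull (rep_orthg Y) p) = w2 w Y.
Proof.
move=> ep; rewrite -H2_pull_cls ep -w2_pull; apply: w2_iso.
exact: real_rep_iso_eq.
Qed.

(** Any section in any model differs from the pin section by scalars [l x], whose coboundary is the
    difference of the two cocycles. The converse takes the pin section itself. *)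
Theorem clifford_class_w2E (X : orth_rep C Gam N) (Y : real_rep R Gam N) :
  is_real_form X Y ->
  forall a, clifford_class X a <-> a = H2_map (sgn C) (w2 w Y).
Proof.
move=> [P [Pu PB XP]] a.
have two : 2 != 0 :> C by rewrite pnatr_eq0.
have XE x : cmx P (rep_orthg Y x) = X x by rewrite /cmx -XP mulmxK.
have [Cl0 tc0] : exists Cl : clifford_algebra (oform X), twisted_centrally_scalar Cl.
  have := clifford_algebra_exists two (Q := invmx P); rewrite unitmx_inv => /(_ Pu).
  have -> // : (invmx P)^T *m invmx P = oform X.
  have e : P^T *m oform X = invmx P by rewrite -[LHS]mulmx1 -(mulmxV Pu) mulmxA PB mul1mx.
  by rewrite -{2}e mulmxA -trmx_mul mulmxV // trmx1 mul1mx.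
split=> [[Cl [s [c [sl sM ->]]]]|->].
  have [s0 [p [s0l s0M ep]]] := pin_cocycle Cl Pu PB w.
  have tc := twisted_centrally_scalar_any (Cl' := Cl) tc0.
  have h x : exists l : funit C, s x = fval l *: s0 (rep_orthg Y x).
    have := sl x; rewrite -XE => slx.
    have [l nl e] := clifford_lift_unique tc slx (s0l _).
    by exists (Funit nl).
  pose l x := sval (cid (h x)).
  have lE x : s x = fval (l x) *: s0 (rep_orthg Y x) by rewrite /l; case: cid.
  rewrite -(w2_rep_orthg Y ep) H2_map_cls; apply: clsP; exists l => x y.
  set q := p (rep_orthg Y x) (rep_orthg Y y).
  rewrite -[LHS]/(c x y - sgn C q); apply: val_inj => /=.
  have nz : s0 (rep_orthg Y (x * y)%g) != 0.
    have [d [u' [[_ uu' _ _] _]]] := s0l (rep_orthg Y (x * y)%g).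
    by apply/eqP => z; move/eqP: uu'; rewrite z mul0r eq_sym oner_eq0.
  have e : fval (c x y) * fval (l (x * y)%g) = fval (l x) * fval (l y) * (-1) ^+ q.
    apply/eqP; rewrite -subr_eq0; apply: contraTT nz => ne; apply/negPn.
    have := sM x y; rewrite !lE -scalerAl -scalerAr !scalerA s0M scalerA -/q => /esym/eqP.
    rewrite -subr_eq0 -gmulfM -scalerBl scaler_eq0 (negPf ne).
    by [].
  have lxy := fvalP (l (x * y)%g).
  apply: (mulIf lxy).
  rewrite -[LHS]/(fval (c x y) / (-1) ^+ q * fval (l (x * y)%g)).
  rewrite -[RHS]/(fval (l y) / fval (l (x * y)%g) * fval (l x) * fval (l (x * y)%g)).
  rewrite mulrAC e mulrK ?unitfE ?signr_eq0 //.
  by rewrite [RHS]mulrAC divfK // mulrC.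
have [s0 [p [s0l s0M ep]]] := pin_cocycle Cl0 Pu PB w.
exists Cl0, (fun x => s0 (rep_orthg Y x)), (Z2_map (sgn C) (Z2_pull (rep_orthg Y) p)).
split=> [x|x y|]; first by rewrite -XE.
  by rewrite s0M -gmulfM.
by rewrite -(w2_rep_orthg Y ep) H2_map_cls.
Qed.

End CliffordClass.

(** * Real forms of complex orthogonal representations *)

Section Spectral.
Variables (C : numClosedFieldType) (n : nat).
Local Notation bar := (map_mx (@Num.conj C)).
Implicit Types A U : 'M[C]_n.

Lemma barK m1 m2 (A : 'M[C]_(m1, m2)) : bar (bar A) = A.
Proof. by apply/matrixP => i j; rewrite !mxE conjCK. Qed.

Definition posdef A : Prop :=
  forall v : 'cV[C]_n, v != 0 -> 0 < ((bar v)^T *m A *m v) 0 0.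

Lemma dot_bar_ge0 (v : 'cV[C]_n) : 0 <= ((bar v)^T *m v) 0 0.
Proof.
rewrite mxE sumr_ge0 // => i _; rewrite !mxE mulrC; exact: mul_conjC_ge0.
Qed.

Lemma dot_bar_gt0 (v : 'cV[C]_n) : v != 0 -> 0 < ((bar v)^T *m v) 0 0.
Proof.
move=> nv; rewrite lt_def dot_bar_ge0 andbT; apply: contra nv.
rewrite mxE psumr_eq0; last by move=> i _; rewrite !mxE mulrC; exact: mul_conjC_ge0.
move=> /allP h; apply/eqP/colP => i; rewrite mxE.
have := h i (mem_index_enum i); rewrite /= !mxE mulf_eq0 conjC_eq0 orbb.
by move=> /eqP.
Qed.

Lemma posdef_gram A : A \in unitmx -> posdef ((bar A)^T *m A).
Proof.
move=> Au v nv; rewrite !mulmxA -mulmxA -trmx_mul -map_mxM; apply: dot_bar_gt0.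
by apply: contra nv => /eqP e; rewrite -(mulKmx Au v) e mulmx0.
Qed.

Lemma posdef_spectral A : (bar A)^T = A -> posdef A ->
  exists U (d : 'rV[C]_n), [/\ U *m (bar U)^T = 1%:M, (bar U)^T *m U = 1%:M,
    A = (bar U)^T *m diag_mx d *m U & forall i, 0 < d 0 i].
Proof.
move=> Ah Ap.
have An : A \is normalmx by apply/normalmxP; rewrite -map_trmx Ah.
have Uu := spectral_unitarymx A; have AE := orthomx_spectralP An.
set U := spectralmx A in Uu AE; set d := spectral_diag A in AE.
have UU : U *m (bar U)^T = 1%:M by have := unitarymxP Uu; rewrite -map_trmx.
have UU' := mulmx1C UU.
rewrite invmx_unitary // -map_trmx in AE.
exists U, d; split=> // i.
pose e : 'cV[C]_n := delta_mx i 0; pose v := (bar U)^T *m e.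
have Uv : U *m v = e by rewrite mulmxA UU mul1mx.
have bv : (bar v)^T = e^T *m U by rewrite map_mxM trmx_mul map_trmx barK trmxK map_delta_mx.
have := Ap v; rewrite AE bv -!mulmxA Uv (mulmxA U) UU mul1mx trmx_delta -colE -rowE !mxE eqxx.
apply; apply: contraTneq (oner_neq0 C) => v0.
have /colP/(_ i) := Uv; rewrite v0 mulmx0 !mxE !eqxx /= => h.
by rewrite negbK; apply/eqP/esym.
Qed.

Definition specfun U (d : 'rV[C]_n) (f : C -> C) : 'M[C]_n :=
  (bar U)^T *m diag_mx (map_mx f d) *m U.

(** In eigenbases an intertwiner has a nonzero entry only between equal eigenvalues, hence it also
    intertwines any function of the two matrices. *)
Lemma specfun_intertwine U1 U2 (d1 d2 : 'rV[C]_n) (f : C -> C) (T : 'M[C]_n) :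
    U1 *m (bar U1)^T = 1%:M -> U2 *m (bar U2)^T = 1%:M ->
  T *m specfun U1 d1 id = specfun U2 d2 id *m T ->
  T *m specfun U1 d1 f = specfun U2 d2 f *m T.
Proof.
rewrite /specfun !(map_mx_id (fun=> erefl)) => u1 u2 e.
have u1' := mulmx1C u1; have u2' := mulmx1C u2.
set E := U2 *m T *m (bar U1)^T.
have TE : T = (bar U2)^T *m E *m U1.
  by rewrite /E !mulmxA u2' mul1mx -mulmxA u1' mulmx1.
have eE : E *m diag_mx d1 = diag_mx d2 *m E.
  have : U2 *m (T *m ((bar U1)^T *m diag_mx d1 *m U1)) *m (bar U1)^T =
         U2 *m ((bar U2)^T *m diag_mx d2 *m U2 *m T) *m (bar U1)^T by rewrite e.
  by rewrite !mulmxA u2 mul1mx -(mulmxA _ U1) u1 mulmx1 -/E -!mulmxA.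
have {eE}fE : E *m diag_mx (map_mx f d1) = diag_mx (map_mx f d2) *m E.
  apply/matrixP => i j; rewrite mul_mx_diag mul_diag_mx !mxE.
  have /matrixP/(_ i j) := eE; rewrite mul_mx_diag mul_diag_mx !mxE.
  have [->|ne] := eqVneq (d1 0 j) (d2 0 i); first by move=> _; rewrite mulrC.
  rewrite mulrC => /eqP; rewrite -subr_eq0 -mulrBl mulf_eq0 subr_eq0 (negPf ne) /=.
  by move=> /eqP ->; rewrite mulr0 mul0r.
clearbody E; rewrite TE !mulmxA -(mulmxA _ U1) u1 mulmx1 -(mulmxA _ U2) u2 mulmx1.
by rewrite -(mulmxA _ E) fE mulmxA.
Qed.

Lemma specfun_mul U d f g : U *m (bar U)^T = 1%:M ->
  specfun U d f *m specfun U d g = specfun U d (fun x => f x * g x).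
Proof.
move=> u; rewrite /specfun !mulmxA -(mulmxA _ U) u mulmx1 -[_ *m diag_mx _ *m diag_mx _]mulmxA mulmx_diag.
by congr (_ *m diag_mx _ *m _); apply/rowP => i; rewrite !mxE.
Qed.

Lemma specfun1 U (d : 'rV[C]_n) (f : C -> C) : (bar U)^T *m U = 1%:M -> (forall i, f (d 0 i) = 1) ->
  specfun U d f = 1%:M.
Proof.
move=> u h; rewrite /specfun (_ : map_mx f d = const_mx 1); last first.
  by apply/rowP => i; rewrite !mxE h.
by rewrite diag_const_mx mulmx1.
Qed.

Lemma specfun_adj U (d : 'rV[C]_n) (f : C -> C) : (forall i, Num.conj (f (d 0 i)) = f (d 0 i)) ->
  (bar (specfun U d f))^T = specfun U d f.
Proof.
move=> h; rewrite /specfun !map_mxM !trmx_mul map_trmx barK trmxK !mulmxA.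
congr (_ *m _ *m _); rewrite map_diag_mx tr_diag_mx; congr diag_mx.
by apply/rowP => i; rewrite !mxE /= h.
Qed.

Lemma specfun_bar U (d : 'rV[C]_n) (f : C -> C) : (forall i, Num.conj (f (d 0 i)) = f (d 0 i)) ->
  bar (specfun U d f) = specfun (bar U) d f.
Proof.
move=> h; rewrite /specfun !map_mxM -map_trmx; congr (_ *m _ *m _).
rewrite map_diag_mx; congr diag_mx.
by apply/rowP => i; rewrite !mxE /= h.
Qed.

(* Hilbert 90, for the twisted involution [v |-> N *m bar v]. *)
Lemma hilbert90 (N : 'M[C]_n) : N *m bar N = 1%:M ->
  exists2 P, P \in unitmx & N *m bar P = P.
Proof.
(* For any [z], the matrix [z + conj z N] is fixed by the involution, and it is singular only if
   [- z / conj z] is an eigenvalue of [N]. The numbers [k + i] make these quotients pairwise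
   distinct, so some [k] avoids all the eigenvalues. *)
move=> NN; pose z (k : nat) : C := k%:R + 'i.
have zn k : z k != 0.
  apply/eqP => /(congr1 (fun x => 'Im x)); rewrite /z raddfD /= Im_i.
  by rewrite (Creal_ImP _ _) ?realn // add0r raddf0 => /eqP; rewrite oner_eq0.
have bz k : Num.conj (z k) = k%:R - 'i by rewrite /z rmorphD /= conjCi conjC_nat.
have bzn k : Num.conj (z k) != 0 by rewrite conjC_eq0.
pose x k := - (z k / Num.conj (z k)).
have xinj : injective x.
  move=> k l /oppr_inj /eqP; rewrite eqr_div // !bz /z => /eqP e.
  have : ('i : C) * (2 * (k%:R - l%:R)) = 0.
    have -> : 'i * (2 * (k%:R - l%:R)) = (l%:R + 'i) * (k%:R - 'i) - (k%:R + 'i) * (l%:R - 'i) :> C by ring.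
    by rewrite e subrr.
  move=> /eqP; rewrite !mulf_eq0 pnatr_eq0 (negPf (neq0Ci _)) /= subr_eq0 eqr_nat.
  by move=> /eqP.
have [k nk] : exists k, ~~ root (char_poly N) (x k).
  apply: contrapT => h.
  have np : char_poly N != 0 by apply: monic_neq0; apply: char_poly_monic.
  have := @max_poly_roots _ (char_poly N) (map x (iota 0 (size (char_poly N)))) np.
  rewrite map_inj_uniq // iota_uniq size_map size_iota ltnn => h'.
  suff : false by []; apply: h' => //.
  apply/allP => _ /mapP[k _ ->]; apply: contrapT => hk; apply: h; exists k; exact/negP.
pose P := z k *: 1%:M + Num.conj (z k) *: N.
exists P.
  have -> : P = Num.conj (z k) *: (N - (x k)%:M).
    rewrite /P scalerBr addrC; congr (_ + _).
    by rewrite -[(x k)%:M]scalemx1 scalerA -scaleNr /x mulrN opprK mulrC divfK.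
  rewrite unitmxZ ?unitfE // -row_free_unit -kermx_eq0.
  by move: nk; rewrite -eigenvalue_root_char negbK.
rewrite /P map_mxD !map_mxZ map_mx1 mulmxDr -!scalemxAr NN mulmx1 /= conjCK addrC.
by [].
Qed.

Lemma posdef_sqrt A : (bar A)^T = A -> posdef A ->
  exists2 Q, Q \in unitmx & (bar Q)^T *m Q = A.
Proof.
move=> Ah Ap; have [U [d [U1 U2 HE dp]]] := posdef_spectral Ah Ap.
have dr i : 0 <= d 0 i by rewrite ltW.
exists (specfun U d sqrtC).
  have : specfun U d sqrtC *m specfun U d (fun x : C => (sqrtC x)^-1) = 1%:M.
    by rewrite specfun_mul // specfun1 // => i; rewrite mulfV // sqrtC_eq0 gt_eqF.
  by case/mulmx1_unit.
rewrite specfun_adj => [|i]; last by rewrite geC0_conj ?sqrtC_ge0.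
rewrite specfun_mul // HE /specfun; congr (_ *m diag_mx _ *m _).
by apply/rowP => i; rewrite !mxE -expr2 sqrtCK.
Qed.

(** The Frobenius-Schur argument. The form gives the antilinear map [v |-> bar (B *m v)], which
    commutes with the unitary matrices [X g] and has the positive matrix [M] as its square. Dividing
    it by the square root of [M] makes it an involution; its fixed vectors form a real structure
    preserved by [X], on which [B] is real and positive. *)
Lemma unitary_posdef_form (T : Type) (X : T -> 'M[C]_n) (B : 'M[C]_n) :
    (forall g, X g *m (bar (X g))^T = 1%:M) -> B^T = B -> B \in unitmx ->
    (forall g, (X g)^T *m B *m X g = B) ->
  exists P (B0 := P^T *m B *m P), [/\ P \in unitmx, bar B0 = B0, B0^T = B0, posdef B0 &
    forall g, bar (invmx P *m X g *m P) = invmx P *m X g *m P].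
Proof.
move=> Xu Bs Bu XB; pose M := bar B *m B.
have Mh : (bar M)^T = M by rewrite /M map_mxM barK trmx_mul Bs map_trmx Bs.
have Mp : posdef M by have := posdef_gram Bu; rewrite map_trmx Bs.
have [U [d [U1 U2 ME dp]]] := posdef_spectral Mh Mp.
have ME0 : M = bar B *m B by [].
have {}ME : M = specfun U d id by rewrite /specfun (map_mx_id (fun=> erefl)).
pose f (x : C) := (sqrtC x)^-1.
have dr i : 0 <= d 0 i by rewrite ltW.
have sd i : sqrtC (d 0 i) != 0 by rewrite sqrtC_eq0 gt_eqF.
have sge i : 0 <= sqrtC (d 0 i) by rewrite sqrtC_ge0.
have fr i : Num.conj (f (d 0 i)) = f (d 0 i) by rewrite geC0_conj // /f invr_ge0.
pose S := specfun U d f; pose S' := specfun U d (fun x : C => sqrtC x).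
have SS' : S *m S' = 1%:M.
  by rewrite specfun_mul // specfun1 // => i; rewrite /f mulVf.
have SMS : S *m M *m S = 1%:M.
  rewrite ME !specfun_mul // specfun1 // => i.
  by rewrite /f -[X in _ * X * _](sqrtCK (d 0 i)) expr2 mulKf // mulfV.
have dconj i : Num.conj (id (d 0 i)) = id (d 0 i) by rewrite geC0_conj.
have bU1 : bar U *m (bar (bar U))^T = 1%:M by rewrite map_trmx -map_mxM U1 map_mx1.
have BS : B *m S = bar S *m B.
  rewrite /S specfun_bar //; apply: specfun_intertwine => //.
  by rewrite -specfun_bar // -ME /M map_mxM barK mulmxA.
have BX g : B *m X g = bar (X g) *m B.
  rewrite -[in RHS](XB g) !mulmxA.
  have -> : bar (X g) *m (X g)^T = 1%:M.
    by rewrite -[1%:M](map_mx1 (@Num.conj C)) -(Xu g) map_mxM -map_trmx barK.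
  by rewrite mul1mx.
have XS g : X g *m S = S *m X g.
  apply: specfun_intertwine => //; rewrite -ME /M -[RHS]mulmxA BX [RHS]mulmxA -map_mxM.
  by rewrite BX map_mxM barK mulmxA.
(* The rescaled antilinear map is [v |-> N *m bar v], where [S] is the inverse square root of
   [M]. *)
pose N := S *m bar B.
have S'h : (bar S')^T = S' by apply: specfun_adj => i; rewrite geC0_conj.
have S'p : posdef S'.
  pose h := fun x : C => sqrtC (sqrtC x); pose H := specfun U d h.
  have hge i : 0 <= h (d 0 i) by rewrite sqrtC_ge0.
  have HH : S' = (bar H)^T *m H.
    rewrite specfun_adj => [|i]; last by rewrite geC0_conj.
    rewrite specfun_mul // /S' /specfun; congr (_ *m diag_mx _ *m _).
    by apply/rowP => i; rewrite !mxE /h -expr2 sqrtCK.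
  rewrite HH; apply: posdef_gram.
  have : H *m specfun U d (fun x => (h x)^-1) = 1%:M.
    by rewrite specfun_mul // specfun1 // => i; rewrite mulfV // /h !sqrtC_eq0 gt_eqF.
  by case/mulmx1_unit.
clearbody S S' M.
have NN : N *m bar N = 1%:M.
  by rewrite /N map_mxM barK -BS -[LHS]mulmxA (mulmxA (bar B)) -ME0 mulmxA SMS.
have S'S := mulmx1C SS'; have N'N := mulmx1C NN.
have NX g : N *m bar (X g) = X g *m N.
  by rewrite /N -mulmxA -map_mxM BX map_mxM barK mulmxA -XS mulmxA.
have [P0 Pu NP] := hilbert90 NN.
have bP : bar P0 = bar N *m P0 by rewrite -[in RHS]NP mulmxA N'N mul1mx.
have BN : bar B *m bar N = S'.
  have -> : bar B = S' *m N by rewrite /N mulmxA S'S mul1mx.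
  by rewrite -mulmxA NN mulmx1.
pose B0 := P0^T *m B *m P0.
have bB0 : bar B0 = (bar P0)^T *m S' *m P0.
  by rewrite /B0 !map_mxM bP -map_trmx bP -BN !mulmxA.
have B0s : B0^T = B0 by rewrite /B0 !trmx_mul trmxK Bs mulmxA.
have B0r : bar B0 = B0.
  by rewrite -[RHS]B0s -[B0 in RHS]barK bB0 !map_mxM !trmx_mul S'h -map_trmx barK trmxK mulmxA.
exists P0; split=> //.
  move=> v nv; rewrite -/B0 -B0r bB0 !mulmxA -trmx_mul -map_mxM -mulmxA; apply: S'p.
  by apply: contra nv => /eqP e; rewrite -(mulKmx Pu v) e mulmx0.
move=> g; set Y0 := invmx P0 *m X g *m P0.
have e : P0 *m Y0 = X g *m P0 by rewrite /Y0 !mulmxA mulmxV // mul1mx.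
rewrite -(mulKmx Pu (bar Y0)) -[in RHS](mulKmx Pu Y0); congr (_ *m _).
by rewrite e -{1}NP -mulmxA -map_mxM e map_mxM mulmxA NX -mulmxA NP.
Qed.

(** Weyl's trick: the hermitian form averaged over the group is [(bar Q)^T *m Q], and conjugation by
    [Q] makes the representation unitary. *)
Theorem group_posdef_form (G : finGroupType) (X : G -> 'M[C]_n) (B : 'M[C]_n) :
    X 1%g = 1%:M -> (forall x y, X (x * y)%g = X x *m X y) -> B^T = B -> B \in unitmx ->
    (forall g, (X g)^T *m B *m X g = B) ->
  exists P (B0 := P^T *m B *m P), [/\ P \in unitmx, bar B0 = B0, B0^T = B0, posdef B0 &
    forall g, bar (invmx P *m X g *m P) = invmx P *m X g *m P].
Proof.
move=> X1 XM Bs Bu XB.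
have Xu g : X g \in unitmx.
  by have /mulmx1_unit[] : X g *m X g^-1%g = 1%:M by rewrite -XM mulgV X1.
pose H : 'M[C]_n := \sum_(g : G) (bar (X g))^T *m X g.
have Hh : (bar H)^T = H.
  rewrite /H raddf_sum [LHS]raddf_sum; apply: eq_bigr => g _ /=.
  by rewrite map_mxM trmx_mul -map_trmx barK trmxK.
have Hp : posdef H.
  move=> v nv; rewrite /H mulmx_sumr mulmx_suml summxE (bigD1 1%g) //=.
  rewrite ltr_wpDr //; last exact: posdef_gram.
  by apply: sumr_ge0 => g _; apply/ltW/posdef_gram.
have HX h : (bar (X h))^T *m H *m X h = H.
  rewrite /H mulmx_sumr mulmx_suml [RHS](reindex_inj (mulIg h)) /=.
  by apply: eq_bigr => g _; rewrite XM map_mxM trmx_mul !mulmxA.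
have [Q Qu QQ] := posdef_sqrt Hh Hp.
clearbody H.
pose X' g := Q *m X g *m invmx Q; pose B' := (invmx Q)^T *m B *m invmx Q.
have QtV : Q^T *m (invmx Q)^T = 1%:M by rewrite -trmx_mul mulVmx // trmx1.
have [|||g|P [Pu]] := @unitary_posdef_form G X' B'.
- move=> g; apply: mulmx1C; rewrite /X' !map_mxM !trmx_mul !mulmxA.
  rewrite -(mulmxA _ (bar Q)^T) QQ -(mulmxA _ (bar (X g))^T) -(mulmxA _ _ (X g)) HX.
  by rewrite -QQ !mulmxA -trmx_mul -map_mxM mulmxV // map_mx1 trmx1 mul1mx mulmxV.
- by rewrite /B' !trmx_mul trmxK Bs mulmxA.
- by rewrite /B' !unitmx_mul unitmx_tr !unitmx_inv Qu Bu.
- rewrite /X' /B' !trmx_mul !mulmxA -(mulmxA _ Q^T) QtV mulmx1.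
  rewrite -(mulmxA _ (invmx Q) Q) mulVmx // mulmx1.
  by rewrite -!(mulmxA (invmx Q)^T) XB.
have -> : P^T *m B' *m P = (invmx Q *m P)^T *m B *m (invmx Q *m P).
  by rewrite /B' trmx_mul !mulmxA.
move=> h1 h2 h3 h4; exists (invmx Q *m P); split=> //.
  by rewrite unitmx_mul unitmx_inv Qu.
move=> g; suff -> : invmx (invmx Q *m P) *m X g *m (invmx Q *m P) = invmx P *m X' g *m P.
  exact: h4.
have Q1u : invmx Q *m P \in unitmx by rewrite unitmx_mul unitmx_inv Qu.
rewrite -[RHS](mulKmx Q1u) -[LHS]mulmxA; congr (_ *m _).
by rewrite /X' !mulmxA mulmxK // mulVmx // mul1mx.
Qed.

End Spectral.

Section ChangeOfBasis.
Variables (F : fieldType) (n : nat).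
Implicit Types P X Y B c : 'M[F]_n.

Lemma congr_orthonormal P B c : P \in unitmx -> c \in unitmx -> c^T *m c = P^T *m B *m P ->
  P *m invmx c \in unitmx /\ (P *m invmx c)^T *m B *m (P *m invmx c) = 1%:M.
Proof.
move=> Pu cu e; split; first by rewrite unitmx_mul Pu unitmx_inv.
rewrite trmx_mul !mulmxA -(mulmxA _ P^T) -(mulmxA _ (P^T *m B)) -e.
by rewrite !mulmxA trmx_inv mulVmx ?unitmx_tr // mul1mx mulmxV.
Qed.

Lemma conj_change_basis P X c : P \in unitmx -> c \in unitmx ->
  (P *m invmx c) *m (c *m (invmx P *m X *m P) *m invmx c) = X *m (P *m invmx c).
Proof. by move=> Pu cu; rewrite !mulmxA mulmxKV // mulmxV // mul1mx. Qed.

Lemma intertwine_mul P X1 X2 Y1 Y2 :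
  P *m Y1 = X1 *m P -> P *m Y2 = X2 *m P -> X1 *m X2 *m P = P *m (Y1 *m Y2).
Proof. by move=> e1 e2; rewrite mulmxA e1 -!mulmxA e2. Qed.

Lemma intertwine_orth P B X Y : P^T *m B *m P = 1%:M -> P *m Y = X *m P ->
  X^T *m B *m X = B -> Y^T *m Y = 1%:M.
Proof.
move=> PB e XB; rewrite -[Y in X in _ *m X]mul1mx -PB -(mulmxA _ P) e !mulmxA -trmx_mul e.
by rewrite trmx_mul -!mulmxA (mulmxA B) (mulmxA X^T) (mulmxA X^T) XB mulmxA.
Qed.

End ChangeOfBasis.

(** * Orthonormal bases for positive definite real forms *)

Section Cholesky.
Variable R : rcfType.

(** Induction through the Schur complement of the first diagonal entry. *)
Lemma cholesky n (b : 'M[R]_n) : b^T = b -> (forall v : 'cV[R]_n, v != 0 -> 0 < (v^T *m b *m v) 0 0) ->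
  exists2 c : 'M[R]_n, c \in unitmx & c^T *m c = b.
Proof.
elim: n b => [|n IH] b bs bp; first by exists 1%:M; rewrite ?unitmx1 //; apply/matrixP => -[].
change 'M[R]_(1 + n) in b.
have {}bp (v : 'cV[R]_(1 + n)) : v != 0 -> 0 < (v^T *m b *m v) 0 0 by apply: bp.
pose a : R := b 0 0; pose u : 'rV_n := ursubmx b; pose d := drsubmx b.
have bE : b = block_mx a%:M u u^T d.
  rewrite -[LHS]submxK /u trmx_ursub bs; congr block_mx.
  rewrite [LHS]mx11_scalar /a !mxE; congr ((b _ _)%:M); exact: val_inj.
have quadE x (y : 'cV[R]_n) : ((col_mx x%:M y)^T *m b *m col_mx x%:M y) 0 0 =
    a * x * x + 2 * x * (u *m y) 0 0 + (y^T *m d *m y) 0 0.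
  have uy : y^T *m u^T = ((u *m y) 0 0)%:M.
    by rewrite -trmx_mul [in LHS](mx11_scalar (u *m y)) tr_scalar_mx.
  rewrite bE tr_col_mx tr_scalar_mx mul_row_block mul_row_col uy !mulmxDl.
  rewrite -(mulmxA _ u y) -!scalar_mxM mul_scalar_mx.
  move: (u *m y) (y^T *m d *m y) => t q; rewrite !mxE eqxx !mulr1n; ring.
have a0 : 0 < a.
  have := bp (col_mx 1%:M 0); rewrite quadE !mulmx0 !mxE !mulr1 mulr0 !addr0; apply.
  apply/eqP => /colP/(_ (lshift n 0)); rewrite col_mxEu !mxE eqxx => /eqP.
  by rewrite oner_eq0.
have sa : Num.sqrt a != 0 by rewrite gt_eqF // sqrtr_gt0.
have sa2 : Num.sqrt a * Num.sqrt a = a by rewrite -expr2 sqr_sqrtr // ltW.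
have [||c cu cE] := IH (d - a^-1 *: (u^T *m u)).
- rewrite linearB /= linearZ /= trmx_mul trmxK; congr (_ - _).
  by rewrite /d trmx_drsub bs.
- move=> v nv; set x := (u *m v) 0 0.
  (* The first coordinate [- (x / a)] completes the square: at this vector [b] takes the value of
     the Schur complement at [v]. *)
  have := bp (col_mx (- (x / a))%:M v); rewrite quadE -/x.
  have -> : (v^T *m (d - a^-1 *: (u^T *m u)) *m v) 0 0 = (v^T *m d *m v) 0 0 - a^-1 * (x * x).
    rewrite mulmxBr mulmxBl mxE [X in _ + X]mxE; congr (_ - _).
    rewrite -scalemxAr -scalemxAl mxE !mulmxA -trmx_mul -mulmxA.
    by rewrite [u *m v]mx11_scalar tr_scalar_mx -scalar_mxM mxE eqxx.
  have na : a != 0 by rewrite gt_eqF.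
  have -> : a * - (x / a) * - (x / a) + 2 * - (x / a) * x + (v^T *m d *m v) 0 0 =
    (v^T *m d *m v) 0 0 - a^-1 * (x * x) by field.
  apply; apply: contra nv => /eqP /(congr1 dsubmx).
  by rewrite col_mxKd linear0 => ->.
suff : exists2 c : 'M[R]_(1 + n), c \in unitmx & c^T *m c = b by [].
exists (block_mx (Num.sqrt a)%:M ((Num.sqrt a)^-1 *: u) 0 c).
  by rewrite unitmxE det_ublock unitrM det_scalar1 unitfE sa -unitmxE.
rewrite tr_block_mx mulmx_block bE !trmx0 !mul0mx !addr0 !mulmx0 ?addr0.
rewrite tr_scalar_mx -scalar_mxM sa2 mul_scalar_mx scalerA mulfV // scale1r.
rewrite linearZ /= -scalemxAl mul_mx_scalar scalerA mulVf // scale1r.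
rewrite -scalemxAl -scalemxAr scalerA cE -invfM sa2 addrC subrK.
by [].
Qed.

End Cholesky.

Section RealForm.
Variable R : realType.
Local Notation C := R[i].
Local Notation rc := (real_complex R).
Local Notation bar := (map_mx (@Num.conj C)).

Lemma bar_real m n (A : 'M[C]_(m, n)) : bar A = A -> exists B : 'M[R]_(m, n), A = map_mx rc B.
Proof.
move=> h; exists (map_mx (@complex.Re R) A); apply/matrixP => i j.
have /matrixP/(_ i j) := h; rewrite !mxE; case: (A i j) => a b /=.
move=> /eqP; rewrite eq_complex /= eqxx /= => /eqP hb.
have -> : b = 0 by apply/eqP; rewrite -eqNr hb.
by [].
Qed.

Lemma bar_map_real m n (B : 'M[R]_(m, n)) : bar (map_mx rc B) = map_mx rc B.
Proof.
apply/matrixP => i j; rewrite !mxE; apply/eqP.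
by rewrite eq_complex /= oppr0 !eqxx.
Qed.

Lemma map_rc_inj m n : injective (map_mx rc : 'M[R]_(m, n) -> 'M[C]_(m, n)).
Proof.
by move=> A B /matrixP h; apply/matrixP => i j; have := h i j; rewrite !mxE => -[].
Qed.

(** In the basis of [group_posdef_form] the matrices are real and the form is real positive
    definite; a real change of basis, from [cholesky], makes the form standard and keeps the
    matrices real. *)
Theorem real_form_exists (G : finGroupType) n (X : orth_rep C G n) :
  exists Y : real_rep R G n, is_real_form X Y.
Proof.
have [P0 [P0u]] := group_posdef_form (omx1 X) (omxM X) (oform_sym X)
  (oform_nondegenerate X) (omx_isom X).
set B0 := P0^T *m oform X *m P0 => B0r B0s B0p PX.
have [b bE] := bar_real B0r.
have bs : b^T = b by apply: map_rc_inj; rewrite -map_trmx -bE.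
have bp (v : 'cV[R]_n) : v != 0 -> 0 < (v^T *m b *m v) 0 0.
  move=> nv; have nz : map_mx rc v != 0.
    by apply: contra nv => /eqP e; apply/eqP/map_rc_inj; rewrite e map_mx0.
  have := B0p _ nz; rewrite bar_map_real bE map_trmx -!map_mxM mxE.
  by rewrite ltcR.
have [c cu cE] := cholesky bs bp.
have mcu : map_mx rc c \in unitmx by rewrite map_unitmx.
have cB : (map_mx rc c)^T *m map_mx rc c = P0^T *m oform X *m P0.
  by rewrite map_trmx -map_mxM cE -bE.
have [Pu PB] := congr_orthonormal P0u mcu cB.
set P := P0 *m invmx (map_mx rc c) in Pu PB.
have h g : exists A : 'M[R]_n, P *m map_mx rc A = X g *m P.
  have [A AE] := bar_real (PX g).
  exists (c *m A *m invmx c); rewrite !map_mxM map_invmx -AE.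
  exact: conj_change_basis.
pose Y g := sval (cid (h g)).
have YE g : P *m map_mx rc (Y g) = X g *m P by rewrite /Y; case: cid.
clearbody P Y.
have Pinj (A B : 'M[R]_n) : P *m map_mx rc A = P *m map_mx rc B -> A = B.
  by move=> e; apply: map_rc_inj; rewrite -(mulKmx Pu (map_mx rc A)) e mulKmx.
have Y1 : Y 1%g = 1%:M by apply: Pinj; rewrite YE omx1 map_mx1 mul1mx mulmx1.
have YM x y : Y (x * y)%g = Y x *m Y y.
  by apply: Pinj; rewrite YE map_mxM omxM; apply: intertwine_mul.
have YO x : (Y x)^T *m Y x = 1%:M.
  apply: map_rc_inj; rewrite map_mx1 map_mxM -map_trmx.
  exact: intertwine_orth PB (YE x) (omx_isom X x).
by exists (RealRep Y1 YM YO), P; split.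
Qed.

End RealForm.

Local Open Scope complex_scope.
Local Open Scope classical_set_scope.

(** * Stiefel-Whitney subgroups *)

Section Generated.
Variables (T : Type) (op : T -> T -> T) (e : T).
Hypotheses (opA : associative op) (opC : commutative op) (op1 : left_id e op).

Lemma sub_subgroup_generated S : S `<=` subgroup_generated op e S.
Proof. by move=> x Sx H [_ SH]; apply: SH. Qed.

Lemma subgroup_generated_min S H :
  is_subgroup op e H -> S `<=` H -> subgroup_generated op e S `<=` H.
Proof. by move=> hH SH x; apply. Qed.

(** Each subgroup containing [S] supplies some inverse of [x]; uniqueness of inverses places one and
    the same element in all of them. *)
Lemma subgroup_generated_group S :
  (forall x, exists y, op x y = e) -> is_subgroup op e (subgroup_generated op e S).
Proof.
move=> inv; split=> [H [[]]//|x y hx hy H hH|x hx].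
  by have [[_ hM _] _] := hH; apply: hM; [apply: hx | apply: hy].
have [y xy] := inv x; exists y => // H hH.
have [[_ _ hV] _] := hH; have [z Hz xz] := hV x (hx H hH).
suff -> : y = z by [].
by rewrite -[y]op1 -xz (opC x) -opA xy opC op1.
Qed.

End Generated.

Lemma zmod_subgroupN (V : zmodType) (H : set V) x : is_subgroup +%R 0 H -> H x -> H (- x).
Proof.
move=> [_ _ hV] /hV [y Hy /eqP]; rewrite addrC addr_eq0 => /eqP <-.
by [].
Qed.

Lemma zmod_generated_group (V : zmodType) (S : set V) :
  is_subgroup +%R 0 (subgroup_generated +%R 0 S).
Proof.
apply: subgroup_generated_group; [exact: addrA|exact: addrC|exact: add0r|].
by move=> x; exists (- x); rewrite subrr.
Qed.

(** * The modified product through [Theta] *)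

Section Main.
Variables (R : realType) (G : finGroupType).
Local Notation C := R[i].
Local Notation rc := (real_complex R).
Local Notation j := (@j R G).
Local Notation Theta := (Theta C G).
Local Notation star := (star C G).
Local Notation Gam := (G * 'Z_2)%type.

Lemma jD a b : j (a + b) = j a + j b.
Proof.
have [c <-] := cls_surj a; have [d <-] := cls_surj b.
rewrite -clsD /j !H2_map_cls -clsD; congr cls; apply: val_inj.
by apply/funext => x; apply/funext => y /=; rewrite -[RHS]raddfD.
Qed.

Lemma j0 : j 0 = 0.
Proof. by apply: (addIr (j 0)); rewrite -jD !add0r. Qed.

(* [(-1) ^ (chi x * chi y)] is the coboundary of [x |-> i ^ (chi x)]. *)
Lemma j_cup_square chi : j (cup chi chi) = 0.
Proof.
rewrite /j H2_map_cls -cls0; apply: clsP.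
pose f (u : 'Z_2) : funit C := if u == 0 then 0 else Funit (neq0Ci C).
have f0 : f 0 = 0 by [].
exists (fun x => f (chi x)) => x y.
rewrite -[LHS]/(sgn C (chi x * chi y) - 0) subr0 H1P.
case: (Z2_case (chi x)) (Z2_case (chi y)) => -> [] ->; rewrite ?addr0 ?add0r ?Z2_add2 ?mulr0 ?f0.
- by rewrite (raddf0 (sgn C)) oppr0.
- by rewrite mul0r (raddf0 (sgn C)) subrr.
- by rewrite (raddf0 (sgn C)) ?sub0r addNr.
- apply: val_inj; rewrite /= invr1 mulr1 -expr2 sqrCi expr1 //.
Qed.

Lemma Theta_star a b : Theta (star a b) =
  ((Theta a).1 + (Theta b).1 + j (cup (Theta a).2 (Theta b).2),
   (Theta a).2 + (Theta b).2).
Proof.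
have [c <-] := cls_surj a; have [d <-] := cls_surj b.
rewrite star_cls !Theta_cls eps_star /j H2_map_cls -!clsD /=; congr pair.
  by congr cls; apply: val_inj.
by apply: val_inj.
Qed.

(** Leaving the second component free encodes the product with K, transported to classes on
    [Gam]. *)
Definition additive_product (A : set (H2 G (funit C))) : set (H2 Gam (funit C)) :=
  [set b | A (Theta b).1].

(** The correction term of the modified product lies in [A], so it does not affect membership. *)
Lemma product_star_subgroup A : is_subgroup +%R 0 A -> (forall chi eta, A (j (cup chi eta))) ->
  is_subgroup star 0 (additive_product A).
Proof.
move=> hA hj; have [A0 AD _] := hA.
have T0 : Theta 0 = 0 by rewrite raddf0.
split=> [|x y hx hy|x hx]; rewrite /additive_product /mkset.
- by rewrite T0.
- by rewrite Theta_star; apply: (AD _ _ (AD _ _ hx hy)).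
have [y xy] := starV x; exists y => //.
have := congr1 (fun p => p.1) (Theta_star x y); rewrite xy T0 /=.
rewrite addrAC addrC => /esym/eqP; rewrite addr_eq0 => /eqP ->.
by apply: zmod_subgroupN => //; apply: AD.
Qed.

(** Multiplication by elements (0, chi) moves the second component freely, so membership in [H]
    depends only on the first. The product of (0, chi) and (0, eta) has first component
    [j (cup chi eta)], which thus belongs to [A]. *)
Lemma star_subgroup_product (H : set (H2 Gam (funit C))) : is_subgroup star 0 H ->
    (forall b, (Theta b).1 = 0 -> H b) ->
  exists A, [/\ is_subgroup +%R 0 A, forall chi eta, A (j (cup chi eta)) & H = additive_product A].
Proof.
move=> [H0 HM HV] hK.
have surj p : exists b, Theta b = p.
  by have [g gK kG] := Theta_bij C G; exists (g p).
have mv b b' : H b -> (Theta b').1 = (Theta b).1 -> H b'.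
  move=> hb e.
  have [c cE] := surj (0, (Theta b).2); have [d dE] := surj (0, (Theta b').2).
  (* The factor [c] brings the second component to 0 without changing the first, since
     [j (cup chi chi) = 0]; then [d] installs the new second component. *)
  have -> : b' = star (star b c) d.
    apply: Theta_inj; rewrite !Theta_star cE dE.
    move: (Theta b) (Theta b') e => [p chi] [p' chi'] /= ->.
    have -> : chi + chi = 0 by apply: val_inj; apply/funext => x /=; exact: Z2_add2.
    by rewrite j_cup_square cup0l j0 !addr0 add0r.
  by apply: (HM); [apply: (HM) => //|]; apply: hK; rewrite ?cE ?dE.
exists [set a | exists2 b, H b & (Theta b).1 = a]; split.
- split; first by exists 0 => //; rewrite raddf0.
    move=> _ _ [b hb <-] [c hc <-].
    have [b' bE] := surj ((Theta b).1, 0); have [c' cE] := surj ((Theta c).1, 0).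
    exists (star b' c'); last by rewrite Theta_star bE cE /= cup0l j0 addr0.
    by apply: HM; [apply: mv hb _ | apply: mv hc _]; rewrite ?bE ?cE.
  move=> _ [b hb <-]; have [b' bE] := surj ((Theta b).1, 0).
  have [y hy xy] := HV b' (mv _ _ hb (congr1 fst bE)).
  exists (Theta y).1; first by exists y.
  by have := congr1 fst (Theta_star b' y); rewrite xy raddf0 bE /= cup0l j0 addr0.
- move=> chi eta.
  have [c cE] := surj (0, chi); have [d dE] := surj (0, eta).
  exists (star c d); last by rewrite Theta_star cE dE /= !add0r.
  by apply: HM; apply: hK; rewrite ?cE ?dE.
- apply/seteqP; split=> [b hb|b [c hc e]]; first by exists b.
  exact: mv hc _.
Qed.

(** * Classes of the representations [tilde X] *)

Section Twist.
Variables (n : nat) (Y : real_rep R G n).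
Let mx (x : Gam) : 'M[R]_n := (-1) ^+ x.2 *: Y x.1.
Fact twist_mx1 : mx 1%g = 1%:M.
Proof. by rewrite /mx expr0 scale1r rmx1. Qed.
Fact twist_mxM x y : mx (x * y)%g = mx x *m mx y.
Proof. by rewrite /mx -scalemxAl -scalemxAr scalerA -signD -rmxM. Qed.
Fact twist_mx_orth x : (mx x)^T *m mx x = 1%:M.
Proof.
rewrite /mx [(_ *: Y x.1)^T]linearZ /= -scalemxAl -scalemxAr scalerA -expr2 sqrr_sign scale1r.
exact: rmx_orth.
Qed.
Definition twist : real_rep R Gam n := RealRep twist_mx1 twist_mxM twist_mx_orth.
End Twist.

Definition real_tilde n (Y : real_rep R G n) : real_rep R Gam (n + n) :=
  real_rep_sum (twist Y) (twist (triv R G n)).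

Lemma tilde_real_form n (X : orth_rep C G n) (Y : real_rep R G n) :
  is_real_form X Y -> is_real_form (tilde X) (real_tilde Y).
Proof.
move=> [P [Pu PB PX]]; exists (block_mx P 0 0 1%:M); split.
- by rewrite unitmxE det_ublock det1 mulr1 -unitmxE.
- rewrite /= /tilde_form tr_block_mx !mulmx_block !trmx0 trmx1.
  by rewrite !mulmx0 !mul0mx !addr0 !add0r ?mulmx0 !mulmx1 PB !mul0mx -scalar_mx_block.
- move=> [g a]; rewrite /= /tilde_mx /sum_mx /= map_block_mx !map_mx0 -scalemxAl.
  rewrite !map_mxZ map_mx1 !rmorphXn /= rmorphN1 !mulmx_block.
  rewrite !mulmx0 !mul0mx !addr0 !add0r !mulmx1 mul1mx -scalemxAr -PX.
  by rewrite scale_block_mx !scaler0.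
Qed.

Variable w : stiefel_whitney R.

Let beta n (Y : real_rep R G n) : H2 Gam (funit C) := H2_map (sgn C) (w2 w (real_tilde Y)).

(** On G the signs disappear and the added summand is trivial, so it does not change [w2]. *)
Lemma Theta_beta1 n (Y : real_rep R G n) : (Theta (beta Y)).1 = j (w2 w Y).
Proof.
rewrite /beta; have [c ec] := cls_surj (w2 w (real_tilde Y)).
rewrite -ec H2_map_cls Theta_cls /=.
transitivity (j (H2_pull (@Defs.incl G) (cls c))).
  by rewrite H2_pull_cls /j H2_map_cls; congr cls; apply: val_inj.
rewrite ec -w2_pull.
have iso : real_rep_iso (real_rep_pull (@Defs.incl G) (real_tilde Y)) (real_rep_sum Y (triv R G n)).
  apply: real_rep_iso_eq => g.
  rewrite -[LHS]/(block_mx ((-1) ^+ 0%N *: Y g) 0 0 ((-1) ^+ 0%N *: 1%:M)).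
  by rewrite expr0 !scale1r.
have [t1 t2] := w_triv w G n.
by rewrite (w2_iso w iso) w2_sum t1 t2 cup0r !addr0.
Qed.

(** Here the representation is the sum of the lines [chi + pr] and [pr], with [pr] the projection to
    Z/2, and its [w2] is their cup product; the commutator of this cocycle at [(g, t)] is
    [chi g]. *)
Lemma Theta_beta_line chi : Theta (beta (line R chi)) = (0, chi).
Proof.
rewrite [LHS]surjective_pairing Theta_beta1 w2_line j0; congr pair.
pose psi := H1_pull fst chi + proj2 G.
have iso : real_rep_iso (real_tilde (line R chi)) (real_rep_sum (line R psi) (line R (proj2 G))).
  apply: real_rep_iso_eq => -[g a]; rewrite /= /sum_mx /=; congr block_mx.
    by rewrite scale_scalar_mx -signD addrC.
  by rewrite scalemx1.
rewrite /beta (w2_iso w iso) w2_sum !w2_line !w1_lineE add0r addr0 /cup H2_map_cls Theta_cls.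
apply: val_inj; apply/funext => g; apply: (@sgn_inj C).
rewrite -[LHS]/(sgn C (eps (Z2_map (sgn C) (cup_cocycle psi (proj2 G))) (Defs.incl g))) epsP.
rewrite -[X in X - _]/(sgn C ((chi g + 0) * 1)) -[X in _ - X]/(sgn C ((chi 1%g + 1) * 0)).
by rewrite mulr0 (raddf0 (sgn C)) subr0 mulr1 addr0.
Qed.

Section Complexify.
Variables (n : nat) (Y : real_rep R G n).
Let mx g : 'M[C]_n := map_mx rc (Y g).
Fact complexify_mx1 : mx 1%g = 1%:M. Proof. by rewrite /mx rmx1 map_mx1. Qed.
Fact complexify_mxM x y : mx (x * y)%g = mx x *m mx y.
Proof. by rewrite /mx rmxM map_mxM. Qed.
Fact complexify_isom x : (mx x)^T *m 1%:M *m mx x = 1%:M.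
Proof. by rewrite mulmx1 /mx map_trmx -map_mxM rmx_orth map_mx1. Qed.
(** Makes every real representation a real form, so that generators may be produced from real
    representations. *)
Definition complexify : orth_rep C G n :=
  OrthRep (trmx1 C n) (unitmx1 C n) complexify_mx1 complexify_mxM complexify_isom.
Lemma complexify_real_form : is_real_form complexify Y.
Proof.
by exists 1%:M; split=> [||g]; rewrite ?unitmx1 //= ?trmx1 ?mulmx1 ?mul1mx.
Qed.
End Complexify.

Lemma SW_generator n (Y : real_rep R G n) : SW G w (j (w2 w Y)).
Proof.
apply: sub_subgroup_generated; exists n, (complexify Y), Y => //.
exact: complexify_real_form.
Qed.

(** The cup product is [w2] of the sum of the two lines. *)
Lemma SW_cup chi eta : SW G w (j (cup chi eta)).
Proof.
have := SW_generator (real_rep_sum (line R chi) (line R eta)).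
by rewrite w2_sum !w2_line !w1_lineE add0r addr0.
Qed.

Lemma SW_plus_group : is_subgroup star 0 (SW_plus R G).
Proof.
apply: subgroup_generated_group;
  [exact: starA | exact: starC | exact: star0r | exact: starV].
Qed.

Lemma SW_plus_beta n (Y : real_rep R G n) : SW_plus R G (beta Y).
Proof.
apply: sub_subgroup_generated; exists n, (complexify Y).
by apply/(clifford_class_w2E w (tilde_real_form (complexify_real_form Y))).
Qed.

(** One inclusion is checked on generators. For the other, the classes of lines give all (0, chi),
    so [SW_plus] is itself a product, whose first factor contains every [j (w2 w Y)]. *)
Lemma SW_plusE : SW_plus R G = additive_product (SW G w).
Proof.
apply/seteqP; split.
  apply: subgroup_generated_min.
    by apply: product_star_subgroup; [exact: zmod_generated_group | exact: SW_cup].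
  move=> b [n [X]]; have [Y XY] := real_form_exists X.
  move/(clifford_class_w2E w (tilde_real_form XY)) => ->.
  rewrite /additive_product /mkset Theta_beta1; exact: SW_generator.
have [b b0|A [A1 A2 AE]] := star_subgroup_product SW_plus_group.
  have <- : beta (line R (Theta b).2) = b; last exact: SW_plus_beta.
  by apply: Theta_inj; rewrite Theta_beta_line -b0; case: (Theta b).
rewrite AE => b; apply: subgroup_generated_min => // a [n [X [Y _ ->]]].
rewrite -Theta_beta1.
suff : additive_product A (beta Y) by [].
by rewrite -AE; apply: SW_plus_beta.
Qed.

(** The generated subgroup is a product whose first factor contains all [j (cup chi eta)], and [DG]
    gives the smallest such product. *)
Lemma star_generated_DG : subgroup_generated star 0 [set b | exists chi, Theta b = (0, chi)] =
  additive_product (DG R G).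
Proof.
have D_cup chi eta : DG R G (j (cup chi eta)).
  by apply: sub_subgroup_generated; exists chi, eta.
apply/seteqP; split.
  apply: subgroup_generated_min.
    by apply: product_star_subgroup => //; apply: zmod_generated_group.
  move=> b [chi e]; rewrite /additive_product /mkset e -[_.1]/(0 : H2 G (funit C)).
  by have [D0 _ _] : is_subgroup +%R 0 (DG R G) := zmod_generated_group _.
have [|b b0|A [A1 A2 ->]] := @star_subgroup_product
    (subgroup_generated star 0 [set b | exists chi, Theta b = (0, chi)]).
- apply: subgroup_generated_group;
    [exact: starA | exact: starC | exact: star0r | exact: starV].
- apply: sub_subgroup_generated; exists (Theta b).2.
  by rewrite -b0; case: (Theta b).
- by move=> b; apply: subgroup_generated_min => // a [chi [eta ->]].
Qed.

End Main.

Theorem proposition3p12 (R : realType) (G : finGroupType)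
    (w : stiefel_whitney R) :
  let k := R[i] in
  let SWp : set (H2 (G * 'Z_2)%type (funit k)) := SW_plus R G in
  let SWG : set (H2 G (funit k)) := SW G w in
  let D : set (H2 G (funit k)) := DG R G in
  let K : set (H1 G 'Z_2) := setT in
  let L : set (H2 (G * 'Z_2)%type (funit k)) := Theta k G @^-1` (D `*` K) in
  (Theta k G @` SWp = SWG `*` K /\ is_subgroup +%R 0 SWp) /\
  [/\ D `<=` SWG,
      L `<=` SWp,
      is_subgroup (star k G) 0 L
    & L = subgroup_generated (star k G) 0
            [set b | exists chi : H1 G 'Z_2, Theta k G b = (0, chi)]].
Proof.
move=> k SWp SWG D K L.
have SWpE : SWp = additive_product SWG := SW_plusE G w.
have LE : L = additive_product D by apply/seteqP; split=> [b [] //|b hb]; split.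
have DSW : D `<=` SWG.
  apply: subgroup_generated_min; first exact: zmod_generated_group.
  by move=> a [chi [eta ->]]; apply: SW_cup.
have [S0 SD _] : is_subgroup +%R 0 SWG := zmod_generated_group _.
split; split=> //.
- rewrite SWpE; apply/seteqP; split=> [_ [b hb <-] //|p [hp _]].
  have [g gK kG] := Theta_bij k G; exists (g p); last exact: kG.
  by rewrite /additive_product /mkset kG.
(* [Theta] is additive for the ordinary law, so this is the preimage of a subgroup under a
   homomorphism. *)
- rewrite SWpE /additive_product; split=> [|x y hx hy|x hx]; rewrite /mkset.
  + by rewrite (raddf0 (Theta k G)).
  + by rewrite (raddfD (Theta k G)); apply: SD.
  + exists (- x); last by rewrite subrr.
    rewrite /mkset (raddfN (Theta k G)).
    exact: (zmod_subgroupN (zmod_generated_group _) hx).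
- by rewrite LE SWpE => b; apply: DSW.
- rewrite LE; apply: product_star_subgroup; first exact: zmod_generated_group.
  by move=> chi eta; apply: sub_subgroup_generated; exists chi, eta.
- by rewrite LE star_generated_DG.
Qed.
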